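(* Let $p$ be a prime, let $r\ge 2$ be an integer, and let $n=p^r$. Then for any field $k$, $$\operatorname{ed}_k(\operatorname{PGL}_n;p)\le p^{2r-1}-p^r+1.$$
   Context: Essential dimension: let $\mathcal F$ be a covariant functor from the category of field extensions $K/k$ to sets. For $a\in\mathcal F(K)$, $\operatorname{ed}_k(a)$ is the minimal value of $\operatorname{trdeg}_k(K_0)$ over intermediate fields $k\subset K_0\subset K$ such that $a$ lies in the image of $\mathcal F(K_0)\to\mathcal F(K)$. For a prime $p$, $\operatorname{ed}_k(a;p)$ is the minimum of $\operatorname{ed}_k(a_L)$ over all finite field extensions $L/K$ of degree prime to $p$, where $a_L$ is the image of $a$ in $\mathcal F(L)$. Then $\operatorname{ed}_k(\mathcal F;p)$ is the supremum of $\operatorname{ed}_k(a;p)$ over all $K/k$ and all $a\in\mathcal F(K)$. For an algebraic group $G$ over $k$, $\operatorname{ed}_k(G;p):=\operatorname{ed}_k(H^1(\ast,G);p)$, where $H^1(K,G)$ is the set of isomorphism classes of $G$-torsors over $K$. For $G=\operatorname{PGL}_n$, $H^1(K,\operatorname{PGL}_n)$ is the set of $K$-isomorphism classes of central simple $K$-algebras of degree $n$. *)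

(* Defs.v *)
From HB Require Import structures.
From mathcomp Require Import all_boot all_order all_algebra all_field.
From mathcomp Require Import mpoly.
From mathcomp Require Import boolp classical_sets reals ereal.

Set Implicit Arguments.
Unset Strict Implicit.
Unset Printing Implicit Defensive.

Import GRing.Theory.
Local Open Scope ring_scope.

Record fieldExt (k : fieldType) := FieldExt {
  ext_field :> fieldType;
  ext_emb : {rmorphism k -> ext_field} }.

Record extHom (k : fieldType) (E F : fieldExt k) := ExtHom {
  ext_fun :> {rmorphism E -> F};
  ext_funP : forall a : k, ext_fun (ext_emb E a) = ext_emb F a }.

Definition ext_id (k : fieldType) (E : fieldExt k) : extHom E E :=
  @ExtHom k E E idfun (fun=> erefl).

Fact ext_comp_subproof (k : fieldType) (E F G : fieldExt k)
    (g : extHom F G) (f : extHom E F) (a : k) :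
  (ext_fun g \o ext_fun f) (ext_emb E a) = ext_emb G a.
Proof. by rewrite /= !ext_funP. Qed.

Definition ext_comp (k : fieldType) (E F G : fieldExt k)
    (g : extHom F G) (f : extHom E F) : extHom E G :=
  @ExtHom k E G (ext_fun g \o ext_fun f) (ext_comp_subproof g f).

Record extFunctor (k : fieldType) := ExtFunctor {
  fobj :> fieldExt k -> Type;
  fmap : forall E F : fieldExt k, extHom E F -> fobj E -> fobj F;
  fmap_id : forall (E : fieldExt k) (a : fobj E), fmap (ext_id E) a = a;
  fmap_comp : forall (E F G : fieldExt k) (g : extHom F G) (f : extHom E F)
    (a : fobj E), fmap (ext_comp g f) a = fmap g (fmap f a) }.

Arguments fmap {k} _ {E F} _ _.

Definition alg_indep (k : fieldType) (E : fieldExt k) (d : nat)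
    (x : 'I_d -> E) : Prop :=
  forall P : {mpoly k[d]}, mmap (ext_emb E) x P = 0 -> P = 0.

(* The largest number of algebraically independent elements, +oo if unbounded.
   All values lie in N u {+oo}; [\bar R] only supplies infima and suprema. *)
Definition trdeg (R : realType) (k : fieldType) (E : fieldExt k) : \bar R :=
  ereal_sup [set (d%:R)%:E | d in
    [set d : nat | exists x : 'I_d -> E, alg_indep x]].

Section Subfield.
Variables (F : fieldType) (S : divringClosed F).

Inductive subfieldType := Subfield x & x \in S.
Definition subfield_val u := let: Subfield x _ := u in x.

HB.instance Definition _ := [isSub for subfield_val].
HB.instance Definition _ := [Choice of subfieldType by <:].
HB.instance Definition _ :=
  [SubChoice_isSubIntegralDomain of subfieldType by <:].
HB.instance Definition _ :=
  [SubIntegralDomain_isSubField of subfieldType by <:].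
End Subfield.

Record midField (k : fieldType) (K : fieldExt k) := MidField {
  mid_set : divringClosed K;
  mid_setP : forall a : k, ext_emb K a \in mid_set }.

Section MidField.
Variables (k : fieldType) (K : fieldExt k) (M : midField K).

Definition mid_emb (a : k) : subfieldType (mid_set M) :=
  Subfield (mid_setP M a).

Fact mid_emb_is_zmod_morphism : zmod_morphism mid_emb.
Proof. by move=> a b; apply: val_inj; rewrite rmorphB /= rmorphB. Qed.

Fact mid_emb_is_monoid_morphism : monoid_morphism mid_emb.
Proof.
by split=> [|a b]; apply: val_inj; rewrite ?rmorph1 ?rmorphM /= ?rmorph1 ?rmorphM.
Qed.

HB.instance Definition _ :=
  GRing.isZmodMorphism.Build k (subfieldType (mid_set M)) mid_emb
    mid_emb_is_zmod_morphism.
HB.instance Definition _ :=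
  GRing.isMonoidMorphism.Build k (subfieldType (mid_set M)) mid_emb
    mid_emb_is_monoid_morphism.

Definition mid_ext : fieldExt k := @FieldExt k (subfieldType (mid_set M)) mid_emb.

Definition mid_incl : extHom mid_ext K :=
  @ExtHom k mid_ext K (val : subfieldType (mid_set M) -> K) (fun=> erefl).
End MidField.

Section FiniteExt.
Variables (k : fieldType) (K : fieldExt k) (L : fieldExtType K).

Definition fin_ext : fieldExt k :=
  @FieldExt k L (in_alg L \o ext_emb K).

Definition fin_incl : extHom K fin_ext :=
  @ExtHom k K fin_ext (in_alg L) (fun=> erefl).
End FiniteExt.

Section EssentialDimension.
Variables (R : realType) (k : fieldType) (F : extFunctor k).
Local Open Scope classical_set_scope.

(* In [ed] and [ed_at] the infimum is over a nonempty subset of N u {+oo}, hence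
   a minimum. The comprehension [set e | exists .., ..] is used instead of an
   image because the indexing types are too large for [set]. *)
Definition ed (K : fieldExt k) (a : F K) : \bar R :=
  ereal_inf [set e | exists (M : midField K) (a0 : F (mid_ext M)),
    fmap F (mid_incl M) a0 = a /\ e = trdeg R (mid_ext M)].

Definition ed_at (p : nat) (K : fieldExt k) (a : F K) : \bar R :=
  ereal_inf [set e | exists L : fieldExtType K,
    coprime p (\dim {:L}) /\ e = ed (fmap F (fin_incl L) a)].

Definition ed_functor_at (p : nat) : \bar R :=
  ereal_sup [set e | exists (K : fieldExt k) (a : F K), e = ed_at p a].
End EssentialDimension.

(* [A] itself is nonzero, as any [falgType] is. *)
Definition simple_alg (K : fieldType) (A : falgType K) : Prop :=
  forall I : {vspace A}, ({:A} * I <= I)%VS -> (I * {:A} <= I)%VS ->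
    I = 0%VS \/ I = {:A}%VS.

Definition central_alg (K : fieldType) (A : falgType K) : Prop :=
  ('Z({:A}) = 1 :> {vspace A})%VS.

Record csa (K : fieldType) (n : nat) := CSA {
  csa_alg :> falgType K;
  csa_central : central_alg csa_alg;
  csa_simple : simple_alg csa_alg;
  csa_degree : \dim {:csa_alg} = (n ^ 2)%N }.

Definition alg_iso (K : fieldType) (A B : falgType K) : Prop :=
  exists phi : {lrmorphism A -> B}, bijective phi.

Lemma alg_isoI (K : fieldType) (A B : falgType K) (h : A -> B) :
  linear h -> monoid_morphism h -> bijective h -> alg_iso A B.
Proof.
move=> h_lin h_mul h_bij.
pose hl := GRing.isLinear.Build K A B _ h h_lin.
pose hm := GRing.isMonoidMorphism.Build A B h h_mul.
pose phi : {lrmorphism A -> B} := HB.pack h hl hm.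
by exists phi.
Qed.

Lemma alg_iso_refl (K : fieldType) (A : falgType K) : alg_iso A A.
Proof. by exists idfun; exists idfun. Qed.

Lemma alg_iso_sym (K : fieldType) (A B : falgType K) :
  alg_iso A B -> alg_iso B A.
Proof.
case=> phi [psi phiK psiK].
have phi_inj : injective phi := can_inj phiK.
apply: (@alg_isoI _ _ _ psi); last by exists phi.
- by move=> c x y; apply: phi_inj; rewrite linearP /= !psiK.
split=> [|x y]; apply: phi_inj; first by rewrite psiK rmorph1.
by rewrite rmorphM /= !psiK.
Qed.

Lemma alg_iso_trans (K : fieldType) (A B C : falgType K) :
  alg_iso A B -> alg_iso B C -> alg_iso A C.
Proof.
move=> [phi phi_bij] [psi psi_bij].
by exists (psi \o phi); apply: bij_comp.
Qed.

(* The algebra [A (x)_K L] along [f : K -> L]. The elements of a [K]-basis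
   [(e_i)] of [A] are an [L]-basis of it, with multiplication given by the
   structure constants of [A] transported by [f]. *)
Definition scalar_ext_type (K L : fieldType) (f : {rmorphism K -> L})
  (A : falgType K) : Type := 'rV[L]_(\dim {:A}).

Section ScalarExt.
Variables (K L : fieldType) (f : {rmorphism K -> L}) (A : falgType K).
Local Notation AL := (scalar_ext_type f A).

HB.instance Definition _ := Vector.on AL.

(* [a |-> a (x) 1] *)
Definition scalar_ext_in (a : A) : AL :=
  \row_i f (coord (vbasis {:A}) i a).

Definition scalar_ext_one : AL := scalar_ext_in 1.

Definition scalar_ext_mul (x y : AL) : AL :=
  \sum_i \sum_j (x ord0 i * y ord0 j) *:
    scalar_ext_in ((vbasis {:A})`_i * (vbasis {:A})`_j).

Local Notation e i := ((vbasis {:A})`_i).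
Local Notation "x ** y" := (scalar_ext_mul x y) (at level 40).

Fact scalar_ext_in_is_zmod_morphism : zmod_morphism scalar_ext_in.
Proof. by move=> a b; apply/rowP=> i; rewrite !mxE linearB rmorphB. Qed.

HB.instance Definition _ :=
  GRing.isZmodMorphism.Build A AL scalar_ext_in
    scalar_ext_in_is_zmod_morphism.

Lemma scalar_ext_inZ c a : scalar_ext_in (c *: a) = f c *: scalar_ext_in a.
Proof. by apply/rowP=> i; rewrite !mxE linearZ rmorphM. Qed.

Lemma scalar_ext_in_basis (i : 'I_(\dim {:A})) : scalar_ext_in (e i) = delta_mx ord0 i.
Proof.
apply/rowP=> j; rewrite !mxE coord_free ?(basis_free (vbasisP _)) //.
by rewrite rmorph_nat eqxx eq_sym.
Qed.

Lemma scalar_ext_sum (x : AL) :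
  x = \sum_i x ord0 i *: scalar_ext_in (e i).
Proof.
by rewrite {1}(row_sum_delta x); apply: eq_bigr => i _; rewrite scalar_ext_in_basis.
Qed.

Lemma scalar_ext_mul_linearr x : linear (scalar_ext_mul x).
Proof.
move=> c y z; rewrite /scalar_ext_mul scaler_sumr -big_split /=.
apply: eq_bigr => i _; rewrite scaler_sumr -big_split /=.
apply: eq_bigr => j _.
by rewrite !mxE mulrDr scalerDl scalerA mulrCA.
Qed.

Lemma scalar_ext_mul_linearl y : linear (scalar_ext_mul^~ y).
Proof.
move=> c x z; rewrite /scalar_ext_mul scaler_sumr -big_split /=.
apply: eq_bigr => i _; rewrite scaler_sumr -big_split /=.
apply: eq_bigr => j _.
by rewrite !mxE mulrDl scalerDl scalerA mulrA.
Qed.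

HB.instance Definition _ x := GRing.isLinear.Build L AL AL _
  (scalar_ext_mul x) (scalar_ext_mul_linearr x).

Definition scalar_ext_mulr y x := x ** y.
HB.instance Definition _ y := GRing.isLinear.Build L AL AL _
  (scalar_ext_mulr y) (scalar_ext_mul_linearl y).

Lemma scalar_ext_mul_suml I (r : seq I) c (u : I -> AL) y :
  (\sum_(i <- r) c i *: u i) ** y = \sum_(i <- r) c i *: (u i ** y).
Proof.
rewrite -/(scalar_ext_mulr y _) linear_sum.
by apply: eq_bigr => i _; rewrite linearZ.
Qed.

Lemma scalar_ext_mul_sumr I (r : seq I) c (u : I -> AL) y :
  y ** (\sum_(i <- r) c i *: u i) = \sum_(i <- r) c i *: (y ** u i).
Proof. by rewrite linear_sum; apply: eq_bigr => i _; rewrite linearZ. Qed.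

Lemma scalar_ext_inM a b : scalar_ext_in (a * b) = scalar_ext_in a ** scalar_ext_in b.
Proof.
rewrite {1}(coord_vbasis (memvf a)) {1}(coord_vbasis (memvf b)).
rewrite mulr_suml raddf_sum; apply: eq_bigr => i _.
rewrite mulr_sumr raddf_sum; apply: eq_bigr => j _.
by rewrite -scalerAl -scalerAr /= !scalar_ext_inZ scalerA !mxE.
Qed.

Fact scalar_ext_mulA : associative scalar_ext_mul.
Proof.
move=> x y z; rewrite (scalar_ext_sum x) !scalar_ext_mul_suml.
apply: eq_bigr => i _; congr (_ *: _).
rewrite (scalar_ext_sum y) scalar_ext_mul_sumr !scalar_ext_mul_suml.
rewrite scalar_ext_mul_sumr; apply: eq_bigr => j _; congr (_ *: _).
rewrite (scalar_ext_sum z) !scalar_ext_mul_sumr.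
by apply: eq_bigr => l _; rewrite -!scalar_ext_inM mulrA.
Qed.

Fact scalar_ext_mul1l : left_id scalar_ext_one scalar_ext_mul.
Proof.
move=> x; rewrite {1}(scalar_ext_sum x) scalar_ext_mul_sumr.
rewrite {2}(scalar_ext_sum x).
by apply: eq_bigr => i _; rewrite -scalar_ext_inM mul1r.
Qed.

Fact scalar_ext_mul1r : right_id scalar_ext_one scalar_ext_mul.
Proof.
move=> x; rewrite {1}(scalar_ext_sum x) scalar_ext_mul_suml.
rewrite {2}(scalar_ext_sum x).
by apply: eq_bigr => i _; rewrite -scalar_ext_inM mulr1.
Qed.

Fact scalar_ext_mulDl : left_distributive scalar_ext_mul +%R.
Proof. by move=> x y z; rewrite -!/(scalar_ext_mulr z _) linearD. Qed.

Fact scalar_ext_mulDr : right_distributive scalar_ext_mul +%R.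
Proof. by move=> x y z; rewrite linearD. Qed.

Lemma scalar_ext_in_inj : injective scalar_ext_in.
Proof.
move=> a b /rowP eq_ab.
rewrite (coord_vbasis (memvf a)) (coord_vbasis (memvf b)).
apply: eq_bigr => i _; congr (_ *: _).
by have := eq_ab i; rewrite !mxE => /fmorph_inj.
Qed.

Fact scalar_ext_one_neq0 : scalar_ext_one != 0.
Proof. by rewrite -(raddf0 scalar_ext_in) (inj_eq scalar_ext_in_inj) oner_neq0. Qed.

HB.instance Definition _ := GRing.Zmodule_isNzRing.Build AL
  scalar_ext_mulA scalar_ext_mul1l scalar_ext_mul1r
  scalar_ext_mulDl scalar_ext_mulDr scalar_ext_one_neq0.

Fact scalar_ext_scaleAl (c : L) (x y : AL) : c *: (x * y) = (c *: x) * y.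
Proof. by rewrite -[RHS]/(scalar_ext_mulr y _) linearZ. Qed.

HB.instance Definition _ := GRing.Lmodule_isLalgebra.Build L AL
  scalar_ext_scaleAl.

Fact scalar_ext_scaleAr (c : L) (x y : AL) : c *: (x * y) = x * (c *: y).
Proof. by rewrite -[RHS]/(scalar_ext_mul x _) linearZ. Qed.

HB.instance Definition _ := GRing.Lalgebra_isAlgebra.Build L AL
  scalar_ext_scaleAr.

HB.instance Definition _ := Algebra_isFalgebra.Build L AL.

Fact scalar_ext_in_is_monoid_morphism : monoid_morphism scalar_ext_in.
Proof. by split=> // a b; apply: scalar_ext_inM. Qed.

HB.instance Definition _ :=
  GRing.isMonoidMorphism.Build A AL scalar_ext_in
    scalar_ext_in_is_monoid_morphism.

Lemma dim_scalar_ext : \dim {:AL} = \dim {:A}.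
Proof. by rewrite dimvf /dim /= mul1n. Qed.

Definition scalar_ext : falgType L := scalar_ext_type f A.
End ScalarExt.

(* [phi : A -> B] exhibits [B] as an extension of scalars of [A] along [f] *)
Definition is_scalar_ext (K L : fieldType) (f : K -> L) (A : falgType K)
    (B : falgType L) (phi : A -> B) : Prop :=
  [/\ zmod_morphism phi, monoid_morphism phi,
      forall c a, phi (c *: a) = f c *: phi a,
      \dim {:A} = \dim {:B} &
      forall b : B, exists (m : nat) (x : 'I_m -> L) (a : 'I_m -> A),
        b = \sum_i x i *: phi (a i)].

Lemma scalar_ext_inP (K L : fieldType) (f : {rmorphism K -> L})
  (A : falgType K) :
  @is_scalar_ext K L f A (scalar_ext f A) (@scalar_ext_in K L f A).
Proof.
split.
- exact: scalar_ext_in_is_zmod_morphism.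
- exact: scalar_ext_in_is_monoid_morphism.
- exact: scalar_ext_inZ.
- by rewrite dim_scalar_ext.
move=> b; exists (\dim {:A}), (fun i => b ord0 i), (fun i => (vbasis {:A})`_i).
exact: scalar_ext_sum.
Qed.

Lemma is_scalar_ext_comp (K L M : fieldType) (f : K -> L)
    (g : {rmorphism L -> M}) (A : falgType K) (B : falgType L)
    (C : falgType M) (phi : A -> B) (psi : B -> C) :
  is_scalar_ext f phi -> is_scalar_ext g psi ->
  is_scalar_ext (g \o f) (psi \o phi).
Proof.
move=> [phiB [phi1 phiM] phiZ dimAB phiT] [psiB [psi1 psiM] psiZ dimBC psiT].
pose psia := GRing.isZmodMorphism.Build B C psi psiB.
pose psi' : {additive B -> C} := HB.pack psi psia.
split.
- by move=> a b; rewrite /= phiB psiB.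
- by split=> [|a b]; rewrite /= ?phi1 ?psi1 ?phiM ?psiM.
- by move=> c a; rewrite /= phiZ psiZ.
- by rewrite dimAB.
move=> c; have [m [x [b ->]]] := psiT c.
have /choice [S defS] : forall i, exists S : seq (L * A),
    b i = \sum_(u <- S) u.1 *: phi u.2.
  move=> i; have [l [y [a ->]]] := phiT (b i).
  exists [seq (y j, a j) | j <- enum 'I_l].
  by rewrite big_map big_enum.
pose T := flatten [seq [seq (x i * g u.1, u.2) | u <- S i] | i <- enum 'I_m].
exists (size T), (fun i => (tnth (in_tuple T) i).1),
  (fun i => (tnth (in_tuple T) i).2).
rewrite -(big_tnth _ _ T xpredT (fun u => u.1 *: (psi \o phi) u.2)).
rewrite big_flatten big_map big_enum; apply: eq_bigr => i _.
rewrite defS big_map -[psi _]/(psi' _) raddf_sum scaler_sumr.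
by apply: eq_bigr => u _; rewrite /= psiZ scalerA.
Qed.

Lemma dim_linear_inj (K : fieldType) (A B : falgType K)
  (h : {linear A -> B}) : injective h -> (\dim {:A} <= \dim {:B})%N.
Proof.
move=> h_inj; have kerh : lker (linfun h) == 0%VS.
  by apply/lker0P => a b; rewrite !lfunE; apply: h_inj.
rewrite -(@limg_dim_eq _ _ _ (linfun h)); first exact/dimvS/subvf.
by rewrite (eqP kerh) capv0.
Qed.

Lemma alg_iso_dim (K : fieldType) (A B : falgType K) :
  alg_iso A B -> \dim {:A} = \dim {:B}.
Proof.
move=> isoAB; apply/eqP; rewrite eqn_leq; apply/andP; split.
  by have [phi /bij_inj] := isoAB; apply: dim_linear_inj.
by have [phi /bij_inj] := alg_iso_sym isoAB; apply: dim_linear_inj.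
Qed.

Lemma is_scalar_ext_iso (K : fieldType) (A B : falgType K)
    (phi : {lrmorphism A -> B}) :
  bijective phi -> is_scalar_ext idfun phi.
Proof.
move=> phi_bij; split.
- exact: raddfB.
- by split=> [|a b]; rewrite ?rmorph1 ?rmorphM.
- by move=> c a; rewrite linearZ.
- by apply: alg_iso_dim; exists phi.
have [psi phiK psiK] := phi_bij.
by move=> b; exists 1%N, (fun=> 1), (fun=> psi b); rewrite big_ord1 scale1r psiK.
Qed.

Lemma scalar_ext_iso (K L : fieldType) (f : {rmorphism K -> L})
    (A : falgType K) (B : falgType L) (phi : A -> B) :
  is_scalar_ext f phi -> alg_iso (scalar_ext f A) B.
Proof.
move=> [phiB [phi1 phiM] phiZ dimAB phiT].
pose phia := GRing.isZmodMorphism.Build A B phi phiB.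
pose phi' : {additive A -> B} := HB.pack phi phia.
pose psi (x : scalar_ext f A) : B := \sum_i x ord0 i *: phi (vbasis {:A})`_i.
have psi_lin : linear psi.
  move=> c x y; rewrite /psi scaler_sumr -big_split /=.
  by apply: eq_bigr => i _; rewrite !mxE scalerDl scalerA.
have psi_in a : psi (scalar_ext_in f a) = phi a.
  rewrite {2}(coord_vbasis (memvf a)) -[RHS]/(phi' _) raddf_sum.
  by apply: eq_bigr => i _; rewrite !mxE /= phiZ.
pose psil := GRing.isLinear.Build L (scalar_ext f A) B _ psi psi_lin.
pose psi' : {linear scalar_ext f A -> B} := HB.pack psi psil.
have psi_comb (I : Type) (r : seq I) c (u : I -> scalar_ext f A) :
    psi (\sum_(i <- r) c i *: u i) = \sum_(i <- r) c i *: psi (u i).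
  by rewrite -[psi _]/(psi' _) linear_sum; apply: eq_bigr => i _; rewrite linearZ.
have psi_surj b : exists x, psi x = b.
  have [m [y [a ->]]] := phiT b; exists (\sum_i y i *: scalar_ext_in f (a i)).
  by rewrite psi_comb; apply: eq_bigr => i _; rewrite psi_in.
have imgpsi : limg (linfun psi') = fullv.
  apply/vspaceP => b; rewrite memvf; have [x <-] := psi_surj b.
  by rewrite -[psi x]/(psi' x) -(lfunE psi') memv_img ?memvf.
have psi_inj : injective psi.
  have := limg_ker_dim (linfun psi') fullv.
  rewrite imgpsi dim_scalar_ext -dimAB capfv -{2}[\dim {:A}]add0n => /addIn/eqP.
  by rewrite dimv_eq0 => /lker0P kerpsi x y eq_xy; apply: kerpsi; rewrite !lfunE.
have psi1 : psi 1 = 1 by rewrite -phi1 -psi_in.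
apply: (@alg_isoI _ _ _ psi) => //; last first.
  have [psi_inv psi_invK] := choice psi_surj.
  by exists psi_inv => // x; apply: psi_inj; rewrite psi_invK.
split=> // x y; rewrite [in LHS](scalar_ext_sum x) [in RHS](scalar_ext_sum x).
rewrite [in RHS]psi_comb !mulr_suml.
under eq_bigr do rewrite -scalerAl.
rewrite psi_comb; apply: eq_bigr => i _; rewrite -scalerAl; congr (_ *: _).
rewrite [in LHS](scalar_ext_sum y) [in RHS](scalar_ext_sum y).
rewrite [in RHS]psi_comb !mulr_sumr.
under eq_bigr do rewrite -scalerAr.
rewrite psi_comb; apply: eq_bigr => j _; rewrite -scalerAr; congr (_ *: _).
by rewrite -rmorphM !psi_in phiM.
Qed.

Lemma scalar_ext_alg_iso (K L : fieldType) (f : {rmorphism K -> L})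
    (A B : falgType K) :
  alg_iso A B -> alg_iso (scalar_ext f A) (scalar_ext f B).
Proof.
case=> phi phi_bij; apply: scalar_ext_iso.
exact: is_scalar_ext_comp (is_scalar_ext_iso phi_bij) (scalar_ext_inP f B).
Qed.

Section ScalarExtCSA.
Variables (K L : fieldType) (f : {rmorphism K -> L}) (A : falgType K).
Hypotheses (A_central : central_alg A) (A_simple : simple_alg A).
Local Notation AL := (scalar_ext f A).
Local Notation iota := (@scalar_ext_in K L f A).

Lemma csa_scalar (a : A) : (forall b, a * b = b * a) -> exists c : K, a = c%:A.
Proof.
move=> ab; have : a \in 'Z({:A})%VS.
  by rewrite memv_cap memvf; apply/centvP => b _; rewrite ab.
by rewrite A_central => /vlineP.
Qed.

Lemma ex_vspace (T : A -> Prop) : T 0 ->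
  (forall c a b, T a -> T b -> T (c *: a + b)) ->
  exists U : {vspace A}, forall a, a \in U <-> T a.
Proof.
move=> T0 Tlin.
pose P d := `[< exists U : {vspace A}, \dim U = d /\ forall a, a \in U -> T a >].
have exP : exists d, P d.
  exists 0%N; apply/asboolP; exists 0%VS; split; first exact: dimv0.
  by move=> a; rewrite memv0 => /eqP ->.
have leP d : P d -> (d <= \dim {:A})%N.
  by move=> /asboolP [U [<- _]]; apply/dimvS/subvf.
case: (ex_maxnP exP leP) => d /asboolP [U [dimU UT]] maxd.
exists U => a; split=> [/UT //|Ta]; rewrite memvE.
suff : (\dim (U + <[a]>) <= \dim U)%N.
  move=> le_dim; apply: (subv_trans (addvSr U <[a]>)).
  by have /eqP <- : (U == U + <[a]>)%VS by rewrite eqEdim addvSl.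
rewrite dimU; apply: maxd; apply/asboolP; exists (U + <[a]>)%VS; split=> // b.
by move=> /memv_addP [u Uu [_ /vlineP [c ->] ->]]; rewrite addrC; apply: Tlin => //; apply: UT.
Qed.

Lemma simple_ideal (T : A -> Prop) : T 0 ->
  (forall c a b, T a -> T b -> T (c *: a + b)) ->
  (forall a b, T b -> T (a * b)) -> (forall a b, T a -> T (a * b)) ->
  (exists2 a, a != 0 & T a) -> T 1.
Proof.
move=> T0 Tlin Tl Tr [a a_neq0 Ta]; have [U defU] := ex_vspace T0 Tlin.
case: (A_simple (I := U)).
- by apply/prodvP => x y _ /defU Ty; apply/defU/Tl.
- by apply/prodvP => x y /defU Tx _; apply/defU/Tr.
- by move=> U0; move/defU: Ta; rewrite U0 memv0 (negPf a_neq0).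
by move=> UT; apply/defU; rewrite UT memvf.
Qed.

Definition Kfree r (c : 'I_r -> L) :=
  forall k : 'I_r -> K, \sum_i f (k i) * c i = 0 -> forall i, k i = 0.

Lemma Kfree_scalar_ext r (c : 'I_r -> L) (a : 'I_r -> A) :
  Kfree c -> \sum_i c i *: iota (a i) = 0 -> forall i, a i = 0.
Proof.
move=> c_free /rowP sum0 i; rewrite (coord_vbasis (memvf (a i))).
rewrite big1 // => j _; suff -> : coord (vbasis {:A}) j (a i) = 0 by rewrite scale0r.
apply: (c_free (fun i => coord (vbasis {:A}) j (a i))).
have := sum0 j; rewrite summxE !mxE => sj; apply: (etrans _ sj); apply: eq_bigr => l _.
by rewrite !mxE mulrC.
Qed.

Lemma shorten r (c : 'I_r.+1 -> L) (a : 'I_r.+1 -> A) (k : 'I_r.+1 -> K) j :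
  \sum_i f (k i) * c i = 0 -> k j != 0 ->
  exists b : 'I_r -> A,
    \sum_i c i *: iota (a i) = \sum_i c (lift j i) *: iota (b i).
Proof.
move=> rel kj; exists (fun i => a (lift j i) - ((k j)^-1 * k (lift j i)) *: a j).
have defc : c j = - \sum_i f ((k j)^-1 * k (lift j i)) * c (lift j i).
  move: rel; rewrite (bigD1_ord j) //= => /eqP; rewrite addr_eq0 => /eqP rel.
  have fkj : f (k j) != 0 by rewrite fmorph_eq0.
  apply: (mulfI fkj); rewrite rel mulrN mulr_sumr; congr (- _).
  by apply: eq_bigr => i _; rewrite mulrA -rmorphM mulVKf.
rewrite (bigD1_ord j) //= defc scaleNr scaler_suml addrC -sumrB.
apply: eq_bigr => i _.
by rewrite raddfB /= scalar_ext_inZ scalerBr scalerA mulrC.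
Qed.

Lemma not_Kfree r (c : 'I_r -> L) : ~ Kfree c ->
  exists (k : 'I_r -> K) j, \sum_i f (k i) * c i = 0 /\ k j != 0.
Proof.
move=> /existsNP [k /not_implyP [rel /existsNP [j kj]]].
by exists k, j; split=> //; apply/eqP.
Qed.

Lemma min_repr (x : AL) : exists r (c : 'I_r -> L) (a : 'I_r -> A),
  Kfree c /\ x = \sum_i c i *: iota (a i).
Proof.
have [r [c [a]]] : exists r (c : 'I_r -> L) (a : 'I_r -> A),
    x = \sum_i c i *: iota (a i).
  by do 3!eexists; apply: scalar_ext_sum.
elim: r c a => [|r IHr] c a defx.
  by exists 0%N, c, a; split=> // k _ [].
have [c_free | /not_Kfree [k [j [rel kj]]]] := pselect (Kfree c).
  by exists r.+1, c, a.
have [b defx'] := shorten a rel kj.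
by apply: (IHr (fun i => c (lift j i)) b); rewrite defx defx'.
Qed.

Lemma scalar_ext_central : central_alg AL.
Proof.
apply/vspaceP => x; apply/idP/idP; last first.
  move=> /vlineP [c ->]; rewrite memv_cap memvf; apply/centvP => y _.
  by rewrite -scalerAl -scalerAr mul1r mulr1.
rewrite memv_cap memvf => /centvP x_comm.
have [r [c [a [c_free defx]]]] := min_repr x.
have a_comm i b : a i * b = b * a i.
  apply/eqP; rewrite -subr_eq0; apply/eqP.
  apply: (Kfree_scalar_ext (a := fun i => a i * b - b * a i) c_free).
  transitivity (x * iota b - iota b * x); last by rewrite x_comm ?memvf ?subrr.
  rewrite defx mulr_suml mulr_sumr -sumrB; apply: eq_bigr => l _.
  by rewrite raddfB /= !rmorphM /= scalerBr scalerAl scalerAr.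
have [k defa] := choice (fun i => csa_scalar (a_comm i)).
apply/vlineP; exists (\sum_i c i * f (k i)); rewrite defx scaler_suml.
by apply: eq_bigr => i _; rewrite defa scalar_ext_inZ rmorph1 scalerA.
Qed.

Lemma scalar_ext_simple : simple_alg AL.
Proof.
move=> J /prodvP Jl /prodvP Jr.
have [-> | J_neq0] := eqVneq J 0%VS; [by left | right].
suff J1 : 1 \in J.
  apply/vspaceP => x; rewrite memvf -[x]mulr1.
  by rewrite Jl ?memvf.
pose P r := `[< exists (c : 'I_r -> L) (a : 'I_r -> A),
  \sum_i c i *: iota (a i) \in J /\ \sum_i c i *: iota (a i) != 0 >].
have exP : exists r, P r.
  exists (\dim {:A}); apply/asboolP.
  exists (fun i => vpick J ord0 i), (fun i => (vbasis {:A})`_i).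
  by rewrite -[\sum_i _]scalar_ext_sum memv_pick vpick0.
case: (ex_minnP exP) => -[|r] /asboolP [c [a [Jx x_neq0]]] minr.
  by rewrite big_ord0 eqxx in x_neq0.
have c_free : Kfree c.
  apply: contrapT => /not_Kfree [k [j [rel kj]]].
  have [b def_x] := shorten a rel kj; suff /minr : P r by rewrite ltnn.
  by apply/asboolP; exists (c \o lift j), b; rewrite -def_x.
have a0_neq0 : a ord0 != 0.
  apply/eqP => a0; suff /minr : P r by rewrite ltnn.
  apply/asboolP; exists (c \o lift ord0), (a \o lift ord0).
  by move: Jx x_neq0; rewrite big_ord_recl a0 raddf0 scaler0 add0r.
pose T (t : A) := exists b : 'I_r.+1 -> A,
  b ord0 = t /\ \sum_i c i *: iota (b i) \in J.
have [] : T 1.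
  apply: simple_ideal.
  - exists (fun=> 0); split=> //.
    by rewrite big1 ?mem0v // => i _; rewrite raddf0 scaler0.
  - move=> k _ _ [b [<- Jb]] [b' [<- Jb']].
    exists (fun i => k *: b i + b' i); split=> //.
    rewrite (_ : \sum_i _ = f k *: (\sum_i c i *: iota (b i))
        + \sum_i c i *: iota (b' i)); first by rewrite memvD ?memvZ.
    rewrite scaler_sumr -big_split; apply: eq_bigr => i _.
    by rewrite raddfD /= scalar_ext_inZ scalerDr !scalerA mulrC.
  - move=> t _ [b [<- Jb]]; exists (fun i => t * b i); split=> //.
    rewrite (_ : \sum_i _ = iota t * \sum_i c i *: iota (b i)).
      by rewrite Jl ?memvf.
    by rewrite mulr_sumr; apply: eq_bigr => i _; rewrite rmorphM scalerAr.
  - move=> _ t [b [<- Jb]]; exists (fun i => b i * t); split=> //.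
    rewrite (_ : \sum_i _ = (\sum_i c i *: iota (b i)) * iota t).
      by rewrite Jr ?memvf.
    by rewrite mulr_suml; apply: eq_bigr => i _; rewrite rmorphM scalerAl.
  by exists (a ord0) => //; exists a.
move=> b [b0 Jb].
have b_comm t i : b i * t = t * b i.
  apply/eqP; rewrite -subr_eq0; apply/eqP.
  apply: (Kfree_scalar_ext (a := fun i => b i * t - t * b i) c_free).
  apply: contrapT => /eqP d_neq0; suff /minr : P r by rewrite ltnn.
  apply/asboolP; exists (c \o lift ord0),
    (fun i => b (lift ord0 i) * t - t * b (lift ord0 i)).
  move: (d_neq0); rewrite {1}big_ord_recl b0 mul1r mulr1 subrr raddf0 scaler0 add0r.
  move=> d'_neq0; split=> //; clear d_neq0 d'_neq0.
  have -> : \sum_(i < r) (c \o lift ord0) i *: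
      iota (b (lift ord0 i) * t - t * b (lift ord0 i)) =
      \sum_i c i *: iota (b i * t - t * b i).
    by rewrite big_ord_recl b0 mul1r mulr1 subrr raddf0 scaler0 add0r.
  have -> : \sum_i c i *: iota (b i * t - t * b i) =
      (\sum_i c i *: iota (b i)) * iota t - iota t * (\sum_i c i *: iota (b i)).
    rewrite mulr_suml mulr_sumr -sumrB; apply: eq_bigr => l _.
    by rewrite raddfB /= !rmorphM /= scalerBr scalerAl scalerAr.
  by rewrite memvB //; [apply: Jr | apply: Jl]; rewrite ?memvf.
have [k defb] := choice (fun i => csa_scalar (b_comm^~ i)).
pose z := \sum_i c i * f (k i).
have defz : \sum_i c i *: iota (b i) = z%:A.
  rewrite scaler_suml; apply: eq_bigr => i _.
  by rewrite defb scalar_ext_inZ rmorph1 scalerA.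
have z_neq0 : z != 0.
  apply: contra_neq (oner_neq0 A) => z0; rewrite -b0.
  by apply: (Kfree_scalar_ext c_free); rewrite defz z0 scale0r.
by rewrite -(scalerK z_neq0 1) memvZ // -defz.
Qed.
End ScalarExtCSA.

Definition csa_ext (K L : fieldType) (f : {rmorphism K -> L}) (n : nat)
    (A : csa K n) : csa L n :=
  @CSA L n (scalar_ext f A)
    (@scalar_ext_central K L f A (csa_central A))
    (@scalar_ext_simple K L f A (csa_central A) (@csa_simple K n A))
    (etrans (dim_scalar_ext f A) (csa_degree A)).

Definition iso_class (K : fieldType) (n : nat) (A : csa K n) : csa K n -> Prop :=
  fun B => alg_iso A B.

(* An isomorphism class is represented by its membership predicate, so that
   equality in [csa_class] is isomorphism (see [class_ofP]). *)
Definition csa_class (K : fieldType) (n : nat) : Type :=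
  {C : csa K n -> Prop | exists A : csa K n, C = iso_class A}.

Definition class_of (K : fieldType) (n : nat) (A : csa K n) : csa_class K n :=
  exist _ (iso_class A) (ex_intro _ A erefl).

Lemma class_ofP (K : fieldType) (n : nat) (A B : csa K n) :
  class_of A = class_of B <-> alg_iso A B.
Proof.
split=> [eqAB | isoAB].
  have : sval (class_of A) B by rewrite eqAB; apply: alg_iso_refl.
  by [].
apply: eq_exist; apply/funext => C; apply/propext; split=> [isoAC | isoBC].
  exact: alg_iso_trans (alg_iso_sym isoAB) isoAC.
exact: alg_iso_trans isoAB isoBC.
Qed.

Lemma class_of_surj (K : fieldType) (n : nat) (C : csa_class K n) :
  exists A, C = class_of A.
Proof. by case: C => C [A defC]; exists A; apply: eq_exist. Qed.

Section ClassExt.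
Variables (K L : fieldType) (f : {rmorphism K -> L}) (n : nat).

Fact class_ext_subproof (C : csa_class K n) : exists A : csa L n,
  (fun B : csa L n => exists2 A0, sval C A0 & alg_iso (csa_ext f A0) B) =
  iso_class A.
Proof.
have [A ->] := class_of_surj C; exists (csa_ext f A).
apply/funext => B; apply/propext; split=> [[A0 isoA isoB] | isoB].
  exact: alg_iso_trans (scalar_ext_alg_iso f isoA) isoB.
by exists A; first exact: alg_iso_refl.
Qed.

Definition class_ext (C : csa_class K n) : csa_class L n :=
  exist _ _ (class_ext_subproof C).

Lemma class_extE (A : csa K n) : class_ext (class_of A) = class_of (csa_ext f A).
Proof.
apply: eq_exist; apply/funext => B; apply/propext; split=> [[A0 isoA isoB] | isoB].
  exact: alg_iso_trans (scalar_ext_alg_iso f isoA) isoB.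
by exists A; first exact: alg_iso_refl.
Qed.
End ClassExt.

Lemma class_ext_id (k : fieldType) (n : nat) (E : fieldExt k)
  (C : csa_class E n) : class_ext (ext_id E) C = C.
Proof.
have [A ->] := class_of_surj C; rewrite class_extE; apply/class_ofP.
apply: (@scalar_ext_iso _ _ _ A A idfun).
exact: (@is_scalar_ext_iso _ A A idfun (Bijective (fun=> erefl) (fun=> erefl))).
Qed.

Lemma class_ext_comp (k : fieldType) (n : nat) (E F G : fieldExt k)
    (g : extHom F G) (f : extHom E F) (C : csa_class E n) :
  class_ext (ext_comp g f) C = class_ext g (class_ext f C).
Proof.
have [A ->] := class_of_surj C; rewrite !class_extE; apply/class_ofP.
apply: scalar_ext_iso.
exact: is_scalar_ext_comp (scalar_ext_inP f A) (scalar_ext_inP g _).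
Qed.

(* [PGL_n]-torsors over [K] are taken as classes of central simple [K]-algebras
   of degree [n]. *)
Definition H1_PGL (k : fieldType) (n : nat) : extFunctor k :=
  @ExtFunctor k (fun K => csa_class K n) (fun E F f => @class_ext E F f n)
    (@class_ext_id k n) (@class_ext_comp k n).

Definition ed_PGL (R : realType) (k : fieldType) (n p : nat) : \bar R :=
  ed_functor_at R (H1_PGL k n) p.

(* Main.v *)
Require Import Defs.
From HB Require Import structures.
From mathcomp Require Import all_boot all_order all_algebra all_fingroup all_solvable all_field.
From mathcomp Require Import mpoly boolp.

(* After an extension of degree prime to [p], a central simple algebra [A] of
   degree [n = p ^ r] contains an etale algebra of dimension [n] whose [n]
   geometric idempotents [e_i] are permuted by a [p]-group.  Such a group preserves
   a partition of the indices into [p] blocks of size [n / p], up to a cyclic shift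
   of the blocks, hence also the set [R] of the pairs [(i, j)] with [j] in the block
   following that of [i].  Choose [z] in [A] generically, let [a] be the sum of the
   [e_i z e_j] over [R], and [th] the sum of the [e_i a^p e_i]; both are rational.
   Over a splitting field, conjugation by a diagonal matrix turns the entries of [a]
   along a spanning tree of [R] into [1], so that [a] and [th] have entries in a
   field generated by [#|R| - (n - 1) = n ^ 2 / p - n + 1] elements.  Since [r >= 2],
   the diagonal entries of [a^p] are distinct, so [a] and [th] generate [A]; as
   the trace form has values in the intersection [M] of that field with the centre
   of [A], the elements of [A] with entries in the field form an algebra over [M]
   from which [A] is obtained by extension of scalars.  Genericity needs an
   infinite centre; a finite one has transcendence degree [0] over [k]. *)

Set Implicit Arguments.
Unset Strict Implicit.
Unset Printing Implicit Defensive.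

Import GRing.Theory.
Local Open Scope ring_scope.

(** * Transcendence degree *)

(** The extension of degree prime to [p] is the fixed field of a Sylow [p]-subgroup of the Galois
    group of a separable polynomial of degree [n]. As [a] has support in [R], a power of [a] can
    have nonzero diagonal entries only when the exponent is a multiple of [p]; this is why [th] is
    made from [a^p]. The [i]-th diagonal entry of [a^p] sums over the closed walks of length [p]
    from [i]. For [r >= 2] a block has more than one element, so some such walk avoids any given
    other index and the entries differ generically; for [r = 1] they would all be the same cyclic
    product. The obstacle to descent is that the diagonal conjugation need not be compatible with
    the Galois action, so that the field generated by the remaining entries need not be Galois
    stable and one cannot simply take invariants. Traces, however, are both unchanged by the
    conjugation and rational, and the trace form is nondegenerate: structure constants in [M] come
    from solving a linear system with coefficients in [M]. *)

Lemma msizeM_le_deg (F : fieldType) n (p q : {mpoly F[n]}) a b :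
  (msize p <= a.+1)%N -> (msize q <= b.+1)%N -> (msize (p * q) <= (a + b).+1)%N.
Proof.
move=> pa qb; have [->|p0] := eqVneq p 0; first by rewrite mul0r msize0.
have [->|q0] := eqVneq q 0; first by rewrite mulr0 msize0.
rewrite msizeM //; move: p0 q0; rewrite -!msize_poly_eq0 -!lt0n.
case: (msize p) pa => // x; case: (msize q) qb => // y; rewrite !ltnS => yb xa _ _.
by rewrite addSn addnS /= ltnS leq_add.
Qed.

Lemma msizeX_le_deg (F : fieldType) n (p : {mpoly F[n]}) a k :
  (msize p <= a.+1)%N -> (msize (p ^+ k) <= (k * a).+1)%N.
Proof.
move=> pa; elim: k => [|k IHk]; first by rewrite expr0 msize1.
by rewrite exprS mulSn; apply: msizeM_le_deg.
Qed.

Lemma msize_prod_le_deg (F : fieldType) n (I : finType) (p : I -> {mpoly F[n]}) a :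
  (forall i, msize (p i) <= a.+1)%N -> (msize (\prod_i p i) <= (#|I| * a).+1)%N.
Proof.
move=> pa; rewrite -sum_nat_const.
apply: (big_ind2 (fun (x : {mpoly F[n]}) y => msize x <= y.+1)%N) => //.
  by rewrite msize1.
by move=> x1 x2 y1 y2; apply: msizeM_le_deg.
Qed.

(** The left side grows only like [s ^ N]: any [s] above [e.+1 ^ N] works, since
    [(s * e).+1 <= s * e.+1]. *)
Lemma ltn_growth N e : exists s, ((s * e).+1 ^ N < s ^ N.+1)%N.
Proof.
have [s lt_s] : exists s, (e.+1 ^ N < s)%N by exists (e.+1 ^ N).+1.
exists s; have les : ((s * e).+1 <= s * e.+1)%N.
  by rewrite mulnS -add1n leq_add2r (leq_trans _ lt_s).
apply: (@leq_ltn_trans ((s * e.+1) ^ N)%N); first by case: (N) => [|M]; rewrite ?expn0 ?leq_exp2r.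
by rewrite expnMn expnSr ltn_pmul2l ?expn_gt0 (leq_ltn_trans _ lt_s).
Qed.

(** The subfield of [F] generated by the image of [k] and the [y i], written as quotients of
    polynomial values so that denominators can be cleared. *)
Definition rat_in (k F : fieldType) (f : {rmorphism k -> F}) N (y : 'I_N -> F) (c : F) :=
  exists P Q : {mpoly k[N]}, mmap f y Q != 0 /\ c = mmap f y P / mmap f y Q.

(* Monomials of degree [< s] in each of the [x_i], multiplied by a common
   denominator, are polynomials in [y] of degree [O(s)]: for [N < d] there are
   more of the former than the latter space has dimensions. *)
Lemma rat_in_alg_dep (k F : fieldType) (f : {rmorphism k -> F}) N d
    (y : 'I_N -> F) (x : 'I_d -> F) :
  (forall i, rat_in f y (x i)) -> (N < d)%N ->
  exists2 P : {mpoly k[d]}, P != 0 & mmap f x P = 0.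
Proof.
move=> xy ltNd.
have [P xP] := choice xy; have [Q xPQ] := choice xP.
pose D := (\max_i maxn (msize (P i)) (msize (Q i)))%N.
have PD i : (msize (P i) <= D.+1)%N.
  apply/leqW/(leq_trans _ (leq_bigmax i)); exact: leq_maxl.
have QD i : (msize (Q i) <= D.+1)%N.
  apply/leqW/(leq_trans _ (leq_bigmax i)); exact: leq_maxr.
(* [W m] below has [d] factors, each of degree at most [s * D]. *)
pose e := (d * D)%N; have [s lt_s] := ltn_growth N e.
pose mon : finType := {ffun 'I_d -> 'I_s}.
pose box : finType := {ffun 'I_N -> 'I_(s * e).+1}.
pose W (m : mon) := \prod_i (P i ^+ m i * Q i ^+ (s - m i)).
have Wdeg m : (msize (W m) <= (s * e).+1)%N.
  rewrite /e mulnCA -[X in (X * (s * _))%N]card_ord; apply: msize_prod_le_deg => i.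
  have -> : (s * D = m i * D + (s - m i) * D)%N by rewrite -mulnDl subnKC // ltnW.
  by apply: msizeM_le_deg; apply: msizeX_le_deg.
pose A := \matrix_(i < #|mon|, j < #|box|)
  (W (enum_val i))@_[multinom (enum_val j l : nat) | l < N].
have [u uA u0] : exists2 u : 'rV_#|mon|, u *m A = 0 & u != 0.
  have : kermx A != 0.
    rewrite kermx_eq0 /row_free neq_ltn; apply/orP; left.
    apply: leq_ltn_trans (rank_leq_col A) _; rewrite !card_ffun !card_ord.
    apply: (leq_trans lt_s); rewrite leq_pexp2l //.
    by case: (s) lt_s => //; rewrite exp0n.
  by case/rowV0Pn => v /sub_kermxP vA v0; exists v.
pose c (m : mon) := u 0 (enum_rank m).
have sumW : \sum_m c m *: W m = 0.
  apply/mpolyP => m; rewrite mcoeff0 raddf_sum /=.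
  have [ltm | lem] := ltnP (mdeg m) (s * e).+1; last first.
    apply: big1 => t _; rewrite mcoeffZ memN_msupp_eq0 ?mulr0 //.
    exact/msize_mdeg_ge/(leq_trans (Wdeg t)).
  have mlt l : (m l < (s * e).+1)%N.
    apply: leq_ltn_trans ltm; rewrite mdegE (bigD1 l) //=; exact: leq_addr.
  pose b : box := [ffun l => Ordinal (mlt l)].
  transitivity ((u *m A) 0 (enum_rank b)); last by rewrite uA mxE.
  rewrite mxE (reindex (@enum_val mon mon)) /=; last exact/onW_bij/enum_val_bij.
  apply: eq_bigr => i _; rewrite mcoeffZ /c enum_valK mxE enum_rankK.
  by congr (_ * (W _)@_ _); apply/mnmP => l; rewrite mnmE ffunE.
pose mm (m : mon) := [multinom (m l : nat) | l < d].
have mm_inj : injective mm.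
  move=> m m' /mnmP eqm; apply/ffunP => l; apply/val_inj.
  by have := eqm l; rewrite !mnmE.
exists (\sum_m c m *: 'X_[mm m]).
  apply: contra_neq u0 => sum0; apply/rowP => i; rewrite mxE.
  move/mpolyP/(_ (mm (enum_val i))): sum0; rewrite mcoeff0 raddf_sum /=.
  rewrite (bigD1 (enum_val i)) //= mcoeffZ mcoeffX eqxx mulr1 big1 ?addr0.
    by rewrite /c enum_valK.
  by move=> m /negPf mi; rewrite mcoeffZ mcoeffX (inj_eq mm_inj) mi mulr0.
have Qs : \prod_i mmap f y (Q i) ^+ s != 0.
  by apply/prodf_neq0 => i _; rewrite expf_neq0 //; have [] := xPQ i.
apply: (mulIf Qs); rewrite mul0r -[RHS](mmap0 y f) -sumW !raddf_sum /=.
rewrite big_distrl /=; apply: eq_bigr => m _.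
rewrite !mmapZ mmapX -mulrA; congr (_ * _).
rewrite /mmap1 -big_split /= rmorph_prod /=; apply: eq_bigr => i _.
have [Q0 ->] := xPQ i.
rewrite mnmE rmorphM !rmorphXn /= expr_div_n mulrAC -mulrA; congr (_ * _).
by rewrite [RHS]expfB_cond // (negPf Q0) ltnW ?ltn_ord.
Qed.

(** * Descent of central simple algebras *)

Section ScalarExtMap.
Variables (K L M : fieldType) (f : {rmorphism K -> L}) (g : {rmorphism L -> M}).
Variables (h : {rmorphism K -> M}) (A : falgType K).
Hypothesis hE : h =1 g \o f.

(** [h] is a separate map, equal to [g \o f] only pointwise, so that [h = f] is allowed: for [g] an
    automorphism fixing the image of [f], this is its semilinear action on [scalar_ext f A]. *)
Definition scalar_ext_map (x : scalar_ext f A) : scalar_ext h A := map_mx g x.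

Lemma scalar_ext_mapE x i : scalar_ext_map x ord0 i = g (x ord0 i).
Proof. by rewrite mxE. Qed.

Lemma scalar_ext_map_in a : scalar_ext_map (scalar_ext_in f a) = scalar_ext_in h a.
Proof. by apply/rowP => i; rewrite !mxE hE. Qed.

Fact scalar_ext_map_is_zmod_morphism : zmod_morphism scalar_ext_map.
Proof. by move=> x y; apply/rowP => i; rewrite !mxE rmorphB. Qed.

HB.instance Definition _ := GRing.isZmodMorphism.Build (scalar_ext f A)
  (scalar_ext h A) scalar_ext_map scalar_ext_map_is_zmod_morphism.

Lemma scalar_ext_mapZ c x : scalar_ext_map (c *: x) = g c *: scalar_ext_map x.
Proof. by apply/rowP => i; rewrite !mxE rmorphM. Qed.

Fact scalar_ext_map_is_monoid_morphism : monoid_morphism scalar_ext_map.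
Proof.
split=> [|x y]; first exact: scalar_ext_map_in.
rewrite -[x * y]/(scalar_ext_mul x y) -[RHS]/(scalar_ext_mul _ _) /scalar_ext_mul.
rewrite raddf_sum; apply: eq_bigr => i _; rewrite raddf_sum; apply: eq_bigr => j _.
by rewrite /= scalar_ext_mapZ scalar_ext_map_in rmorphM !scalar_ext_mapE.
Qed.

HB.instance Definition _ := GRing.isMonoidMorphism.Build (scalar_ext f A)
  (scalar_ext h A) scalar_ext_map scalar_ext_map_is_monoid_morphism.

Lemma scalar_ext_map_inj : injective scalar_ext_map.
Proof.
by move=> x y /rowP eq_xy; apply/rowP => i; have := eq_xy i; rewrite !mxE => /fmorph_inj.
Qed.

(** Freeness is row-freeness of the matrix of coordinates, and the rank does not change under a
    field extension. *)
Lemma scalar_ext_map_free r (u : 'I_r -> scalar_ext f A) :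
  (forall c : 'I_r -> L, \sum_i c i *: u i = 0 -> forall i, c i = 0) ->
  forall c : 'I_r -> M, \sum_i c i *: scalar_ext_map (u i) = 0 -> forall i, c i = 0.
Proof.
move=> u_free c sum0; pose U : 'M[L]_(r, _) := \matrix_i u i.
have Ufree : row_free U.
  rewrite -kermx_eq0; apply/rowV0P => v /sub_kermxP vU; apply/rowP => i.
  rewrite mxE; apply: (u_free (fun i => v ord0 i)); rewrite -[RHS]vU mulmx_sum_row.
  by apply: eq_bigr => j _; rewrite rowK.
have : row_free (map_mx g U) by rewrite row_free_map.
rewrite -kermx_eq0 => /rowV0P/(_ (\row_i c i)) c0 i.
suff /rowP/(_ i) : \row_i c i = 0 by rewrite !mxE.
apply/c0/sub_kermxP; rewrite mulmx_sum_row -[RHS]sum0; apply: eq_bigr => j _.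
by rewrite mxE -map_row rowK.
Qed.
End ScalarExtMap.

Section Descent.
Variables (M L : fieldType) (f : {rmorphism M -> L}) (B : falgType L) (d : nat).
Variables (w : 'I_d -> B) (one : 'rV[M]_d) (s : 'I_d -> 'I_d -> 'rV[M]_d).

Definition desc_in (x : 'rV[M]_d) : B := \sum_l f (x 0 l) *: w l.

Definition desc_mul (x y : 'rV[M]_d) : 'rV[M]_d :=
  \sum_i \sum_j (x 0 i * y 0 j) *: s i j.

Hypothesis w_free : forall c : 'I_d -> L, \sum_l c l *: w l = 0 -> forall l, c l = 0.
Hypothesis w_one : desc_in one = 1.
Hypothesis w_mul : forall i j, w i * w j = desc_in (s i j).

Fact desc_in_is_zmod_morphism : zmod_morphism desc_in.
Proof.
move=> x y; rewrite /desc_in -sumrB; apply: eq_bigr => l _.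
by rewrite !mxE rmorphB scalerBl.
Qed.

HB.instance Definition _ := GRing.isZmodMorphism.Build 'rV[M]_d B desc_in
  desc_in_is_zmod_morphism.

Lemma desc_inZ c x : desc_in (c *: x) = f c *: desc_in x.
Proof.
rewrite scaler_sumr; apply: eq_bigr => l _.
by rewrite mxE rmorphM scalerA.
Qed.

(** Together with [desc_inM], this lets the coordinate vectors inherit the algebra axioms from
    [B]. *)
Lemma desc_in_inj : injective desc_in.
Proof.
move=> x y eq_xy; apply/eqP; rewrite -subr_eq0; apply/eqP/rowP => l; rewrite [RHS]mxE.
apply: (fmorph_inj f); rewrite rmorph0.
apply: (w_free (c := fun l => f ((x - y) 0 l))).
by rewrite -[LHS]/(desc_in (x - y)) raddfB /= eq_xy subrr.
Qed.

Lemma desc_inM x y : desc_in (desc_mul x y) = desc_in x * desc_in y.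
Proof.
rewrite raddf_sum mulr_suml; apply: eq_bigr => i _.
rewrite raddf_sum mulr_sumr; apply: eq_bigr => j _.
by rewrite /= desc_inZ rmorphM -w_mul -scalerAl -scalerAr scalerA.
Qed.

Fact desc_mulA : associative desc_mul.
Proof. by move=> x y z; apply: desc_in_inj; rewrite !desc_inM mulrA. Qed.
Fact desc_mul1l : left_id one desc_mul.
Proof. by move=> x; apply: desc_in_inj; rewrite !desc_inM w_one mul1r. Qed.
Fact desc_mul1r : right_id one desc_mul.
Proof. by move=> x; apply: desc_in_inj; rewrite !desc_inM w_one mulr1. Qed.
Fact desc_mulDl : left_distributive desc_mul +%R.
Proof. by move=> x y z; apply: desc_in_inj; rewrite !(desc_inM, raddfD) /= !desc_inM mulrDl. Qed.
Fact desc_mulDr : right_distributive desc_mul +%R.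
Proof. by move=> x y z; apply: desc_in_inj; rewrite !(desc_inM, raddfD) /= !desc_inM mulrDr. Qed.
Fact desc_one_neq0 : one != 0.
Proof. by rewrite -(inj_eq desc_in_inj) w_one raddf0 oner_neq0. Qed.
Fact desc_scaleAl (c : M) x y : c *: desc_mul x y = desc_mul (c *: x) y.
Proof. by apply: desc_in_inj; rewrite !(desc_inM, desc_inZ) scalerAl. Qed.
Fact desc_scaleAr (c : M) x y : c *: desc_mul x y = desc_mul x (c *: y).
Proof. by apply: desc_in_inj; rewrite !(desc_inM, desc_inZ) scalerAr. Qed.

(** The hypotheses are arguments of the type because the algebra structure attached to it is built
    from them. *)
Definition desc_type
  (_ : forall c : 'I_d -> L, \sum_l c l *: w l = 0 -> forall l, c l = 0)
  (_ : desc_in one = 1) (_ : forall i j, w i * w j = desc_in (s i j)) : Type :=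
  'rV[M]_d.

Local Notation A := (desc_type w_free w_one w_mul).

HB.instance Definition _ := Vector.on A.
HB.instance Definition _ := GRing.Zmodule_isNzRing.Build A
  desc_mulA desc_mul1l desc_mul1r desc_mulDl desc_mulDr desc_one_neq0.
HB.instance Definition _ := GRing.Lmodule_isLalgebra.Build M A desc_scaleAl.
HB.instance Definition _ := GRing.Lalgebra_isAlgebra.Build M A desc_scaleAr.
HB.instance Definition _ := Algebra_isFalgebra.Build M A.

Definition desc_alg : falgType M := A.

Lemma desc_inP : d = \dim {:B} -> is_scalar_ext f (desc_in : desc_alg -> B).
Proof.
move=> dimB; split.
- exact: desc_in_is_zmod_morphism.
- by split=> [|x y]; [exact: w_one | exact: desc_inM].
- exact: desc_inZ.
- by rewrite dimvf /dim /= mul1n.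
move=> b; have w_free' : free [tuple w l | l < d].
  apply/freeP => c sum0; apply: w_free; rewrite -[RHS]sum0.
  by apply: eq_bigr => l _; rewrite -tnth_nth tnth_mktuple.
have w_basis : basis_of {:B} [tuple w l | l < d].
  by rewrite basisEfree w_free' subvf size_tuple dimB /=.
exists d, (fun l => coord [tuple w l | l < d] l b), (fun l => delta_mx 0 l).
rewrite {1}(coord_basis w_basis (memvf b)); apply: eq_bigr => l _.
rewrite -tnth_nth tnth_mktuple; congr (_ *: _).
rewrite /desc_in (bigD1 l) //= mxE !eqxx rmorph1 scale1r big1 ?addr0 // => j jl.
by rewrite mxE eqxx (negPf jl) rmorph0 scale0r.
Qed.
End Descent.

Section DescentCSA.
Variables (M L : fieldType) (f : {rmorphism M -> L}) (A : falgType M) (B : falgType L).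
Variable phi : {additive A -> B}.
Hypothesis phiP : is_scalar_ext f phi.

Lemma is_scalar_extZ c a : phi (c *: a) = f c *: phi a.
Proof. by have [_ _ ->] := phiP. Qed.

Lemma is_scalar_extM a b : phi (a * b) = phi a * phi b.
Proof. by have [_ [_ ->]] := phiP. Qed.

Lemma is_scalar_ext1 : phi 1 = 1.
Proof. by have [_ [->]] := phiP. Qed.

Lemma is_scalar_ext_span (U : {vspace A}) a :
  a \in U -> phi a \in <<map phi (vbasis U)>>%VS.
Proof.
move=> aU; rewrite (coord_vbasis aU) raddf_sum; apply: memv_suml => i _.
rewrite /= is_scalar_extZ memvZ // memv_span //.
by apply/map_f/mem_nth; rewrite size_tuple.
Qed.

Lemma is_scalar_ext_basis : basis_of {:B} (map_tuple phi (vbasis {:A})).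
Proof.
have [_ _ _ dimAB phiT] := phiP.
rewrite basisEdim; apply/andP; split; last by rewrite size_tuple dimAB.
apply/subvP => b _; have [m [x [a ->]]] := phiT b.
by apply: memv_suml => i _; rewrite memvZ // is_scalar_ext_span ?memvf.
Qed.

Lemma is_scalar_ext_coord a i :
  coord (map_tuple phi (vbasis {:A})) i (phi a) = f (coord (vbasis {:A}) i a).
Proof.
rewrite {1}(coord_vbasis (memvf a)) raddf_sum /=.
under eq_bigr => j _.
  rewrite is_scalar_extZ (_ : phi _ = (map_tuple phi (vbasis {:A}))`_j).
    over.
  by rewrite (nth_map 0) // size_tuple.
by rewrite coord_sum_free // (basis_free is_scalar_ext_basis).
Qed.

Lemma is_scalar_ext_inj : injective phi.
Proof.
move=> a b eq_ab; rewrite (coord_vbasis (memvf a)) (coord_vbasis (memvf b)).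
apply: eq_bigr => i _; congr (_ *: _); apply: (fmorph_inj f).
by rewrite -!is_scalar_ext_coord eq_ab.
Qed.

(** The scalar [c] is a ratio of coordinates of [a] and [b], hence comes from [M]. This brings
    central scalars of [B] down to [A]. *)
Lemma is_scalar_ext_line a b c : b != 0 -> phi a = c *: phi b -> exists c', a = c' *: b.
Proof.
move=> b0 phia.
have [i bi] : exists i, coord (vbasis {:A}) i b != 0.
  apply: contrapT => /forallNP b0'; case/eqP: b0; rewrite (coord_vbasis (memvf b)).
  by apply: big1 => i _; have /negP := b0' i; rewrite negbK => /eqP ->; rewrite scale0r.
exists (coord (vbasis {:A}) i a / coord (vbasis {:A}) i b).
apply: is_scalar_ext_inj; rewrite is_scalar_extZ phia; congr (_ *: _).
rewrite fmorph_div -!is_scalar_ext_coord phia linearZ /= mulfK //.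
by rewrite is_scalar_ext_coord fmorph_eq0.
Qed.

Lemma descent_central : central_alg B -> central_alg A.
Proof.
have [_ _ _ dimAB phiT] := phiP.
move=> cB; apply/vspaceP => a; apply/idP/idP; last first.
  move=> /vlineP [c ->]; rewrite memv_cap memvf; apply/centvP => y _.
  by rewrite -scalerAl -scalerAr mul1r mulr1.
rewrite memv_cap memvf => /centvP a_comm.
have [b|c phia] := @csa_scalar _ _ cB (phi a).
  have [m [x [u ->]]] := phiT b; rewrite mulr_suml mulr_sumr.
  apply: eq_bigr => i _; rewrite -scalerAl -scalerAr -!is_scalar_extM.
  by rewrite a_comm ?memvf.
have [|c' ->] := @is_scalar_ext_line a 1 c (oner_neq0 _); last by rewrite memvZ ?mem1v ?memv_line.
by rewrite is_scalar_ext1.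
Qed.

(** The span [J] of the image of an ideal [I] is an ideal of [B]. If it is [0], injectivity gives
    [I = 0]; if it is [B], its dimension, at most that of [I], forces [I] to be everything. *)
Lemma descent_simple : simple_alg B -> simple_alg A.
Proof.
have [_ _ _ dimAB phiT] := phiP.
move=> sB I /prodvP Il /prodvP Ir.
pose J := <<map phi (vbasis I)>>%VS.
have [] := sB J.
- apply/prodvP => b y _ /(coord_span (X := map_tuple phi (vbasis I))) ->.
  have [m [x [u ->]]] := phiT b; rewrite mulr_suml; apply: memv_suml => i _.
  rewrite mulr_sumr; apply: memv_suml => j _.
  rewrite -scalerAl -scalerAr !memvZ // (nth_map 0) ?size_tuple // -is_scalar_extM.
  by apply: is_scalar_ext_span; rewrite Il ?memvf ?vbasis_mem ?mem_nth ?size_tuple.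
- apply/prodvP => y b /(coord_span (X := map_tuple phi (vbasis I))) -> _.
  have [m [x [u ->]]] := phiT b; rewrite mulr_suml; apply: memv_suml => i _.
  rewrite mulr_sumr; apply: memv_suml => j _.
  rewrite -scalerAl -scalerAr !memvZ // (nth_map 0) ?size_tuple // -is_scalar_extM.
  by apply: is_scalar_ext_span; rewrite Ir ?memvf ?vbasis_mem ?mem_nth ?size_tuple.
- move=> J0; left; apply/eqP; rewrite -subv0; apply/subvP => a /is_scalar_ext_span.
  rewrite -/J J0 !memv0 => /eqP phia; apply/eqP/is_scalar_ext_inj.
  by rewrite phia raddf0.
move=> JT; right; apply/eqP; rewrite eqEdim subvf dimAB -JT.
by apply: leq_trans (dim_span _) _; rewrite size_map size_tuple.
Qed.
End DescentCSA.

Lemma csa_descent (M L : fieldType) (f : {rmorphism M -> L}) (n : nat) (B : csa L n)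
    (w : 'I_(n ^ 2) -> B) (one : 'rV[M]_(n ^ 2)) (s : 'I_(n ^ 2) -> 'I_(n ^ 2) -> 'rV[M]_(n ^ 2)) :
  (forall c : 'I_(n ^ 2) -> L, \sum_l c l *: w l = 0 -> forall l, c l = 0) ->
  desc_in f w one = 1 -> (forall i j, w i * w j = desc_in f w (s i j)) ->
  exists A : csa M n, alg_iso (csa_ext f A) B.
Proof.
move=> w_free w_one w_mul; pose A := desc_alg w_free w_one w_mul.
pose phi : A -> B := desc_in f w.
have phiP : is_scalar_ext f phi by apply: desc_inP; rewrite csa_degree.
pose phia := GRing.isZmodMorphism.Build A B phi (desc_in_is_zmod_morphism f w).
pose phi' : {additive A -> B} := HB.pack phi phia.
have dimA : \dim {:A} = (n ^ 2)%N by have [_ _ _ -> _] := phiP; rewrite csa_degree.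
exists (CSA (@descent_central _ _ _ _ _ phi' phiP (csa_central B))
  (@descent_simple _ _ _ _ _ phi' phiP (@csa_simple _ _ B)) dimA).
exact: scalar_ext_iso phiP.
Qed.

(** * Splitting central simple algebras *)

Lemma ex_irreducible_factor (F : fieldType) (q : {poly F}) :
  (1 < size q)%N -> exists2 r, irreducible_poly r & r %| q.
Proof.
move=> q_gt1.
pose P m := `[< exists r : {poly F}, [/\ (1 < size r)%N, r %| q & size r = m] >].
have exP : exists m, P m by exists (size q); apply/asboolP; exists q; rewrite dvdpp.
case: (ex_minnP exP) => _ /asboolP [r [r_gt1 r_q <-]] minr; exists r => //.
split=> // u u1 u_r; rewrite -dvdp_size_eqp //.
have r0 : r != 0 by rewrite -size_poly_gt0 ltnW.
rewrite eqn_leq dvdp_leq //=; apply: minr; apply/asboolP; exists u; split=> //.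
  rewrite ltn_neqAle eq_sym u1 size_poly_gt0; exact: dvdpN0 u_r r0.
exact: dvdp_trans u_r r_q.
Qed.

Lemma ex_root_ext (F : fieldType) (q : {poly F}) : (1 < size q)%N ->
  exists (E : fieldType) (g : {rmorphism F -> E}) (x : E), root (map_poly g q) x.
Proof.
move=> /ex_irreducible_factor [r r_irr r_q].
have [E _ [x rx _]] := irredp_FAdjoin r_irr.
exists E, (in_alg E), x; rewrite -!dvdp_XsubCl in rx *.
by apply: (dvdp_trans rx); rewrite dvdp_map.
Qed.

(* A right ideal [I] with [I = eB] and [eBe = F e] makes [B] act on [I] from the
   right as the full matrix algebra. *)
Section RightIdealSplit.
Variables (F : fieldType) (B : falgType F) (I : {vspace B}) (e : B).
Hypotheses (sB : simple_alg B) (I_right : (I * {:B} <= I)%VS) (eI : e \in I).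
Hypotheses (e0 : e != 0) (eK : forall v, v \in I -> e * v = v).
Hypothesis e_scal : forall v, v \in I -> exists c, v * e = c *: e.
Variables (d : nat) (u : d.-tuple B).
Hypothesis uI : basis_of I u.

Definition rightmx (z : B) : 'M[F]_d := \matrix_(i, j) coord u j (u`_i * z).

Lemma rightmx_memv v z : v \in I -> v * z \in I.
Proof. by move=> vI; have /prodvP -> := I_right; rewrite ?memvf. Qed.

Lemma memv_basis_nth (i : 'I_d) : u`_i \in I.
Proof. by rewrite (basis_mem uI) ?mem_nth ?size_tuple. Qed.

Lemma rightmxE z (i : 'I_d) : u`_i * z = \sum_j rightmx z i j *: u`_j.
Proof.
rewrite {1}(coord_basis uI (rightmx_memv z (memv_basis_nth i))).
by apply: eq_bigr => j _; rewrite mxE.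
Qed.

Lemma rightmx_unique z (X : 'M_d) :
  (forall i : 'I_d, u`_i * z = \sum_j X i j *: u`_j) -> rightmx z = X.
Proof.
move=> zX; apply/matrixP => i j; rewrite mxE zX.
by rewrite coord_sum_free // (basis_free uI).
Qed.

Lemma rightmx_linear : linear rightmx.
Proof.
by move=> c x y; apply/matrixP => i j; rewrite !mxE mulrDr -scalerAr linearP.
Qed.

Lemma rightmxM x y : rightmx (x * y) = rightmx x *m rightmx y.
Proof.
apply: rightmx_unique => i; rewrite mulrA rightmxE mulr_suml.
under eq_bigr do rewrite -scalerAl rightmxE scaler_sumr.
rewrite exchange_big; apply: eq_bigr => j _; rewrite mxE scaler_suml.
by apply: eq_bigr => l _; rewrite scalerA.
Qed.

Lemma rightmx1 : rightmx 1 = 1%:M.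
Proof.
apply: rightmx_unique => i; rewrite mulr1 (bigD1 i) //= mxE eqxx scale1r.
by rewrite big1 ?addr0 // => j; rewrite mxE eq_sym => /negPf ->; rewrite scale0r.
Qed.

Lemma right_ideal_gen : ({:B} * I = {:B})%VS.
Proof.
case: (sB (I := ({:B} * I)%VS)).
- by rewrite prodvA prodvSl // subvf.
- by rewrite -prodvA prodvSr.
- move/eqP; rewrite -subv0 => /prodvP/(_ 1 e (memvf _) eI).
  by rewrite mul1r memv0 (negPf e0).
by [].
Qed.

Lemma rightmx_inj : injective rightmx.
Proof.
have I0 z : rightmx z = 0 -> forall v, v \in I -> v * z = 0.
  move=> z0 v vI; rewrite (coord_basis uI vI) mulr_suml big1 // => i _.
  by rewrite -scalerAl rightmxE z0 big1 ?scaler0 // => j _; rewrite mxE scale0r.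
pose rl := GRing.isLinear.Build F B _ _ rightmx rightmx_linear.
pose r : {linear B -> 'M_d} := HB.pack rightmx rl.
suff r0 : forall z, rightmx z = 0 -> z = 0.
  move=> x y eq_xy; apply/eqP; rewrite -subr_eq0; apply/eqP/r0.
  by rewrite -[rightmx _]/(r _) linearB /= eq_xy subrr.
move=> z z0; have : 1 \in ({:B} * I)%VS by rewrite right_ideal_gen memvf.
suff : ({:B} * I <= lker (amulr z))%VS.
  by move=> /subvP ker /ker; rewrite memv_ker lfunE /= mul1r => /eqP.
apply/prodvP => b v _ vI; rewrite memv_ker lfunE /=.
by rewrite -mulrA (I0 _ z0) // mulr0.
Qed.

(** A double centraliser argument: the [x] for which [v |-> phi (v * x)] is a right multiplication
    on [I] form a subspace, and it contains [{:B} * I], hence [1]. *)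
Lemma rightmx_surj (X : 'M_d) : exists z, rightmx z = X.
Proof.
pose phi v := \sum_i coord u i v *: \sum_j X i j *: u`_j.
have phi_lin : linear phi.
  move=> c x y; rewrite scaler_sumr -big_split; apply: eq_bigr => i _.
  by rewrite linearP scalerDl scalerA.
pose phil := GRing.isLinear.Build F B B _ phi phi_lin.
pose phi' : {linear B -> B} := HB.pack phi phil.
have phiI v : phi v \in I.
  apply: memv_suml => i _; rewrite memvZ // memv_suml // => j _.
  by rewrite memvZ // memv_basis_nth.
pose T x := exists z, forall v, v \in I -> v * z = phi (v * x).
have [||U defU] := @ex_vspace F B T.
- by exists 0 => v _; rewrite !mulr0 -[phi 0]/(phi' 0) linear0.
- move=> c x y [z zx] [t ty]; exists (c *: z + t) => v vI.
  rewrite !mulrDr -!scalerAr zx // ty // -[phi (_ + _)]/(phi' _).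
  by rewrite linearP.
have : 1 \in ({:B} * I)%VS by rewrite right_ideal_gen memvf.
suff /subvP sU : ({:B} * I <= U)%VS.
  move=> /sU/defU [z zX]; exists z; apply: rightmx_unique => i.
  rewrite zX ?memv_basis_nth // mulr1 /phi (bigD1 i) //= coord_free ?eqxx; last first.
    exact: basis_free uI.
  rewrite scale1r [X in _ + X]big1 ?addr0 // => j ji.
  by rewrite coord_free ?(basis_free uI) // eq_sym (negPf ji) scale0r.
(* Left multiplication by [v * b], an element of [I], acts on [I] as a scalar and therefore commutes
   with [phi]. *)
apply/prodvP => b w _ wI; apply/defU; exists (b * phi w) => v vI.
have [c vbe] := e_scal (rightmx_memv b vI).
have vbw x : x \in I -> v * (b * x) = c *: x.
  by move=> xI; rewrite -{1}(eK xI) !mulrA vbe -scalerAl eK.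
by rewrite !vbw // -[RHS]/(phi' _) linearZ.
Qed.
End RightIdealSplit.

(* [I] has minimal dimension among the right ideals over all field extensions:
   left multiplications on [I] acquire an eigenvalue over some extension, where the
   eigenspace cannot be smaller, so they are scalars. *)
Section MinimalRightIdeal.
Variables (K : fieldType) (A : falgType K).
Hypotheses (A_central : central_alg A) (A_simple : simple_alg A).

Definition right_ideal_dim (F : fieldType) (f : {rmorphism K -> F}) (m : nat) :=
  exists I : {vspace scalar_ext f A},
    [/\ I != 0%VS, (I * {:scalar_ext f A} <= I)%VS & \dim I = m].

Variables (F : fieldType) (f : {rmorphism K -> F}).
Local Notation B := (scalar_ext f A).
Variable (I : {vspace B}).
Hypotheses (I0 : I != 0%VS) (I_right : (I * {:B} <= I)%VS).
Hypothesis I_min : forall (E : fieldType) (g : {rmorphism K -> E}) m,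
  right_ideal_dim g m -> (\dim I <= m)%N.

Lemma min_right_ideal_eq (J : {vspace B}) :
  J != 0%VS -> (J * {:B} <= J)%VS -> (J <= I)%VS -> J = I.
Proof.
move=> J0 J_right JI; apply/eqP; rewrite eqEdim JI.
by apply: (I_min (g := f)); exists J.
Qed.

(** Brauer's lemma: some [x] in [I] has [x * I] nonzero, so by minimality left multiplication by [x]
    is bijective on [I], and the [e] with [x = x * e] is a left identity of [I]. *)
Lemma min_right_ideal_idem :
  exists e, [/\ e \in I, e != 0 & forall v, v \in I -> e * v = v].
Proof.
have sB := scalar_ext_simple (f := f) A_central A_simple.
have [x [v [xI vI xv]]] : exists x v, [/\ x \in I, v \in I & x * v != 0].
  apply: contrapT => noxv.
  have : (I <= I * ({:B} * I))%VS.
    have -> : ({:B} * I = {:B})%VS.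
      by apply: (right_ideal_gen sB I_right (memv_pick I)); rewrite vpick0.
    by apply/subvP => x xI; rewrite -[x]mulr1 memv_mul ?memvf.
  rewrite prodvA => /subv_trans /(_ (prodvSl _ I_right)) II.
  case/negP: I0; rewrite -subv0; apply: (subv_trans II).
  apply/prodvP => x v xI vI; rewrite memv0; apply: contrapT => /negP xv.
  by apply: noxv; exists x, v.
have xI_eq : (amull x @: I)%VS = I.
  apply: min_right_ideal_eq.
  - apply: contraNneq xv => xI0; rewrite -memv0 -xI0.
    by rewrite -[x * v]/((x \*o idfun) v) -[_ v]lfunE memv_img.
  - apply/prodvP => _ b /memv_imgP [y yI ->] _; rewrite lfunE /= -mulrA.
    have /prodvP/(_ _ b yI (memvf _)) yb := I_right.
    by have := memv_img (amull x) yb; rewrite lfunE.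
  - apply/subvP => _ /memv_imgP [y yI ->]; rewrite lfunE /=.
    by have /prodvP -> := I_right; rewrite ?memvf.
have /memv_imgP [e eI xe] : x \in (amull x @: I)%VS by rewrite xI_eq.
rewrite lfunE /= in xe.
have x_inj y : y \in I -> x * y = 0 -> y = 0.
  move=> yI xy; apply: contra_neq_eq xv => y0.
  have : v \in (I :&: lker (amull x))%VS.
    rewrite (@min_right_ideal_eq (I :&: lker (amull x))%VS) ?capvSl //.
      apply: contra_neq y0 => IK0; apply/eqP; rewrite -memv0 -IK0 memv_cap yI.
      by rewrite memv_ker lfunE /= xy.
    apply/prodvP => a b; rewrite !memv_cap !memv_ker !lfunE /= => /andP [aI /eqP xa] _.
    by rewrite mulrA xa mul0r eqxx andbT; have /prodvP -> := I_right; rewrite ?memvf.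
  by rewrite memv_cap memv_ker lfunE /= => /andP [_ /eqP].
exists e; split=> //.
  by apply: contra_neq xv => e0; rewrite xe e0 mulr0 mul0r.
move=> w wI; apply/eqP; rewrite -subr_eq0; apply/eqP/x_inj.
  by rewrite memvB //; have /prodvP -> := I_right; rewrite ?memvf.
by rewrite mulrBr mulrA -xe subrr.
Qed.

Lemma min_right_ideal_scal e : e \in I -> e != 0 -> (forall v, v \in I -> e * v = v) ->
  forall v, v \in I -> exists c, v * e = c *: e.
Proof.
move=> eI e0 eK v vI; set y := v * e.
have ye : y * e = y by rewrite -mulrA eK.
have yI : y \in I by have /prodvP -> := I_right; rewrite ?memvf.
pose u := vbasis I.
pose N := \matrix_(i < \dim I, j < \dim I) coord u j (y * u`_i).
have NE (i : 'I_(\dim I)) : y * u`_i = \sum_j N i j *: u`_j.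
  rewrite {1}(coord_vbasis (U := I) (v := y * u`_i)).
    by apply: eq_bigr => j _; rewrite mxE.
  by have /prodvP -> := I_right; rewrite ?memvf.
have dI : (0 < \dim I)%N by rewrite lt0n dimv_eq0.
have [|E [g [l]]] := @ex_root_ext F (char_poly N); first by rewrite size_char_poly.
rewrite map_char_poly -eigenvalue_root_char => /eigenvalueP [c Nc c0].
pose h : {rmorphism K -> E} := g \o f.
have hE : h =1 g \o f by [].
pose em := @scalar_ext_map _ _ _ f g h A.
have emM x z : em (x * z) = em x * em z by exact: rmorphM.
have em_in a : em (scalar_ext_in f a) = scalar_ext_in h a by apply: scalar_ext_map_in.
have emL (a : 'I_(\dim I) -> F) : em (\sum_j a j *: u`_j) = \sum_j g (a j) *: em u`_j.
  by rewrite [LHS]raddf_sum; apply: eq_bigr => j _; apply: scalar_ext_mapZ.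
have u_free (a : 'I_(\dim I) -> F) : \sum_i a i *: u`_i = 0 -> forall i, a i = 0.
  by move=> sum0; have /freeP /(_ a sum0) := basis_free (vbasisP I).
pose w := \sum_i c ord0 i *: em u`_i.
have w0 : w != 0.
  apply: contra_neq c0 => w0; apply/rowP => i; rewrite mxE.
  exact: (@scalar_ext_map_free _ _ _ f g h A _ _ u_free (c ord0) w0).
have yw : em y * w = l *: w.
  rewrite scaler_sumr mulr_sumr.
  under eq_bigr => i _.
    rewrite -scalerAr -emM NE emL scaler_sumr.
    under eq_bigr do rewrite scalerA.
    over.
  rewrite exchange_big; apply: eq_bigr => j _; rewrite scalerA -scaler_suml.
  have /rowP/(_ j) := Nc; rewrite !mxE => <-; congr (_ *: _).
  by apply: eq_bigr => m _; rewrite [in RHS]mxE.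
pose J := <<map em u>>%VS.
have emJ v' : v' \in I -> em v' \in J.
  move=> v'I; rewrite (coord_vbasis v'I) emL; apply: memv_suml => i _.
  rewrite memvZ // memv_span //.
  by apply/map_f/mem_nth; rewrite size_tuple.
have J_right : (J * {:scalar_ext h A} <= J)%VS.
  apply/prodvP => z b /(coord_span (X := map_tuple em u)) -> _.
  rewrite [b]scalar_ext_sum mulr_suml; apply: memv_suml => i _.
  rewrite mulr_sumr; apply: memv_suml => j _.
  rewrite -scalerAl -scalerAr !memvZ // (nth_map 0) ?size_tuple //.
  rewrite -em_in -emM emJ //; have /prodvP -> := I_right; rewrite ?memvf //.
  by rewrite vbasis_mem ?mem_nth ?size_tuple.
pose U := (J :&: lker (amull (em y) - l *: \1%VF))%VS.
have memU x : (x \in U) = (x \in J) && (em y * x == l *: x).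
  by rewrite memv_cap memv_ker add_lfunE opp_lfunE scale_lfunE id_lfunE lfunE subr_eq0.
have UJ : U = J.
  apply/eqP; rewrite eqEdim capvSl /=.
  apply: leq_trans (dim_span _) _; rewrite size_map size_tuple.
  apply: (I_min (g := h)); exists U; split=> //.
    apply: contra_neq w0 => U0; apply/eqP; rewrite -memv0 -U0 memU yw eqxx andbT.
    by apply: memv_suml => i _; rewrite memvZ // emJ // vbasis_mem ?mem_nth ?size_tuple.
  apply/prodvP => x b; rewrite !memU => /andP [xJ /eqP yx] _.
  rewrite mulrA yx scalerAl eqxx andbT.
  by have /prodvP -> := J_right; rewrite ?memvf.
have : em e \in U by rewrite UJ emJ.
rewrite memU -emM ye => /andP [_ /eqP eqy].
have [i ei] : exists i, e ord0 i != 0.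
  apply: contrapT => /forallNP e0'; case/eqP: e0; apply/rowP => i; rewrite mxE.
  by have /negP := e0' i; rewrite negbK => /eqP.
(* The eigenvalue [l] is only known to lie in [E], but a nonzero coordinate of [e] exhibits it as
   the image of a ratio in [F]. *)
exists (y ord0 i / e ord0 i).
have eqi j : g (y ord0 j) = l * g (e ord0 j).
  by have /rowP/(_ j) := eqy; rewrite !mxE.
apply/rowP => j; apply: (fmorph_inj g); rewrite mxE rmorphM fmorph_div !eqi.
by rewrite mulfK // fmorph_eq0.
Qed.
End MinimalRightIdeal.

Definition mx_iso (F : fieldType) (n : nat) (B : falgType F) (rho : B -> 'M[F]_n) :=
  [/\ linear rho, rho 1 = 1%:M, forall x y, rho (x * y) = rho x *m rho y, injective rho &
      forall X, exists x, rho x = X].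

(** A right ideal of least dimension over all field extensions takes the place of one over an
    algebraic closure. Its dimension is [n] by comparison of [(\dim I) ^ 2] with [n ^ 2]. *)
Lemma csa_split (K : fieldType) (n : nat) (A : csa K n) :
  exists (F : fieldType) (f : {rmorphism K -> F}) (rho : scalar_ext f A -> 'M[F]_n),
    mx_iso rho.
Proof.
have cA := csa_central A; have sA := @csa_simple _ _ A.
pose P m := `[< exists (F : fieldType) (f : {rmorphism K -> F}), right_ideal_dim A f m >].
have exP : exists m, P m.
  exists (\dim {:scalar_ext (@idfun K) A}); apply/asboolP; exists K, idfun, fullv.
  split=> //; last exact: subvf.
  by rewrite -dimv_eq0 dim_scalar_ext -lt0n adim_gt0.
case: (ex_minnP exP) => _ /asboolP [F [f [I [I0 I_right <-]]]] minI.
have I_min (E : fieldType) (g : {rmorphism K -> E}) m : right_ideal_dim A g m -> (\dim I <= m)%N.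
  by move=> Im; apply: minI; apply/asboolP; exists E, g.
have [e [eI e0 eK]] := min_right_ideal_idem cA sA I0 I_right I_min.
have e_scal := min_right_ideal_scal I0 I_right I_min eI e0 eK.
have sB := scalar_ext_simple (f := f) cA sA.
have uI := vbasisP I.
have inj := rightmx_inj sB I_right eI e0 uI.
have surj := rightmx_surj sB I_right eI e0 eK e_scal uI.
suff dI : \dim I = n.
  have ex_rho m : \dim I = m -> exists rho : scalar_ext f A -> 'M[F]_m, mx_iso rho.
    move=> <-; exists (@rightmx _ _ _ (vbasis I)); split=> //.
    - exact: rightmx_linear.
    - exact: (rightmx1 uI).
    - exact: (rightmxM I_right uI).
  by exists F, f; apply: ex_rho.
pose rl := GRing.isLinear.Build F (scalar_ext f A) _ _ (@rightmx _ _ _ (vbasis I))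
  (@rightmx_linear _ _ _ (vbasis I)).
pose r : {linear scalar_ext f A -> 'M_(\dim I)} := HB.pack (@rightmx _ _ _ (vbasis I)) rl.
have r_inj : lker (linfun r) == 0%VS.
  by apply/lker0P => x y; rewrite !lfunE => /inj.
have r_surj : limg (linfun r) = fullv.
  apply/vspaceP => X; rewrite memvf; have [x <-] := surj X.
  by rewrite -[rightmx _ _]/(r x) -(lfunE r) memv_img ?memvf.
have := limg_ker_dim (linfun r) fullv; rewrite r_surj (eqP r_inj) capv0 dimv0 add0n.
rewrite dim_scalar_ext csa_degree dimvf /dim /= -mulnn => /eqP.
by rewrite mulnn eqn_exp2r // => /eqP.
Qed.

(** * Generic elements *)

Definition infinite_field (K : fieldType) := forall s : seq K, exists x, x \notin s.

Lemma infinite_field_ext (K F : fieldType) (f : {rmorphism K -> F}) :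
  infinite_field K -> infinite_field F.
Proof.
move=> infK s.
pose P m := `[< exists t : seq K, [/\ uniq t, all (fun x => f x \in s) t & size t = m] >].
apply: contrapT => /forallNP all_s.
have [t [t_uniq t_size]] : exists t : seq K, uniq t /\ size t = (size s).+1.
  elim: (size s).+1 => [|m [t [t_uniq <-]]]; first by exists [::].
  by have [x xt] := infK t; exists (x :: t); rewrite /= xt.
have : (size (map f t) <= size s)%N.
  apply: uniq_leq_size; first by rewrite map_inj_uniq //; apply: fmorph_inj.
  by move=> x _; apply: contrapT => /negP /all_s.
by rewrite size_map t_size ltnn.
Qed.

Lemma ex_nonroot (K F : fieldType) (f : {rmorphism K -> F}) (q : {poly F}) :
  infinite_field K -> q != 0 -> exists x, q.[f x] != 0.
Proof.
move=> infK q0.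
have [t [t_uniq t_size]] : exists t : seq K, uniq t /\ size t = size q.
  elim: (size q) => [|m [t [t_uniq <-]]]; first by exists [::].
  by have [x xt] := infK t; exists (x :: t); rewrite /= xt.
have : ~~ all (root q) (map f t).
  apply/negP => /(max_poly_roots q0); rewrite size_map t_size ltnn => /implyP.
  by rewrite map_inj_uniq ?t_uniq //; apply: fmorph_inj.
by move/allPn => [_ /mapP [x _ ->]]; exists x.
Qed.

(** Being polynomial along each line is as much of polynomiality as the density arguments use, and
    it refers to no coordinates on [V]. *)
Definition line_poly (F : fieldType) (V : lmodType F) (g : V -> F) :=
  forall y w, exists q : {poly F}, forall t, g (y + t *: w) = q.[t].

Lemma line_poly_linear (F : fieldType) (V W : lmodType F) (h : V -> W) (g : W -> F) :
  linear h -> line_poly g -> line_poly (g \o h).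
Proof.
move=> h_lin g_poly y w; have [q gq] := g_poly (h y) (h w); exists q => t.
by rewrite /= addrC h_lin addrC gq.
Qed.

(** On the line from a point good for [s] to a point good for [i], the product of the restricted
    polynomials is nonzero, so it has a non-root. *)
Lemma line_poly_common (F : fieldType) (V : lmodType F) (I : Type) (g : I -> V -> F)
    (s : seq I) :
  infinite_field F -> (forall i, line_poly (g i)) -> (forall i, exists y, g i y != 0) ->
  exists y, all (fun i => g i y != 0) s.
Proof.
move=> infF g_poly g_neq0; elim: s => [|i s [y1 y1s]]; first by exists 0.
have [y2 y2i] := g_neq0 i.
have [q gq] := choice (fun j => g_poly j y1 (y2 - y1)).
have qi : q i != 0.
  apply: contra_neq y2i => qi.
  by have := gq i 1; rewrite qi horner0 scale1r addrC subrK.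
have qs : \prod_(j <- s) q j != 0.
  rewrite prodf_seq_neq0; apply: sub_all y1s => j; apply: contra_neq => qj.
  by have := gq j 0; rewrite qj horner0 scale0r addr0.
have [t] := @ex_nonroot F F idfun _ infF (mulf_neq0 qi qs).
rewrite hornerM horner_prod mulf_eq0 negb_or => /andP [qit].
rewrite prodf_seq_neq0 => qst; exists (y1 + t *: (y2 - y1)).
by rewrite /= !gq qit /=; apply: sub_all qst => j; rewrite gq.
Qed.

(* The coordinates are moved into [K] one at a time, so that only polynomials in
   one variable occur. *)
Lemma line_poly_dense (K F : fieldType) (f : {rmorphism K -> F}) (V : lmodType F)
    (I : Type) (g : I -> V -> F) (s : seq I) d (w : 'I_d -> V) (c : 'I_d -> F) y :
  infinite_field K -> (forall i, line_poly (g i)) ->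
  all (fun i => g i (y + \sum_l c l *: w l) != 0) s ->
  exists c' : 'I_d -> K, all (fun i => g i (y + \sum_l f (c' l) *: w l) != 0) s.
Proof.
move=> infK g_poly; elim: d w c y => [|d IHd] w c y.
  by exists (fun=> 0); move: H; rewrite !big_ord0.
rewrite big_ord_recr /= addrA.
set z := y + _ => zc.
have [q gq] := choice (fun j => g_poly j z (w ord_max)).
have [x] : exists x, (\prod_(j <- s) q j).[f x] != 0.
  apply: ex_nonroot infK _; rewrite prodf_seq_neq0; apply: sub_all zc => j.
  by rewrite gq; apply: contra_neq => ->; rewrite horner0.
rewrite horner_prod prodf_seq_neq0 => qx.
have [|c' c'P] := IHd (fun l => w (widen_ord (leqnSn d) l))
    (fun l => c (widen_ord (leqnSn d) l)) (y + f x *: w ord_max).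
  by apply: sub_all qx => j; rewrite -gq /z addrAC.
exists (fun l => oapp c' x (unlift ord_max l)).
have -> : y + \sum_(l < d.+1) f (oapp c' x (unlift ord_max l)) *: w l =
    y + f x *: w ord_max + \sum_l f (c' l) *: w (widen_ord (leqnSn d) l).
  rewrite big_ord_recr /= unlift_none /= addrAC -addrA; congr (_ + (_ + _)).
  apply: eq_bigr => l _; have -> : widen_ord (leqnSn d) l = lift ord_max l.
    by apply: val_inj; rewrite /= /bump leqNgt ltn_ord.
  by rewrite liftK.
exact: c'P.
Qed.

(** Density of the [K]-points: open conditions that can be met over [F] one at a time are met
    together by an element of [A]. *)
Lemma scalar_ext_generic (K F : fieldType) (f : {rmorphism K -> F}) (A : falgType K)
    (I : finType) (g : I -> scalar_ext f A -> F) :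
  infinite_field K -> (forall i, line_poly (g i)) -> (forall i, exists y, g i y != 0) ->
  exists a, forall i, g i (scalar_ext_in f a) != 0.
Proof.
move=> infK g_poly g_neq0.
have [y ys] := line_poly_common (enum I) (infinite_field_ext f infK) g_poly g_neq0.
rewrite [y]scalar_ext_sum -[\sum_i _]add0r in ys.
have [c cs] := line_poly_dense f infK g_poly ys.
exists (\sum_i c i *: (vbasis {:A})`_i) => i.
have /allP/(_ i) := cs; rewrite mem_enum => /(_ isT); rewrite add0r.
rewrite raddf_sum; congr (g i _ != 0); apply: eq_bigr => l _.
by rewrite [RHS]scalar_ext_inZ.
Qed.

(** * Discriminants, cyclic vectors and separable elements *)

Section LineMatrix.
Variables (F : fieldType) (n : nat) (X Y : 'M[F]_n.+1).

(** Evaluation at [t] commutes with determinants and characteristic polynomials, so those of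
    [X + t *: Y] are polynomial in [t]. *)
Definition line_mx : 'M[{poly F}]_n.+1 := map_mx polyC X + 'X *: map_mx polyC Y.

Lemma line_mxE t : map_mx (horner_eval t) line_mx = X + t *: Y.
Proof. by apply/matrixP => i j; rewrite !mxE /horner_eval !hornerE. Qed.
End LineMatrix.

(** Up to sign, this determinant is the discriminant of [char_poly X]. *)
Lemma line_poly_disc (F : fieldType) n :
  line_poly (fun X : 'M[F]_n.+1 => \det (horner_mx X (char_poly X)^`())).
Proof.
move=> X Y; exists (\det (horner_mx (line_mx X Y) (char_poly (line_mx X Y))^`())) => t.
rewrite -[RHS]/(horner_eval t _) -det_map_mx map_horner_mx -deriv_map map_char_poly.
by rewrite line_mxE.
Qed.

(** Over a field, its determinant is nonzero exactly when the row of ones is a cyclic vector of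
    [X]. *)
Definition krylov_mx (R : comNzRingType) n (X : 'M[R]_n.+1) : 'M_n.+1 :=
  \matrix_i (const_mx 1 *m X ^+ i : 'rV_n.+1).

Lemma line_poly_powers (F : fieldType) n :
  line_poly (fun X : 'M[F]_n.+1 => \det (krylov_mx X)).
Proof.
move=> X Y; exists (\det (krylov_mx (line_mx X Y))) => t.
rewrite -[RHS]/(horner_eval t _) -det_map_mx; congr (\det _).
apply/row_matrixP => i; rewrite -map_row !rowK map_mxM map_const_mx rmorph1.
by rewrite rmorphXn /= line_mxE.
Qed.

Lemma ex_distinct (F : fieldType) m : infinite_field F ->
  exists c : 'I_m -> F, injective c.
Proof.
move=> infF; have [t [t_uniq t_size]] : exists t : seq F, uniq t /\ size t = m.
  elim: m => [|m [t [t_uniq <-]]]; first by exists [::].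
  by have [x xt] := infF t; exists (x :: t); rewrite /= xt.
exists (fun i => t`_i) => i j /eqP; rewrite nth_uniq ?t_size // => /eqP.
exact: val_inj.
Qed.

Section DistinctDiag.
Variables (F : fieldType) (n : nat) (c : 'I_n.+1 -> F).
Hypothesis c_inj : injective c.
Local Notation D := (diag_mx (\row_i c i)).

(** In a Bezout relation between the characteristic polynomial and its derivative, evaluated at [D],
    the first term vanishes by Cayley-Hamilton, so the derivative becomes invertible. *)
Lemma disc_diag_neq0 : \det (horner_mx D (char_poly D)^`()) != 0.
Proof.
have D_trig : is_trig_mx D by exact: diag_mx_is_trig.
have : separable_poly (char_poly D).
  rewrite (char_poly_trig D_trig).
  rewrite (eq_bigr (fun i => 'X - (c i)%:P)); last by move=> i _; rewrite !mxE eqxx.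
  rewrite -(big_map c predT (fun x => 'X - x%:P)) separable_prod_XsubC map_inj_uniq //.
  exact: index_enum_uniq.
rewrite unlock => /Bezout_coprimepP [[u v]] /= /eqpP [[a b] /andP [/= a0 b0] uv].
have := congr1 (horner_mx D) uv; rewrite !linearZ /= rmorphD !rmorphM /= rmorph1.
rewrite Cayley_Hamilton mulr0 add0r => /(congr1 determinant).
rewrite !detZ det_mulmx det1 mulr1 => eq_det.
have : b ^+ n.+1 != 0 by rewrite expf_neq0.
by rewrite -eq_det !mulf_eq0 !negb_or => /and3P [].
Qed.

Lemma powers_diag_neq0 : \det (krylov_mx D) != 0.
Proof.
have -> : krylov_mx D = Vandermonde n.+1 (\row_i c i).
  apply/row_matrixP => i; rewrite rowK.
  have -> : D ^+ i = horner_mx D 'X^i by rewrite rmorphXn /= horner_mx_X.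
  rewrite horner_mx_diag mul_mx_diag; apply/rowP => j.
  by rewrite !mxE mul1r hornerXn.
rewrite det_Vandermonde; apply/prodf_neq0 => i _; apply/prodf_neq0 => j ij.
by rewrite !mxE subr_eq0 (inj_eq c_inj) eq_sym neq_ltn ij.
Qed.
End DistinctDiag.

Lemma scalar_ext_in_free (K F : fieldType) (f : {rmorphism K -> F}) (A : falgType K)
    r (u : 'I_r -> A) :
  (forall c : 'I_r -> K, \sum_i c i *: u i = 0 -> forall i, c i = 0) ->
  forall c : 'I_r -> F, \sum_i c i *: scalar_ext_in f (u i) = 0 -> forall i, c i = 0.
Proof.
move=> u_free c sum0; pose v i : scalar_ext idfun A := scalar_ext_in idfun (u i).
have v_free (b : 'I_r -> K) : \sum_i b i *: v i = 0 -> forall i, b i = 0.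
  move=> sum0'; apply: u_free; apply: (@scalar_ext_in_inj _ _ (@idfun K) A).
  rewrite raddf0 raddf_sum -[RHS]sum0'; apply: eq_bigr => i _.
  exact: scalar_ext_inZ.
apply: (@scalar_ext_map_free _ _ _ _ f f A r v v_free c).
rewrite -[RHS]sum0; apply: eq_bigr => i _.
by rewrite (@scalar_ext_map_in _ _ _ idfun f f).
Qed.

Section CyclicMatrix.
Variables (F : fieldType) (n : nat) (X : 'M[F]_n.+1).
Hypothesis powers_neq0 : \det (krylov_mx X) != 0.

Lemma cyclic_mx_eq0 (p : {poly F}) : (size p <= n.+1)%N -> horner_mx X p = 0 -> p = 0.
Proof.
move=> p_size pX; have : (\row_(i < n.+1) p`_i) *m krylov_mx X = 0.
  rewrite mulmx_sum_row -[RHS](mulmx0 _ (const_mx 1 : 'rV[F]_n.+1)) -{}pX.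
  rewrite -[p in horner_mx X p]coefK (poly_def (size p)) rmorph_sum /= mulmx_sumr.
  rewrite (big_ord_widen _ (fun i => const_mx 1 *m horner_mx X (p`_i *: 'X^i)) p_size).
  rewrite [RHS]big_mkcond; apply: eq_bigr => i _; rewrite rowK mxE.
  rewrite linearZ /= rmorphXn /= horner_mx_X -scalemxAr.
  by case: ltnP => // /(nth_default 0) ->; rewrite scale0r.
move/(congr1 (fun v => v *m invmx (krylov_mx X))).
rewrite mul0mx mulmxK ?unitmxE ?unitfE // => /rowP p0; apply/polyP => i.
rewrite coef0; case: (ltnP i n.+1) => [lti | lei].
  by have := p0 (Ordinal lti); rewrite !mxE.
by rewrite nth_default // (leq_trans p_size).
Qed.

(** Write [char_poly X = h * g] with [g] the gcd with the derivative. Then [g] is invertible at [X],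
    so [h] vanishes there by Cayley-Hamilton; for nonconstant [g] the degree of [h] is too small for
    that, [X] being cyclic. *)
Lemma cyclic_mx_separable :
  \det (horner_mx X (char_poly X)^`()) != 0 -> separable_poly (char_poly X).
Proof.
move=> disc; rewrite unlock; set g := gcdp (char_poly X) (char_poly X)^`().
have [h chi_gh] : exists h, char_poly X = h * g by apply/dvdpP; apply: dvdp_gcdl.
have [h' der_gh] : exists h', (char_poly X)^`() = h' * g.
  by apply/dvdpP; apply: dvdp_gcdr.
have chi0 : char_poly X != 0 by rewrite monic_neq0 ?char_poly_monic.
have gX : horner_mx X g \in unitmx.
  move: disc; rewrite der_gh rmorphM det_mulmx mulf_eq0 negb_or => /andP [_].
  by rewrite unitmxE unitfE.
rewrite /coprimep -/g eqn_leq size_poly_gt0.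
have g0 : g != 0 by apply: contra_neq chi0 => g0; rewrite chi_gh g0 mulr0.
rewrite g0 andbT leqNgt; apply: contra_neqN chi0 => g_gt1.
suff h0 : h = 0 by rewrite chi_gh h0 mul0r.
have [//|h0] := eqVneq h 0; apply: cyclic_mx_eq0.
  have := congr1 (fun p : {poly F} => size p) chi_gh.
  rewrite /= size_char_poly size_mul //; move: g_gt1; case: (size g) => [|[|m]] //.
  by rewrite !addnS /= => _ [->]; rewrite leq_addr.
have := congr1 (horner_mx X) chi_gh; rewrite Cayley_Hamilton rmorphM /=.
move/esym/(congr1 (fun Y => Y *m invmx (horner_mx X g))).
by rewrite mul0mx mulmxK.
Qed.
End CyclicMatrix.

(** Over a splitting field, a generic [x] has a separable characteristic polynomial and free powers
    below [n.+1]. The dependence of the first [n.+2] powers holds already over [K], and up to a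
    scalar it is that polynomial. *)
Lemma csa_separable_elt (K : fieldType) (n : nat) (A : csa K n.+1) :
  infinite_field K -> exists (x : A) (mu : {poly K}),
  [/\ mu \is monic, size mu = n.+2, separable_poly mu, horner_alg x mu = 0 &
      forall p : {poly K}, (size p <= n.+1)%N -> horner_alg x p = 0 -> p = 0].
Proof.
move=> infK; have [F [f [rho [rho_lin rho1 rhoM rho_inj rho_surj]]]] := csa_split A.
have [c c_inj] := ex_distinct n.+1 (infinite_field_ext f infK).
have [y rho_y] := rho_surj (diag_mx (\row_i c i)).
pose g (b : bool) := (if b then fun X : 'M[F]_n.+1 => \det (horner_mx X (char_poly X)^`())
  else fun X => \det (krylov_mx X)) \o rho.
have [||a ga] := scalar_ext_generic (g := g) infK.
- move=> b; apply: line_poly_linear rho_lin _; case: b.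
    exact: line_poly_disc.
  exact: line_poly_powers.
- move=> b; exists y; rewrite /g /= rho_y; case: b.
    exact: disc_diag_neq0.
  exact: powers_diag_neq0.
pose X := rho (scalar_ext_in f a).
have disc : \det (horner_mx X (char_poly X)^`()) != 0 := ga true.
have pows : \det (krylov_mx X) != 0 := ga false.
pose rl := GRing.isLinear.Build F (scalar_ext f A) _ _ rho rho_lin.
pose r : {linear scalar_ext f A -> 'M_n.+1} := HB.pack rho rl.
have rE p : rho (scalar_ext_in f (horner_alg a p)) = horner_mx X (map_poly f p).
  elim/poly_ind: p => [|p d IHp].
    have -> : scalar_ext_in f (horner_alg a 0) = 0 by rewrite !raddf0.
    by rewrite -[rho 0]/(r 0) !raddf0.
  have -> : scalar_ext_in f (horner_alg a (p * 'X + d%:P)) =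
      f d *: 1 + scalar_ext_in f (horner_alg a p) * scalar_ext_in f a.
    rewrite rmorphD rmorphM /= horner_algX horner_algC addrC raddfD /= scalar_ext_inZ.
    by congr (_ + _); apply: scalar_ext_inM.
  rewrite rho_lin rho1 rhoM IHp rmorphD rmorphM /= map_polyX map_polyC /=.
  by rewrite rmorphD rmorphM /= horner_mx_X horner_mx_C addrC scalemx1.
have in0 : scalar_ext_in f (0 : A) = 0 by apply: raddf0.
have a_eq0 (p : {poly K}) : (size p <= n.+1)%N -> horner_alg a p = 0 -> p = 0.
  move=> p_size pa; apply/eqP; rewrite -(map_poly_eq0 f); apply/eqP.
  apply: (cyclic_mx_eq0 pows); first by rewrite size_map_poly.
  by rewrite -rE pa in0 -[rho 0]/(r 0) raddf0.
have [mu [mu_monic mu_size mu_a]] : exists mu : {poly K},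
    [/\ mu \is monic, size mu = n.+2 & horner_alg a mu = 0].
  pose pw (i : 'I_n.+2) := a ^+ i.
  have pwE (d : 'I_n.+2 -> K) :
      horner_alg a (\poly_(i < n.+2) d (inord i)) = \sum_i d i *: pw i.
    rewrite poly_def linear_sum; apply: eq_bigr => i _.
    by rewrite inord_val linearZ /= rmorphXn /= horner_algX mulr_algl.
  have [d [i [d_rel di]]] : exists (d : 'I_n.+2 -> K) i,
      \sum_i d i *: pw i = 0 /\ d i != 0.
    apply: contrapT => no_rel.
    have /(scalar_ext_in_free (f := f)) pw_free (d : 'I_n.+2 -> K) :
        \sum_i d i *: pw i = 0 -> forall i, d i = 0.
      move=> d_rel i; apply: contrapT => /eqP di; apply: no_rel.
      by exists d, i.
    have chi_lead : (char_poly X)`_n.+1 = 1.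
      have /monicP := char_poly_monic X.
      by rewrite /lead_coef size_char_poly.
    have chi_rel : \sum_(i < n.+2) (char_poly X)`_i *: scalar_ext_in f (pw i) = 0.
      apply: rho_inj; rewrite -[LHS]/(r _) -[rho 0]/(r 0) raddf0 linear_sum /=.
      rewrite -[RHS](Cayley_Hamilton X).
      rewrite -[in RHS](coefK (char_poly X)) size_char_poly poly_def linear_sum.
      apply: eq_bigr => j _; rewrite [in RHS]linearZ /= -[rho _]/(r _) linearZ /=.
      have := rE 'X^j; rewrite map_polyXn [horner_alg a _]rmorphXn /= horner_algX.
      by rewrite /pw => <-.
    by have /eqP := pw_free _ chi_rel ord_max; rewrite chi_lead oner_eq0.
  pose q := \poly_(i < n.+2) d (inord i).
  have qa : horner_alg a q = 0 by rewrite pwE.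
  have q0 : q != 0.
    by apply: contra_neq di => /polyP/(_ i); rewrite coef_poly ltn_ord inord_val coef0.
  have q_size : size q = n.+2.
    apply/eqP; rewrite eqn_leq size_poly ltnNge; apply: contra_neqN q0 => q_size.
    exact: a_eq0.
  exists ((lead_coef q)^-1 *: q); split.
  - by rewrite monicE lead_coefZ mulVf ?lead_coef_eq0.
  - by rewrite size_scale ?invr_eq0 ?lead_coef_eq0.
  - by rewrite linearZ /= qa mulr0.
exists a, mu; split=> //.
suff chi : map_poly f mu = char_poly X.
  by rewrite -(separable_map f) chi; apply: cyclic_mx_separable.
apply/eqP; rewrite -subr_eq0; apply/eqP; apply: (cyclic_mx_eq0 pows); last first.
  by rewrite rmorphB /= Cayley_Hamilton -rE mu_a in0 -[rho 0]/(r 0) raddf0 subr0.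
apply/leq_sizeP => j; rewrite leq_eqVlt => /orP [/eqP <- | ltj].
  have := monicP (char_poly_monic X); have := monicP mu_monic.
  rewrite /lead_coef size_char_poly mu_size /= coefB coef_map => -> ->.
  by apply/eqP; rewrite subr_eq0; apply/eqP; exact: (rmorph1 f).
by rewrite coefB !nth_default ?subrr ?size_map_poly ?mu_size ?size_char_poly.
Qed.

(** * Orbits of p-groups *)

(** If no single term is [p ^ s], all terms are at most the previous power of [p], and [p] disjoint
    subfamilies with that sum can be taken out one after the other. *)
Lemma ex_subset_sum_pow p (I : finType) (f : I -> nat) s (A : {set I}) :
  prime p -> (forall i, i \in A -> exists2 e, (e <= s)%N & f i = (p ^ e)%N) ->
  (p ^ s <= \sum_(i in A) f i)%N ->
  exists2 B : {set I}, B \subset A & (\sum_(i in B) f i = p ^ s)%N.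
Proof.
move=> p_pr; have p0 := prime_gt0 p_pr; elim: s A => [|s IHs] A f_pow sumA.
  have [i iA] : exists i, i \in A.
    by apply/set0Pn; apply: contraTneq sumA => ->; rewrite big_set0.
  exists [set i]; rewrite ?sub1set // big_set1.
  by have [e] := f_pow i iA; rewrite leqn0 => /eqP ->.
have [[i iA fi]|no_i] := pselect (exists2 i, i \in A & f i = p ^ s.+1)%N.
  by exists [set i]; rewrite ?sub1set // big_set1.
have f_pow' i : i \in A -> exists2 e, (e <= s)%N & f i = (p ^ e)%N.
  move=> iA; have [e] := f_pow i iA; rewrite leq_eqVlt ltnS => /orP [/eqP -> fi|es fi].
    by case: no_i; exists i.
  by exists e.
have : (p <= p)%N by [].
(* Only the number of subfamilies is generalised, from [p] to [t <= p]. *)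
rewrite expnS; move: {1 3}p => t; elim: t => [|t IHt] tp.
  by exists set0; rewrite ?sub0set // big_set0.
have [B BA sumB] := IHt (ltnW tp).
have splitA : (\sum_(i in A) f i = \sum_(i in B) f i + \sum_(i in A :\: B) f i)%N.
  by rewrite (big_setID B) /= (setIidPr BA).
have [i /setDP [iA _]||C CA sumC] := IHs (A :\: B); first exact: f_pow'.
  rewrite -(leq_add2l (\sum_(i in B) f i)) -splitA sumB -mulSnr.
  by apply: leq_trans sumA; rewrite expnS leq_mul2r tp orbT.
exists (B :|: C).
  by rewrite subUset BA (subset_trans CA) ?subsetDl.
have [_ CB] : C \subset A /\ [disjoint C & B] by move: CA; rewrite subsetD => /andP.
rewrite (big_setID B) /= setUK setDUl setDv set0U (setDidPl CB) sumB sumC.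
by rewrite mulSn addnC.
Qed.

Lemma ex_partition_sum_pow p (I : finType) (f : I -> nat) s c (A : {set I}) :
  prime p -> (forall i, i \in A -> exists2 e, (e <= s)%N & f i = (p ^ e)%N) ->
  (\sum_(i in A) f i = c * p ^ s)%N ->
  exists b : I -> nat, (forall i, i \in A -> b i < c)%N /\
    forall j, (j < c)%N -> (\sum_(i in A | b i == j) f i = p ^ s)%N.
Proof.
move=> p_pr; elim: c A => [|c IHc] A f_pow sumA.
  exists (fun=> 0%N); split=> // i iA; have [e _ fi] := f_pow i iA.
  move: sumA => /eqP; rewrite mul0n sum_nat_eq0 => /forall_inP/(_ i iA).
  by rewrite fi expn_eq0 eqn0Ngt prime_gt0.
have [|B BA sumB] := ex_subset_sum_pow p_pr f_pow; first by rewrite sumA mulSn leq_addr.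
have [i /setDP [iA _]||b [b_lt b_sum]] := IHc (A :\: B); first exact: f_pow.
  apply/eqP; rewrite -(eqn_add2l (p ^ s)) -mulSn -sumA -{1}sumB.
  by rewrite [X in _ == X](big_setID B) /= (setIidPr BA).
exists (fun i => if i \in B then c else b i); split=> [i iA | j].
  by case: ifP => // iB; rewrite ltnW // ltnS b_lt // inE iB.
rewrite ltnS (big_setIDcond _ A B) /= (setIidPr BA) leq_eqVlt => /orP [/eqP -> | ltjc].
  rewrite [X in (_ + X)%N]big1 ?addn0.
    by rewrite -sumB; apply: eq_bigl => i; case: (i \in B); rewrite ?eqxx.
  move=> i /andP [iAB]; have := b_lt i iAB; move: iAB; rewrite inE => /andP [/negPf -> _].
  by move=> lt_bc /eqP bc; rewrite bc ltnn in lt_bc.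
rewrite big1 ?add0n => [|i /andP [-> /eqP cj]]; last by rewrite -cj ltnn in ltjc.
rewrite -(b_sum j ltjc); apply: eq_bigl => i.
by rewrite inE; case: (i \in B).
Qed.

Section Blocks.
Variables (gT : finGroupType) (P : {group gT}) (p n r : nat).
Variable (to : {action gT &-> 'I_n}).
Hypotheses (p_pr : prime p) (pP : (p.-group P)%g) (nE : n = (p ^ r.+1)%N).

(** A map onto the integers modulo [p] with fibres of equal size, [P] acting on the target by
    translations. *)
Definition block_map (b : 'I_n -> nat) :=
  [/\ forall i, (b i < p)%N, forall j, (j < p)%N -> #|[set i | b i == j]| = (p ^ r)%N &
      forall g, g \in P -> exists c, forall i, b (to i g) = ((b i + c) %% p)%N].

(** Every orbit has size [p ^ e] with [e <= r], so the orbits can be packed into [p] stable blocks,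
    and the shift is [0]. *)
Lemma ex_blocks_intransitive : (forall i, orbit to P i != setT) -> exists b, block_map b.
Proof.
move=> orb_proper; pose O := orbit to P @: setT.
have orbO i : orbit to P i \in O by rewrite imset_f.
have [] := @ex_partition_sum_pow p {set 'I_n} (fun X : {set 'I_n} => #|X|) r p O p_pr.
- move=> _ /imsetP [i _ ->].
  have : (#|orbit to P i| %| #|P|)%N by rewrite card_orbit dvdn_indexg.
  have [k ->] := p_natP pP; move/dvdn_pfactor => /(_ p_pr) [e _ oe]; exists e => //.
  have := orb_proper i; rewrite -properT => /proper_card; rewrite cardsT card_ord oe nE.
  by rewrite ltn_exp2l ?prime_gt1.
- have /card_partition <- : partition O setT.
    by apply: orbit_partition; apply/actsP => g _ i; rewrite !inE.
  by rewrite cardsT card_ord nE expnS.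
move=> b [b_lt b_sum]; exists (fun i => b (orbit to P i)); split.
- by move=> i; apply/b_lt/orbO.
- move=> j jp; rewrite -(b_sum j jp) -sum1_card.
  rewrite (partition_big (fun i => orbit to P i) (fun X => (X \in O) && (b X == j))) /=.
    apply: eq_bigr => _ /andP [/imsetP [i _ ->] bj]; rewrite -[RHS]sum1_card.
    apply: eq_bigl => l; rewrite inE.
    apply/andP/idP => [[_ /eqP <-]|]; first exact: orbit_refl.
    by move/orbit_eqP => ->; rewrite eqxx bj.
  by move=> i; rewrite inE orbO.
move=> g gP; exists 0%N => i; rewrite addn0 orbit_act // modn_small //.
exact/b_lt/orbO.
Qed.
(** The stabiliser of [i0] lies in a maximal subgroup [M], which is normal of index [p]. Hence
    [to i0 g] determines the coset of [g] in the cyclic group [P / M], and its exponent is the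
    block. *)
Lemma ex_blocks_transitive i0 : orbit to P i0 = setT -> exists b, block_map b.
Proof.
move=> orbT; have p_gt1 := prime_gt1 p_pr.
pose H := ('C_P[i0 | to])%G.
have HP : H \proper P.
  have := card_orbit_in_stab to i0 (subsetT P).
  rewrite properEcard subsetIl orbT cardsT card_ord /= => <-.
  by rewrite ltn_Pmull ?cardG_gt0 // nE -(expn0 p) ltn_exp2l.
have [M maxM HM] : exists2 M : {group gT}, maximal M P & H \subset M.
  by have [HeP|//] := maximal_exists (proper_sub HP); rewrite HeP properxx in HP.
have nMP := p_maximal_normal pP maxM; have sMP := normal_sub nMP.
have iMP := p_maximal_index pP maxM.
have nM g : g \in P -> g \in 'N(M)%g := subsetP (normal_norm nMP) g.
have oPM : #|(P / M)%g| = p by rewrite card_quotient ?normal_norm.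
have [x xP xM] : exists2 x, x \in P & x \notin M.
  apply/subsetPn; apply: contraL (maxgroupp maxM) => sPM.
  by rewrite properE sPM andbF.
pose y := coset M x.
have yPM : (P / M = <[y]>)%g.
  apply: nt_gen_prime; rewrite ?oPM // !inE mem_quotient // andbT.
  by apply: contra xM => /eqP /coset_idr; apply; apply: nM.
have oy : #[y]%g = p by rewrite orderE -yPM.
have exm g : g \in P -> exists2 m, (m < p)%N & coset M g = (y ^+ m)%g.
  move=> gP; have /cyclePmin : coset M g \in <[y]>%g by rewrite -yPM mem_quotient.
  by rewrite oy => -[m mp ->]; exists m.
have /choice [b bP] : forall i, exists m, (m < p)%N /\
    exists2 g, g \in P & to i0 g = i /\ coset M g = (y ^+ m)%g.
  move=> i; have /orbitP [g gP gi] : i \in orbit to P i0 by rewrite orbT inE.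
  by have [m mp gm] := exm g gP; exists m; split=> //; exists g.
have bE g : g \in P -> coset M g = (y ^+ b (to i0 g))%g.
  move=> gP; have [_ [g' g'P [eq_to <-]]] := bP (to i0 g).
  have : (g * g'^-1)%g \in M.
    apply: (subsetP HM); rewrite !inE groupM ?groupV //= sub1set inE actM -eq_to actK.
    by rewrite eqxx.
  move/coset_id; rewrite morphM ?morphV ?groupV ?nM //= => /eqP.
  by rewrite -eq_mulgV1 => /eqP.
have bM i h c : h \in P -> coset M h = (y ^+ c)%g -> b (to i h) = ((b i + c) %% p)%N.
  move=> hP hc; have /orbitP [g gP <-] : i \in orbit to P i0 by rewrite orbT inE.
  have := bE _ (groupM gP hP); rewrite actM morphM ?nM //= (bE g gP) hc -expgD.
  move/eqP; rewrite eq_expg_mod_order oy => /eqP ->; rewrite modn_small //.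
  by have [] := bP (to (to i0 g) h).
exists b; split.
- by move=> i; have [] := bP i.
- have xj j : coset M (x ^+ j)%g = (y ^+ j)%g by rewrite morphX // nM.
  (* The powers of [x] carry the block [0] onto every other block. *)
  have fibre j : (j < p)%N -> #|[set i | b i == j]| = #|[set i | b i == 0%N]|.
    move=> jp; rewrite -[RHS](card_imset _ (act_inj to (x ^+ j)%g)); apply: eq_card => i.
    apply/idP/imsetP => [|[i' ii' ->]]; rewrite !inE.
      move=> /eqP bi; exists (to i (x ^+ j)^-1%g); last by rewrite actKV.
      rewrite inE; have := bM (to i (x ^+ j)^-1%g) (x ^+ j)%g j.
      rewrite groupX // => /(_ isT (xj j)); rewrite actKV bi => bj.
      have [b_lt _] := bP (to i (x ^+ j)^-1%g).
      have : (b (to i (x ^+ j)^-1%g) + j == 0 + j %[mod p])%N.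
        by rewrite -bj add0n modn_small.
      by rewrite eqn_modDr mod0n modn_small.
    rewrite inE in ii'; rewrite (bM i' _ j) ?groupX //.
    by rewrite (eqP ii') add0n modn_small.
  have : (\sum_(j < p) #|[set i | b i == j]| = n)%N.
    transitivity (\sum_(i < n) 1)%N; last by rewrite sum1_card card_ord.
    under eq_bigr => j _ do rewrite -sum1dep_card.
    rewrite (exchange_big_dep xpredT) //=.
    apply: eq_bigr => i _; have [bi _] := bP i.
    by rewrite (big_pred1 (Ordinal bi)) // => j; rewrite -val_eqE eq_sym.
  under eq_bigr => j _ do rewrite fibre //.
  rewrite sum_nat_const card_ord => f0 j jp; rewrite fibre //.
  by apply/eqP; rewrite -(eqn_pmul2l (prime_gt0 p_pr)) f0 nE expnS.
move=> g gP; have [c cp gc] := exm g gP; exists c => i; exact: bM.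
Qed.

Lemma ex_blocks : exists b, block_map b.
Proof.
have [[i /eqP orbT]|no_i] := pselect (exists i, orbit to P i == setT).
  exact: ex_blocks_transitive orbT.
by apply: ex_blocks_intransitive => i; apply/negP => orbT; apply: no_i; exists i.
Qed.
End Blocks.

(** * The successor relation on blocks and its spanning trees *)

Section Succ.
Variables (p m n : nat) (b : 'I_n -> nat).
Hypotheses (p_gt0 : (0 < p)%N) (b_lt : forall i, (b i < p)%N).
Hypothesis b_card : forall j, (j < p)%N -> #|[set i | b i == j]| = m.
Hypothesis m_gt0 : (0 < m)%N.

Definition block_succ (i j : 'I_n) := b j == ((b i).+1 %% p)%N.

Lemma block_succ_shift (g : 'I_n -> 'I_n) c :
  (forall i, b (g i) = ((b i + c) %% p)%N) ->
  forall i j, block_succ (g i) (g j) = block_succ i j.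
Proof.
move=> bg i j; rewrite /block_succ !bg -addn1 modnDml addnAC eqn_modDr addn1.
by rewrite (modn_small (b_lt j)).
Qed.

Lemma card_block_succ : #|[set ij | block_succ ij.1 ij.2]| = (n * m)%N.
Proof.
rewrite -sum1dep_card -(pair_big_dep xpredT block_succ (fun _ _ => 1%N)) /=.
transitivity (\sum_(i < n) m)%N; last by rewrite sum_nat_const card_ord.
by apply: eq_bigr => i _; rewrite sum1dep_card b_card // ltn_mod.
Qed.

Lemma block_ex c : (c < p)%N -> exists i, b i = c.
Proof.
move=> cp; have /set0Pn [i] : [set i | b i == c] != set0 by rewrite -card_gt0 b_card.
by rewrite inE => /eqP; exists i.
Qed.

(** The relation is strongly connected: every index in the block at distance [t.+1] from [i] is
    reached in [t.+1] steps. *)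
Lemma block_succ_closed (V : {set 'I_n}) i : i \in V ->
  (forall j l, j \in V -> block_succ j l -> l \in V) -> V = setT.
Proof.
move=> iV closedV.
have reach t j : b j = ((b i + t.+1) %% p)%N -> j \in V.
  elim: t j => [|t IHt] j bj.
    by apply: (closedV i) => //; rewrite /block_succ bj addn1.
  have [l bl] := block_ex (ltn_pmod (b i + t.+1) p_gt0).
  apply: (closedV l); first exact: IHt.
  by rewrite /block_succ bj bl -[((b i + t.+1) %% p).+1]addn1 modnDml addn1 -addnS.
apply/setP => j; rewrite inE; have bi := b_lt i; have bj := b_lt j.
(* The distance [b j + (p - b i)] is congruent to [b j - b i] and always positive; indices in the
   block of [i] itself are reached by a full turn. *)
apply: (reach (b j + (p - b i).-1)%N); rewrite -addnS prednK ?subn_gt0 // addnCA subnKC 1?ltnW //.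
by rewrite modnDr modn_small.
Qed.
End Succ.

Section CycleWitness.
Variables (F : fieldType) (p m n : nat) (b : 'I_n.+1 -> nat).
Hypotheses (p_gt0 : (0 < p)%N) (b_lt : forall i, (b i < p)%N).
Hypothesis b_card : forall j, (j < p)%N -> #|[set i | b i == j]| = m.
Hypothesis m_gt1 : (1 < m)%N.

(* [X] is the adjacency matrix of a cycle of length [p] through [i] that avoids
   [i']. *)
Lemma ex_cycle_mx i i' : i != i' -> exists X : 'M[F]_n.+1,
  [/\ forall j l, ~~ block_succ p b j l -> X j l = 0,
      (X ^+ p) i i = 1 & (X ^+ p) i' i' = 0].
Proof.
(* [v] selects the vertex of the cycle in each block, namely [i] in its own block; for [c >= p] the
   value is a default. *)
move=> ii'; have exv c : exists v, [/\ (c < p)%N -> b v = c, v != i' & c = b i -> v = i].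
  have [-> | ci] := eqVneq c (b i); first by exists i.
  have [cp | pc] := ltnP c p; last by exists i; split=> //; rewrite ltnNge pc.
  (* The block [c] may contain [i']; having more than one element, it still offers another
     vertex. *)
  have /card_gt0P [v] : (0 < #|[set j | b j == c] :\ i'|)%N.
    rewrite -(ltn_add2l (i' \in [set j | b j == c])) -cardsD1 b_card // addn0.
    exact: leq_ltn_trans (leq_b1 _) m_gt1.
  rewrite !inE => /andP [vi' /eqP bv]; exists v; split=> // ci'.
  by rewrite ci' eqxx in ci.
have [v vP] := choice exv.
have bv c : (c < p)%N -> b (v c) = c by have [] := vP c.
have vi : v (b i) = i by have [_ _ ->] := vP (b i).
have vi' c : (i' == v c) = false by have [_ /negPf] := vP c; rewrite eq_sym.
exists (\matrix_(j, l) ((j == v (b j)) && (l == v ((b j).+1 %% p)%N))%:R).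
set X := \matrix_(_, _) _.
have Xv c : (c < p)%N -> delta_mx 0 (v c) *m X = delta_mx 0 (v (c.+1 %% p)%N) :> 'rV_n.+1.
  by move=> cp; rewrite -rowE; apply/rowP => l; rewrite !mxE bv // eqxx.
have XvX t : delta_mx 0 i *m X ^+ t = delta_mx 0 (v ((b i + t) %% p)%N) :> 'rV_n.+1.
  elim: t => [|t IHt]; first by rewrite expr0 mulmx1 addn0 modn_small // vi.
  rewrite exprSr mulmxA IHt Xv ?ltn_pmod //.
  by rewrite -[((b i + t) %% p).+1%N]addn1 modnDml addn1 addnS.
split.
- move=> j l; rewrite mxE => nsucc; case: eqP => //= _; case: eqP => //= lE.
  by case/negP: nsucc; rewrite /block_succ lE bv // ltn_pmod.
- have := XvX p; rewrite -rowE modnDr modn_small // vi => /rowP/(_ i).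
  by rewrite !mxE !eqxx.
have Xi' : row i' X = 0 by apply/rowP => l; rewrite !mxE vi'.
have : row i' (X ^+ p) = 0.
  by rewrite -(prednK p_gt0) exprS rowE mulmxA -rowE Xi' mul0mx.
by move/rowP/(_ i'); rewrite !mxE.
Qed.
End CycleWitness.

(* Conjugating by the diagonal matrix of the [t i] turns the entries along a
   spanning tree into [1]. *)
Lemma ex_gauge (F : fieldType) n (R : rel 'I_n.+1) (x : 'I_n.+1 -> 'I_n.+1 -> F) :
  (forall i j, R i j -> x i j != 0) ->
  (forall V : {set 'I_n.+1}, V != set0 -> V != setT ->
     exists i j, R i j /\ (i \in V) != (j \in V)) ->
  exists (t : 'I_n.+1 -> F) (T : {set 'I_n.+1 * 'I_n.+1}),
  [/\ forall i, t i != 0, #|T| = n &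
      forall i j, (i, j) \in T -> R i j /\ t i * x i j / t j = 1].
Proof.
move=> x0 conn; pose T_ok k (V : {set 'I_n.+1}) (t : 'I_n.+1 -> F) (T : {set 'I_n.+1 * 'I_n.+1}) :=
  [/\ #|V| = k.+1, #|T| = k, forall i, t i != 0,
      forall i j, (i, j) \in T -> (i \in V) && (j \in V) &
      forall i j, (i, j) \in T -> R i j /\ t i * x i j / t j = 1].
suff /(_ n (leqnn n)) [V [t [T [_ cT t0 _ TP]]]] :
    forall k, (k <= n)%N -> exists V t T, T_ok k V t T by exists t, T.
elim=> [|k IHk] kn.
  exists [set ord0], (fun=> 1), set0; split=> [|||i j|i j]; rewrite ?cards1 ?cards0 ?inE //.
  by move=> i; apply: oner_neq0.
have [V [t [T [cV cT t0 TV TP]]]] := IHk (ltnW kn).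
have [||i [j [Rij Vij]]] := conn V.
- by rewrite -card_gt0 cV.
- by apply: contraTneq kn => VT; rewrite -ltnNge -cV VT cardsT card_ord.
have xij := x0 i j Rij.
(* The edge may leave or enter [V]: [v] is its end outside [V], and [c] solves
   [t i * x i j / t j = 1] for the coordinate of [t] at [v]. *)
pose v := if i \in V then j else i.
pose c := if i \in V then t i * x i j else t j / x i j.
have vV : v \notin V by move: Vij; rewrite /v; case: ifP => [_|-> //]; case: (j \in V).
have c0 : c != 0 by rewrite /c; case: ifP; rewrite mulf_neq0 ?invr_eq0.
have neqv l : l \in V -> (l == v) = false by move=> lV; apply: contraNF vV => /eqP <-.
exists (v |: V), (fun l => if l == v then c else t l), ((i, j) |: T); split.
- by rewrite cardsU1 vV cV.
- rewrite cardsU1 cT; case: (boolP (_ \in T)) => // /TV.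
  by move: Vij; case: (i \in V); case: (j \in V).
- by move=> l; case: ifP.
- move=> i' j'; rewrite !inE => /orP [/eqP [-> ->]|/TV/andP [-> ->]]; last by rewrite !orbT.
  by move: Vij; rewrite /v; case: (i \in V); case: (j \in V); rewrite ?eqxx ?orbT.
move=> i' j'; rewrite !inE => /orP [/eqP [-> ->]|ij'T].
  split=> //; move: Vij neqv; rewrite /v /c; case: ifP => iV.
    case jV: (j \in V) => // _ neqv; rewrite eqxx neqv // divff // mulf_neq0 //.
  case jV: (j \in V) => // _ neqv; rewrite eqxx neqv // divfK // divff //.
have /andP [i'V j'V] := TV _ _ ij'T; rewrite !neqv //; exact: TP.
Qed.

(** * Peirce decomposition *)

Section Peirce.
Variables (F : fieldType) (n : nat) (B : falgType F) (e : 'I_n.+1 -> B).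
Hypotheses (sB : simple_alg B) (dimB : \dim {:B} = (n.+1 ^ 2)%N).
Hypothesis e_neq0 : forall i, e i != 0.
Hypothesis e_orth : forall i j, e i * e j = if i == j then e i else 0.
Hypothesis e_sum : \sum_i e i = 1.

(** If [e i * B * e j] were zero, the two-sided ideal of the [b] with [e i * B * b = 0] would
    contain [e j], hence [1], and [e i] would vanish. *)
Lemma peirce_ex i j : exists2 w, w != 0 & e i * w * e j = w.
Proof.
apply: contrapT => no_w.
have ij0 z : e i * z * e j = 0.
  apply: contrapT => /eqP w0; apply: no_w; exists (e i * z * e j) => //.
  by rewrite !mulrA e_orth eqxx -mulrA e_orth eqxx.
have : forall z, e i * z * 1 = 0.
  apply: (simple_ideal sB (T := fun b => forall z, e i * z * b = 0)).
  - by move=> z; rewrite mulr0.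
  - by move=> c a b a0 b0 z; rewrite mulrDr -scalerAr a0 b0 scaler0 addr0.
  - by move=> a b b0 z; rewrite mulrA -(mulrA (e i)) b0.
  - by move=> a b a0 z; rewrite mulrA a0 mul0r.
  - by exists (e j).
by move=> /(_ 1); rewrite !mulr1 => /eqP; rewrite (negPf (e_neq0 i)).
Qed.

(* The [n^2] Peirce components are nonzero and [dim B = n^2], so they are lines. *)
Lemma peirce_line i j : exists2 w, w != 0 &
  e i * w * e j = w /\ forall z, exists c, e i * z * e j = c *: w.
Proof.
have /choice [w wP] : forall ij : 'I_n.+1 * 'I_n.+1,
    exists w, w != 0 /\ e ij.1 * w * e ij.2 = w.
  by move=> [k l]; have [w w0 wE] := peirce_ex k l; exists w.
pose phi (c : 'M[F]_n.+1) : B := \sum_k \sum_l c k l *: w (k, l).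
have phi_lin : linear phi.
  move=> a c d; rewrite scaler_sumr -big_split; apply: eq_bigr => k _.
  rewrite scaler_sumr -big_split; apply: eq_bigr => l _.
  by rewrite !mxE scalerDl scalerA.
have phi_ij c k l : e k * phi c * e l = c k l *: w (k, l).
  rewrite mulr_sumr mulr_suml (bigD1 k) //= mulr_sumr mulr_suml (bigD1 l) //=.
  have [_ /= wkl] := wP (k, l).
  rewrite -scalerAr -scalerAl wkl big1 ?addr0 => [|l' l'l]; last first.
    have [_ /= <-] := wP (k, l').
    by rewrite -scalerAr -scalerAl -!mulrA e_orth (negPf l'l) !mulr0 scaler0.
  rewrite big1 ?addr0 // => k' k'k; rewrite mulr_sumr mulr_suml big1 // => l' _.
  have [_ /= <-] := wP (k', l').
  by rewrite -scalerAr -scalerAl !mulrA e_orth eq_sym (negPf k'k) !mul0r scaler0.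
pose phil := GRing.isLinear.Build F 'M[F]_n.+1 B _ phi phi_lin.
pose phi' : {linear 'M[F]_n.+1 -> B} := HB.pack phi phil.
have phi_inj : lker (linfun phi') == 0%VS.
  rewrite -subv0; apply/subvP => c; rewrite memv_ker lfunE memv0 /= => /eqP c0.
  apply/eqP/matrixP => k l; rewrite mxE; have := phi_ij c k l.
  rewrite c0 mulr0 mul0r => /esym/eqP; rewrite scaler_eq0; have [/negPf -> _] := wP (k, l).
  by rewrite orbF => /eqP.
have phi_surj : limg (linfun phi') = fullv.
  apply/eqP; rewrite eqEdim subvf dimB limg_dim_eq ?(eqP phi_inj) ?capv0 //.
  by rewrite dimvf /dim /= mulnn.
have [w0 wij] := wP (i, j); exists (w (i, j)) => //; split=> // z.
have /memv_imgP [c _ ->] : z \in limg (linfun phi') by rewrite phi_surj memvf.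
by exists (c i j); rewrite lfunE; apply: phi_ij.
Qed.

(** [B] acts from the right on [e ord0 * B], whose basis takes one vector from each line
    [e ord0 * B * e j]; there [e i] is the projection to the [i]-th vector. *)
Lemma peirce_mx_iso : exists rho : B -> 'M[F]_n.+1,
  mx_iso rho /\ forall i, rho (e i) = delta_mx i i.
Proof.
have /choice [w wP] : forall j, exists w, [/\ w != 0, e ord0 * w * e j = w &
    forall z, exists c, e ord0 * z * e j = c *: w].
  by move=> j; have [w w0 [wE wz]] := peirce_line ord0 j; exists w.
have we j k : w j * e k = if j == k then w j else 0.
  have [_ <- _] := wP j; rewrite -mulrA e_orth; case: (j == k) => //.
  by rewrite mulr0.
have ew j : e ord0 * w j = w j.
  by have [_ <- _] := wP j; rewrite !mulrA e_orth eqxx.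
pose u := [tuple w j | j < n.+1].
have uE (j : 'I_n.+1) : u`_j = w j by rewrite -tnth_nth tnth_mktuple.
pose I := limg (amull (e ord0)).
have memI v : v \in I -> e ord0 * v = v.
  by move=> /memv_imgP [z _ ->]; rewrite lfunE /= mulrA e_orth eqxx.
have Imem v : e ord0 * v = v -> v \in I.
  by move=> <-; have := memv_img (amull (e ord0)) (memvf v); rewrite lfunE.
have uI : basis_of I u.
  rewrite basisEfree; apply/and3P; split.
  - apply/freeP => c sum0 k; have : (\sum_j c j *: u`_j) * e k = 0 by rewrite sum0 mul0r.
    rewrite mulr_suml (bigD1 k) //= uE -scalerAl we eqxx big1 => [|j jk]; last first.
      by rewrite uE -scalerAl we (negPf jk) scaler0.
    rewrite addr0 => /eqP; rewrite scaler_eq0; have [/negPf -> _ _] := wP k.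
    by rewrite orbF => /eqP.
  - apply/span_subvP => v /mapP [j _ ->]; exact/Imem.
  rewrite size_tuple; apply: (leq_trans _ (_ : \dim <<u>> <= n.+1)%N); last first.
    by rewrite -[X in (_ <= X)%N](size_tuple u) dim_span.
  apply/dimvS/subvP => v /memI <-; rewrite -[v]mulr1 -e_sum !mulr_sumr.
  apply: memv_suml => j _; have [_ _ /(_ v) [c]] := wP j; rewrite mulrA => ->.
  by rewrite memvZ // -uE memv_span // mem_nth // size_tuple.
have I_right : (I * {:B} <= I)%VS.
  by apply/prodvP => v z /memI ev _; apply: Imem; rewrite mulrA ev.
have eI : e ord0 \in I by apply: Imem; rewrite e_orth eqxx.
have e_scal v : v \in I -> exists c, v * e ord0 = c *: e ord0.
  move=> /memI <-; have [w0 w0' [w0E w0z]] := peirce_line ord0 ord0.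
  have [c ->] := w0z v; have [d ed] := w0z 1.
  rewrite mulr1 e_orth eqxx in ed; exists (c / d); rewrite ed scalerA divfK //.
  by apply: contra_neq (e_neq0 ord0) => d0; rewrite ed d0 scale0r.
exists (rightmx u); split.
  split.
  - exact: rightmx_linear.
  - exact: (rightmx1 uI).
  - exact: (rightmxM I_right uI).
  - exact: (rightmx_inj sB I_right eI (e_neq0 ord0) uI).
  - exact: (rightmx_surj sB I_right eI (e_neq0 ord0) memI e_scal uI).
move=> i; apply: (rightmx_unique uI) => j; rewrite uE we.
rewrite (bigD1 i) //= big1 ?addr0 => [|l li]; rewrite mxE ?eqxx ?andbT.
  by rewrite uE; case: (eqVneq j i) => [->|_]; rewrite ?scale1r ?scale0r.
by rewrite (negPf li) andbF scale0r.
Qed.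
End Peirce.

(** * Splitting fields of polynomials *)

Lemma ex_split_poly (K : fieldType) (q : {poly K}) : q != 0 ->
  exists (L : fieldExtType K) (rs : seq L),
    map_poly (in_alg L) q %= \prod_(z <- rs) ('X - z%:P).
Proof.
have [m] := ubnP (size q); elim: m => // m IHm in K q * => q_lt q0.
have [q_le1 | q_gt1] := leqP (size q) 1.
  by exists K^o, [::]; rewrite big_nil -size_poly_eq1 size_map_poly eqn_leq q_le1 size_poly_gt0.
have [r r_irr r_q] := ex_irreducible_factor q_gt1.
have [E _ [x rx _]] := irredp_FAdjoin r_irr.
have /dvdpP [h qE] : 'X - x%:P %| map_poly (in_alg E) q.
  by apply: dvdp_trans (_ : _ %| map_poly (in_alg E) r) _; rewrite ?dvdp_XsubCl ?dvdp_map.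
have h0 : h != 0.
  by apply: contra_neq q0 => h0; apply/eqP; rewrite -(map_poly_eq0 (in_alg E)) qE h0 mul0r.
have [||L [rs h_rs]] := IHm E h.
- rewrite -ltnS; apply: leq_trans q_lt; rewrite -(size_map_poly (in_alg E) q) qE.
  by rewrite size_mul ?polyXsubC_eq0 // size_XsubC addn2.
- by [].
suff splits : map_poly (in_alg L) (map_poly (in_alg E) q) %=
    \prod_(z <- x%:A :: rs) ('X - z%:P).
  exists (baseFieldType L), (x%:A :: rs).
  rewrite (_ : map_poly _ q = map_poly (in_alg L) (map_poly (in_alg E) q)) //.
  by rewrite -map_poly_comp; apply: eq_map_poly => a; rewrite /= [LHS]baseField_scaleE.
rewrite qE rmorphM /= rmorphB /= map_polyX map_polyC /= big_cons mulrC.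
exact: eqp_mull.
Qed.

Lemma ex_splitting_field (K : fieldType) (q : {poly K}) : q != 0 ->
  exists (L : splittingFieldType K) (rs : seq L),
    map_poly (in_alg L) q %= \prod_(z <- rs) ('X - z%:P) /\ <<1 & rs>>%VS = fullv.
Proof.
move=> /ex_split_poly [E [rs q_rs]].
(* The field is cut down to the one generated by the roots, as the splitting field structure
   requires. *)
pose L : fieldExtType K := subvs_of <<1 & rs>>%AS.
pose zs : seq L := map (vsproj <<1 & rs>>%VS) rs.
have zsE : map vsval zs = rs.
  by rewrite -map_comp map_id_in // => z z_rs; rewrite /= vsprojK ?seqv_sub_adjoin.
have q_zs : map_poly (in_alg L) q %= \prod_(z <- zs) ('X - z%:P).
  rewrite -(eqp_map (vsval : L -> E)) rmorph_prod /=.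
  rewrite -map_poly_comp (_ : map_poly _ q = map_poly (in_alg E) q); last first.
    by apply: eq_map_poly => a; rewrite /= algid1.
  apply: eqp_trans q_rs _; rewrite -{1}zsE big_map.
  rewrite (eq_bigr (fun z => map_poly vsval ('X - z%:P))) ?eqpxx // => z _.
  by rewrite rmorphB /= map_polyX map_polyC.
have zs_full : <<1 & zs>>%VS = fullv.
  pose inE := linfun (vsval : L -> E).
  apply/vspaceP => u; rewrite memvf.
  have : val u \in (inE @: <<1 & zs>>)%VS.
    rewrite aimg_adjoin_seq aimg1 (_ : map inE zs = rs) ?(valP u) //.
    by rewrite -zsE; apply: eq_map => z; rewrite lfunE.
  by case/memv_imgP => v zs_v; rewrite lfunE => /val_inj ->.
have L_split : SplittingField.axiom L.
  exists (map_poly (in_alg L) q); last by exists zs.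
  by apply/polyOverP => i; rewrite coef_map /= memvZ // mem1v.
pose Ls := FieldExt_isSplittingField.Build K L L_split.
pose L' : splittingFieldType K := HB.pack (FieldExt.sort L) Ls.
by exists L', zs.
Qed.

Lemma ex_splitting_roots (K : fieldType) (q : {poly K}) n :
  q \is monic -> separable_poly q -> size q = n.+1 ->
  exists (L : splittingFieldType K) (l : 'I_n -> L),
  [/\ injective l, map_poly (in_alg L) q = \prod_i ('X - (l i)%:P) & galois 1 {:L}].
Proof.
move=> q_monic q_sep q_size.
have [L [rs [q_rs rs_full]]] := ex_splitting_field (monic_neq0 q_monic).
have qE : map_poly (in_alg L) q = \prod_(z <- rs) ('X - z%:P).
  by apply/eqP; rewrite -eqp_monic ?monic_map // monic_prod_XsubC.
have rs_size : size rs = n.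
  have := congr1 (fun p : {poly L} => size p) qE.
  by rewrite /= size_map_poly q_size size_prod_XsubC => -[].
have L_sep : separable_poly (map_poly (in_alg L) q) by rewrite separable_map.
exists L, (fun i => rs`_i); split.
- move: L_sep; rewrite qE separable_prod_XsubC => rs_uniq i j /eqP.
  by rewrite nth_uniq ?rs_size // => /eqP; apply: val_inj.
- by rewrite qE (big_nth 0) rs_size big_mkord.
apply/splitting_galoisField; exists (map_poly (in_alg L) q); split=> //.
  by apply/polyOverP => i; rewrite coef_map /= memvZ // mem1v.
by exists rs.
Qed.

(** * Rational functions and eigenspace idempotents *)

Section RatField.
Variables (k F E : fieldType) (f : {rmorphism k -> F}) (N : nat) (y : 'I_N -> F).
Variable g : {rmorphism E -> F}.

(** For [g = idfun] this is the subfield generated by [k] and [y]; for [g] the embedding of a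
    subfield, it is the intersection with that subfield. *)
Definition rat_pred : {pred E} := fun c => `[< rat_in f y (g c) >].

Lemma rat_predP c : reflect (rat_in f y (g c)) (c \in rat_pred).
Proof. exact: asboolP. Qed.

Lemma rat_in_const a : rat_in f y (f a).
Proof.
exists (a%:MP), 1; rewrite rmorph1 oner_neq0 divr1; split=> //.
by rewrite mmapC.
Qed.

Lemma rat_in_gen i : rat_in f y (y i).
Proof.
by exists 'X_i, 1; rewrite rmorph1 oner_neq0 divr1; split=> //; rewrite mmapX mmap1U.
Qed.

Fact rat_pred_divring_closed : GRing.divring_closed rat_pred.
Proof.
split=> [|c d|c d].
- by apply/rat_predP; rewrite rmorph1 -(rmorph1 f); apply: rat_in_const.
- move=> /rat_predP [P [Q [Q0 cE]]] /rat_predP [P' [Q' [Q'0 dE]]]; apply/rat_predP.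
  exists (P * Q' - P' * Q), (Q * Q'); rewrite rmorphM /= mulf_neq0 //; split=> //.
  by rewrite !rmorphB /= !rmorphM /= cE dE -mulNr addf_div // mulNr.
move=> /rat_predP [P [Q [Q0 cE]]] /rat_predP [P' [Q' [Q'0 dE]]]; apply/rat_predP.
have [P'0|P'0] := eqVneq (mmap f y P') 0.
  by rewrite fmorph_div dE P'0 mul0r invr0 mulr0 -(rmorph0 f); apply: rat_in_const.
exists (P * Q'), (Q * P'); rewrite !rmorphM /= mulf_neq0 //; split=> //.
by rewrite fmorphV cE dE invf_div mulf_div.
Qed.

HB.instance Definition _ := GRing.isDivringClosed.Build E rat_pred rat_pred_divring_closed.
End RatField.

Section Lagrange.
Variables (F : fieldType) (n : nat) (l : 'I_n.+1 -> F).
Hypothesis l_inj : injective l.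

Definition lagr (i : 'I_n.+1) : {poly F} :=
  (\prod_(j | j != i) (l i - l j))^-1 *: \prod_(j | j != i) ('X - (l j)%:P).

Lemma lagr_eval i j : (lagr i).[l j] = (i == j)%:R.
Proof.
rewrite hornerZ horner_prod; have [<-|ij] := eqVneq i j.
  rewrite [X in _ * X](eq_bigr (fun j => l i - l j)) => [|j' _]; last by rewrite hornerXsubC.
  rewrite mulVf //; apply/prodf_neq0 => j' j'i.
  by rewrite subr_eq0 (inj_eq l_inj) eq_sym.
by rewrite [X in _ * X](bigD1 j) 1?eq_sym //= hornerXsubC subrr mul0r mulr0.
Qed.

Lemma size_lagr i : size (lagr i) = n.+1.
Proof.
have /lregP c0 : (\prod_(j | j != i) (l i - l j))^-1 != 0.
  rewrite invr_eq0; apply/prodf_neq0 => j ji.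
  by rewrite subr_eq0 (inj_eq l_inj) eq_sym.
rewrite lreg_size // -big_filter size_prod_XsubC size_filter -sum1_count sum1_card.
by rewrite cardC1 card_ord.
Qed.

Lemma lagr_neq0 i : lagr i != 0.
Proof. by rewrite -size_poly_eq0 size_lagr. Qed.

Lemma lagr_sum : \sum_i lagr i = 1.
Proof.
apply/eqP; rewrite -subr_eq0; apply/eqP; set q := _ - 1.
have [//|q0] := eqVneq q 0.
have : all (root q) (map l (enum 'I_n.+1)).
  apply/allP => _ /mapP [j _ ->]; rewrite /root hornerD hornerN hornerC horner_sum.
  rewrite (bigD1 j) //= lagr_eval eqxx big1 ?addr0 ?subrr // => i ij.
  by rewrite lagr_eval (negPf ij).
move/(max_poly_roots q0); rewrite map_inj_uniq ?enum_uniq // => /(_ isT).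
rewrite size_map size_enum_ord ltnNge; case/negP.
apply: leq_trans (size_polyD _ _) _; rewrite geq_max size_polyN size_poly1 andbT.
by apply: leq_trans (size_sum _ _ _) _; apply/bigmax_leqP => i _; rewrite size_lagr.
Qed.

Lemma lagr_dvd i : exists c, ('X - (l i)%:P) * lagr i = c *: \prod_j ('X - (l j)%:P).
Proof.
exists (\prod_(j | j != i) (l i - l j))^-1.
by rewrite [X in _ = _ *: X](bigD1 i) //= -scalerAr.
Qed.
End Lagrange.

Section EigenIdem.
Variables (F : fieldType) (n : nat) (l : 'I_n.+1 -> F) (B : falgType F) (x : B).
Hypothesis l_inj : injective l.

(** Idempotency and orthogonality follow when the [l i] are distinct. The listed conditions
    determine the family and are carried over directly by automorphisms. *)
Definition eigen_idem (e : 'I_n.+1 -> B) :=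
  [/\ forall i, x * e i = l i *: e i, forall i, e i * x = l i *: e i & \sum_i e i = 1].

Lemma eigen_idem_orth_pair e e' i j :
  eigen_idem e -> eigen_idem e' -> i != j -> e i * e' j = 0.
Proof.
move=> [_ ex _] [xe' _ _] ij; apply/eqP.
have : (l i - l j) *: (e i * e' j) == 0.
  by rewrite scalerBl scalerAl -ex scalerAr -xe' mulrA subrr.
by rewrite scaler_eq0 subr_eq0 (inj_eq l_inj) (negPf ij).
Qed.

Lemma eigen_idem_unique e e' : eigen_idem e -> eigen_idem e' -> e =1 e'.
Proof.
move=> eP e'P i; have [[_ _ e_sum] [_ _ e'_sum]] := (eP, e'P).
transitivity (e i * e' i).
  rewrite -{1}[e i]mulr1 -e'_sum mulr_sumr (bigD1 i) //= big1 ?addr0 // => j ji.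
  by apply: (eigen_idem_orth_pair eP e'P); rewrite eq_sym.
rewrite -[RHS]mul1r -e_sum mulr_suml (bigD1 i) //= big1 ?addr0 // => j ji.
exact: (eigen_idem_orth_pair eP e'P).
Qed.

Lemma eigen_idem_orth e i j : eigen_idem e -> e i * e j = if i == j then e i else 0.
Proof.
move=> eP; case: eqVneq => [<-|]; last exact: (eigen_idem_orth_pair eP eP).
have [_ _ e_sum] := eP.
rewrite -[RHS]mulr1 -e_sum mulr_sumr (bigD1 i) //= big1 ?addr0 // => k ki.
by apply: (eigen_idem_orth_pair eP eP); rewrite eq_sym.
Qed.

Lemma ex_eigen_idem : horner_alg x (\prod_j ('X - (l j)%:P)) = 0 ->
  eigen_idem (fun i => horner_alg x (lagr l i)).
Proof.
move=> x_root; have xe i : x * horner_alg x (lagr l i) = l i *: horner_alg x (lagr l i).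
  apply/eqP; rewrite -subr_eq0 -mulr_algl -mulrBl -{1}(horner_algX x) -(horner_algC x).
  rewrite -rmorphB -rmorphM /=; have [c ->] := lagr_dvd l i.
  by rewrite linearZ /= x_root mulr0.
split=> // [i|]; last by rewrite -rmorph_sum lagr_sum ?rmorph1.
rewrite -xe; have : horner_alg x (lagr l i * 'X) = horner_alg x ('X * lagr l i).
  by rewrite mulrC.
by rewrite !rmorphM /= horner_algX.
Qed.
End EigenIdem.

(** * Generic elements with support in a relation *)

Definition mask_mx (F : fieldType) n (R : rel 'I_n) (X : 'M[F]_n) : 'M[F]_n :=
  \matrix_(i, j) if R i j then X i j else 0.

Lemma mask_mx_linear (F : fieldType) n (R : rel 'I_n) : linear (@mask_mx F n R).
Proof.
move=> c X Y; apply/matrixP => i j; rewrite !mxE; case: ifP => // _.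
by rewrite mulr0 addr0.
Qed.

Lemma line_poly_entry (F : fieldType) n (i j : 'I_n) :
  line_poly (fun X : 'M[F]_n => X i j).
Proof.
move=> X Y; exists ((X i j)%:P + 'X * (Y i j)%:P) => t.
by rewrite !mxE !hornerE.
Qed.

Lemma line_poly_pow_diag (F : fieldType) n p (i j : 'I_n.+1) :
  line_poly (fun X : 'M[F]_n.+1 => (X ^+ p) i i - (X ^+ p) j j).
Proof.
move=> X Y; exists ((line_mx X Y ^+ p) i i - (line_mx X Y ^+ p) j j) => t.
by rewrite -(line_mxE X Y) -!rmorphXn !mxE /horner_eval hornerD hornerN.
Qed.

Lemma ex_generic_mask (K F : fieldType) (f : {rmorphism K -> F}) (A : falgType K) n
    (rho : scalar_ext f A -> 'M[F]_n.+1) (R : rel 'I_n.+1) p :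
  infinite_field K -> mx_iso rho ->
  (forall i i', i != i' -> exists X : 'M[F]_n.+1,
     [/\ forall j l, ~~ R j l -> X j l = 0, (X ^+ p) i i = 1 & (X ^+ p) i' i' = 0]) ->
  exists a, (forall i j, rho (scalar_ext_in f a) i j != 0) /\
    injective (fun i => (mask_mx R (rho (scalar_ext_in f a)) ^+ p) i i).
Proof.
move=> infK [rho_lin _ _ _ rho_surj] witness.
pose I : finType := (bool * ('I_n.+1 * 'I_n.+1))%type.
(* A pair of distinct indices compares two diagonal entries of the [p]-th power. A pair [(i, i)] is
   to impose nothing, and gets the constant [1] because each condition must be satisfiable. *)
pose g (u : I) : scalar_ext f A -> F := if u.1 then (fun X : 'M[F]_n.+1 => X u.2.1 u.2.2) \o rho
  else if u.2.1 == u.2.2 then fun=> 1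
  else (fun X : 'M[F]_n.+1 => (X ^+ p) u.2.1 u.2.1 - (X ^+ p) u.2.2 u.2.2) \o (mask_mx R \o rho).
have [||a ga] := scalar_ext_generic (g := g) infK.
- move=> [[] [i j]]; rewrite /g /=; first exact: line_poly_linear rho_lin (line_poly_entry _ _).
  case: ifP => _; first by move=> y w; exists 1 => t; rewrite hornerE.
  apply: line_poly_linear (line_poly_pow_diag _ _ _) => c X Y.
  by rewrite /= rho_lin mask_mx_linear.
- move=> [[] [i j]]; rewrite /g /=.
    by have [y yE] := rho_surj (const_mx 1); exists y; rewrite yE mxE oner_neq0.
  case: eqVneq => [_|ij]; first by exists 0; apply: oner_neq0.
  have [X [XR Xi Xj]] := witness i j ij; have [y yE] := rho_surj X; exists y.
  have yX : mask_mx R (rho y) = X.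
    by apply/matrixP => k l; rewrite mxE yE; case: ifPn => // /XR ->.
  by rewrite /= yX Xi Xj subr0 oner_neq0.
exists a; split=> [i j|i j eq_ij]; first exact: (ga (true, (i, j))).
apply: contrapT => /eqP ij; have := ga (false, (i, j)).
by rewrite /g /= (negPf ij) /= subr_eq0 => /eqP.
Qed.

Lemma mx_iso_conj (F : fieldType) n (B : falgType F) (rho : B -> 'M[F]_n.+1) (t : 'I_n.+1 -> F) :
  mx_iso rho -> (forall i, t i != 0) ->
  mx_iso (fun z => \matrix_(i, j) (t i * rho z i j / t j)).
Proof.
move=> [rho_lin rho1 rhoM rho_inj rho_surj] t0.
split=> [c x y||x y|x y /matrixP eq_xy|X].
- apply/matrixP => i j; rewrite !mxE rho_lin !mxE mulrDr mulrDl; congr (_ + _).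
  by rewrite mulrCA !mulrA.
- apply/matrixP => i j; rewrite !mxE rho1 !mxE; case: eqVneq => [->|_].
    by rewrite mulr1 divff.
  by rewrite mulr0 mul0r.
- apply/matrixP => i j; rewrite !mxE rhoM !mxE mulr_sumr mulr_suml.
  apply: eq_bigr => l _; rewrite !mxE -!mulrA mulKf //.
- apply: rho_inj; apply/matrixP => i j; have := eq_xy i j; rewrite !mxE.
  by move/(mulIf (invr_neq0 (t0 j)))/(mulfI (t0 i)).
have [z zE] := rho_surj (\matrix_(i, j) ((t i)^-1 * X i j * t j)); exists z.
by apply/matrixP => i j; rewrite !mxE zE !mxE !mulrA divff // mul1r mulfK.
Qed.

(** * Descent to a small field *)

Section GaloisFixed.
Variables (K L F : fieldType) (h : {rmorphism K -> L}) (g : {rmorphism L -> F}).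
Variables (f : {rmorphism K -> F}) (n : nat) (A : csa K n.+1).
Variables (T : Type) (S : T -> {rmorphism F -> F}).
Hypothesis f_gh : f =1 g \o h.
Hypothesis S_g : forall t c, S t (g c) = g c.
Hypothesis S_ex : forall c, (forall t, S t c = c) -> exists c', c = g c'.
Variables (x : A) (l : 'I_n.+1 -> F) (act : T -> 'I_n.+1 -> 'I_n.+1).
Hypotheses (l_inj : injective l) (act_inj : forall t, injective (act t)).
Hypothesis S_l : forall t i, S t (l i) = l (act t i).
Hypothesis x_root : horner_alg (scalar_ext_in f x) (\prod_j ('X - (l j)%:P)) = 0.
Hypothesis x_free : forall q : {poly F},
  (size q <= n.+1)%N -> horner_alg (scalar_ext_in f x) q = 0 -> q = 0.

Local Notation B := (scalar_ext f A).
Local Notation em := (@scalar_ext_map _ _ _ h g f A).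
Local Notation SB t := (@scalar_ext_map _ _ _ f (S t) f A).
Local Notation iota := (@scalar_ext_in _ _ f A).

Let S_f t : f =1 S t \o f.
Proof. by move=> c; rewrite /= f_gh /= S_g. Qed.

Let e i : B := horner_alg (iota x) (lagr l i).

Let eP : eigen_idem l (iota x) e.
Proof. exact: ex_eigen_idem x_root. Qed.

Let e_neq0 i : e i != 0.
Proof.
apply: contra_neq (lagr_neq0 l_inj i) => e0; apply: x_free e0.
by rewrite size_lagr.
Qed.

Let e_orth i j : e i * e j = if i == j then e i else 0.
Proof. exact: eigen_idem_orth eP. Qed.

Let SBM t (y z : B) : SB t (y * z) = SB t y * SB t z.
Proof. by have [_ ->] := scalar_ext_map_is_monoid_morphism A (S_f t). Qed.

Let SB1 t : SB t 1 = 1.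
Proof. by have [->] := scalar_ext_map_is_monoid_morphism A (S_f t). Qed.

Let SBin t a : SB t (iota a) = iota a.
Proof. exact: scalar_ext_map_in (S_f t) a. Qed.

(** Since [iota x] is fixed, the images of the [e i], suitably reindexed, are again its eigenspace
    idempotents, and uniqueness identifies them. *)
Let SBe t i : SB t (e i) = e (act t i).
Proof.
have [xe ex e_sum] := eP.
pose r := invF (@act_inj t); have rK := f_invF (@act_inj t).
have e'P : eigen_idem l (iota x) (fun i => SB t (e (r i))).
  split=> [j|j|].
  - by rewrite -{1}(SBin t) -SBM xe scalar_ext_mapZ S_l rK.
  - by rewrite -{1}(SBin t) -SBM ex scalar_ext_mapZ S_l rK.
  rewrite -(SB1 t) -e_sum raddf_sum; symmetry.
  apply: (reindex r); exists (act t) => j _; [exact: rK | exact: invF_f].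
by have := eigen_idem_unique l_inj e'P eP (act t i); rewrite /r invF_f.
Qed.

Let fixed_descends (z : B) : (forall t, SB t z = z) -> exists z', z = em z'.
Proof.
move=> z_fix; have /choice [c cP] : forall i, exists c, z ord0 i = g c.
  by move=> i; apply: S_ex => t; rewrite -{2}(z_fix t) scalar_ext_mapE.
by exists (\row_i c i); apply/rowP => i; rewrite !mxE cP.
Qed.

Let SBem t z : SB t (em z) = em z.
Proof. by apply/rowP => i; rewrite !mxE S_g. Qed.

Variables (p : nat) (R : rel 'I_n.+1).
Hypothesis infK : infinite_field K.
Hypothesis R_act : forall t i j, R (act t i) (act t j) = R i j.
Hypothesis R_cycle : forall i i', i != i' -> exists X : 'M[F]_n.+1,
  [/\ forall j l, ~~ R j l -> X j l = 0, (X ^+ p) i i = 1 & (X ^+ p) i' i' = 0].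

(** [rho] need not be equivariant, but [rho z i i] is the coefficient of [e i] in [e i * z * e i],
    so automorphisms permute the diagonal entries of a rational element. Hence its trace is
    rational. The sums defining [a] and [th] are invariant because [R] is. *)
Lemma ex_galois_generators : exists rho : B -> 'M[F]_n.+1,
  [/\ mx_iso rho, forall z, exists c, \tr (rho (em z)) = g c &
   exists a th, [/\ forall i j, (rho (em a) i j != 0) = R i j,
     injective (fun i => (rho (em a) ^+ p) i i) &
     rho (em th) = diag_mx (\row_i (rho (em a) ^+ p) i i)]].
Proof.
have sB := scalar_ext_simple (f := f) (csa_central A) (@csa_simple _ _ A).
have dimB : \dim {:B} = (n.+1 ^ 2)%N by rewrite dim_scalar_ext csa_degree.
have [_ _ e_sum] := eP.
have [rho [rho_iso rho_e]] := peirce_mx_iso sB dimB e_neq0 e_orth e_sum.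
have [rho_lin rho1 rhoM rho_inj rho_surj] := rho_iso.
pose rl := GRing.isLinear.Build F B _ _ rho rho_lin.
pose rho' : {linear B -> 'M_n.+1} := HB.pack rho rl.
have rho_sum (Q : pred 'I_n.+1) (u : 'I_n.+1 -> B) :
    rho (\sum_(i | Q i) u i) = \sum_(i | Q i) rho (u i).
  by rewrite -[rho _]/(rho' _) linear_sum.
have rho_ee i j z : rho (e i * z * e j) = rho z i j *: delta_mx i j.
  rewrite !rhoM !rho_e; apply/matrixP => k m; rewrite !mxE (bigD1 j) //= big1 ?addr0.
    rewrite !mxE (bigD1 i) //= big1 ?addr0 => [|i' i'i]; rewrite !mxE ?eqxx.
      by rewrite andbT; case: (k == i); case: (m == j); rewrite ?mulr1 ?mul1r ?mulr0 ?mul0r.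
    by rewrite (negPf i'i) andbF mul0r.
  by move=> j' j'j; rewrite !mxE (negPf j'j) mulr0.
have rho_diag i z : e i * z * e i = rho z i i *: e i.
  by apply: rho_inj; rewrite rho_ee -[RHS]/(rho' _) linearZ /= rho_e.
exists rho; split=> // [z|].
  apply: S_ex => t; rewrite raddf_sum [RHS](reindex_inj (@act_inj t)) /=.
  apply: eq_bigr => i _; apply/eqP; rewrite -subr_eq0.
  have : (S t (rho (em z) i i) - rho (em z) (act t i) (act t i)) *: e (act t i) == 0.
    by rewrite scalerBl -rho_diag -!SBe -scalar_ext_mapZ -rho_diag !SBM SBem subrr.
  by rewrite scaler_eq0 (negPf (e_neq0 _)) orbF.
have [a0 [a0_neq0 a0_inj]] := ex_generic_mask infK rho_iso R_cycle.
pose a : B := \sum_i \sum_(j | R i j) e i * iota a0 * e j.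
have rho_a : rho a = mask_mx R (rho (iota a0)).
  rewrite rho_sum; apply/matrixP => i j.
  rewrite summxE (bigD1 i) //= [X in _ + X]big1 ?addr0 => [|i' i'i]; last first.
    rewrite rho_sum summxE big1 // => j' _.
    by rewrite rho_ee !mxE eq_sym (negPf i'i) mulr0.
  rewrite rho_sum summxE mxE; case: ifP => Rij.
    rewrite (bigD1 j) //= rho_ee !mxE !eqxx mulr1 big1 ?addr0 // => j' /andP [_ j'j].
    by rewrite rho_ee !mxE [j == j']eq_sym (negPf j'j) andbF mulr0.
  rewrite big1 // => j' Rij'; rewrite rho_ee !mxE.
  have [jj'|_] := eqVneq j j'; last by rewrite andbF mulr0.
  by rewrite jj' Rij' in Rij.
have a_fix t : SB t a = a.
  rewrite raddf_sum [RHS](reindex_inj (@act_inj t)) /=; apply: eq_bigr => i _.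
  rewrite raddf_sum [RHS](reindex_inj (@act_inj t)) /=.
  by apply: eq_big => [j|j _]; rewrite ?R_act // !SBM SBin !SBe.
have [a' aE] := fixed_descends a_fix.
pose th : B := \sum_i e i * a ^+ p * e i.
have th_fix t : SB t th = th.
  rewrite raddf_sum [RHS](reindex_inj (@act_inj t)) /=; apply: eq_bigr => i _.
  rewrite !SBM !SBe; congr (_ * _ * _).
  elim: p => [|q IHq]; first by rewrite expr0 SB1.
  by rewrite exprS SBM a_fix IHq.
have [th' thE] := fixed_descends th_fix.
have rhoX z q : rho (z ^+ q) = rho z ^+ q.
  by elim: q => [|q IHq]; rewrite ?expr0 ?rho1 // !exprS rhoM IHq.
exists a', th'; rewrite -aE -thE; split.
- move=> i j; rewrite rho_a mxE; case: ifP => _; first exact: a0_neq0.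
  by rewrite eqxx.
- by rewrite rho_a.
rewrite rho_sum; apply/matrixP => i j; rewrite summxE !mxE.
rewrite (bigD1 i) //= big1 ?addr0 => [|i' i'i]; rewrite rho_ee !mxE rhoX.
  by rewrite eqxx eq_sym; case: eqP; rewrite ?mulr1 ?mulr0.
by rewrite eq_sym (negPf i'i) mulr0.
Qed.
End GaloisFixed.

(** Bounds the transcendence degree of [E] by the number of generators of a larger field, which need
    not lie in [E]. *)
Lemma alg_indep_rat_in (k F : fieldType) (E : fieldExt k) (g : {rmorphism E -> F})
    N (y : 'I_N -> F) d (x : 'I_d -> E) :
  (forall i, rat_in (g \o ext_emb E) y (g (x i))) -> alg_indep x -> (d <= N)%N.
Proof.
move=> xy x_indep; rewrite leqNgt; apply/negP => /(rat_in_alg_dep xy) [P P0 Px].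
case/eqP: P0; apply: x_indep; apply: (fmorph_inj g); rewrite rmorph0 -[RHS]Px.
rewrite /mmap rmorph_sum; apply: eq_bigr => m _.
by rewrite rmorphM rmorph_prod; congr (_ * _); apply: eq_bigr => i _; rewrite rmorphXn.
Qed.

Section MidDescent.
Variables (k K F : fieldType) (L : fieldExt k) (h : {rmorphism K -> L}).
Variables (g : {rmorphism L -> F}) (f : {rmorphism K -> F}) (n : nat) (A : csa K n.+1).
Hypothesis f_gh : f =1 g \o h.
Local Notation B := (scalar_ext f A).
Local Notation AL := (scalar_ext h A).
Local Notation em := (@scalar_ext_map _ _ _ h g f A).
Variables (p : nat) (R : rel 'I_n.+1) (rho : B -> 'M[F]_n.+1) (a th : AL).
Hypothesis R_closed : forall (V : {set 'I_n.+1}) i, i \in V ->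
  (forall j l, j \in V -> R j l -> l \in V) -> V = setT.
Hypothesis rho_iso : mx_iso rho.
Hypothesis rho_tr : forall z, exists c, \tr (rho (em z)) = g c.
Hypothesis rho_a : forall i j, (rho (em a) i j != 0) = R i j.
Hypothesis a_diag_inj : injective (fun i => (rho (em a) ^+ p) i i).
Hypothesis rho_th : rho (em th) = diag_mx (\row_i (rho (em a) ^+ p) i i).
Local Notation d i := ((rho (em a) ^+ p) i i).

Let rho_lin : linear rho. Proof. by have [] := rho_iso. Qed.
Let rho1 : rho 1 = 1. Proof. by have [] := rho_iso. Qed.
Let rhoM x y : rho (x * y) = rho x * rho y. Proof. by have [_ _ ->] := rho_iso. Qed.
Let rho_inj : injective rho. Proof. by have [] := rho_iso. Qed.
Let rho_surj X : exists x, rho x = X. Proof. by have [_ _ _ _] := rho_iso; apply. Qed.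

Let rho_is_linear := GRing.isLinear.Build F B 'M[F]_n.+1 _ rho rho_lin.
Let rho' : {linear B -> 'M[F]_n.+1} := HB.pack rho rho_is_linear.

Let rhoZ c x : rho (c *: x) = c *: rho x.
Proof. by rewrite -[rho _]/(rho' _) linearZ. Qed.
Let rhoD x y : rho (x + y) = rho x + rho y.
Proof. by rewrite -[rho _]/(rho' _) linearD. Qed.
Let rho0 : rho 0 = 0.
Proof. by rewrite -[rho _]/(rho' _) linear0. Qed.
Let rho_sum (I : finType) (u : I -> B) : rho (\sum_i u i) = \sum_i rho (u i).
Proof. by rewrite -[rho _]/(rho' _) linear_sum. Qed.

Let rho_horner z q : rho (horner_alg z q) = horner_mx (rho z) q.
Proof.
elim/poly_ind: q => [|q c IHq]; first by rewrite !raddf0 rho0.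
rewrite !rmorphD !rmorphM /= horner_algX horner_algC horner_mx_X horner_mx_C.
by rewrite rhoD rhoM IHq rhoZ rho1 scalemx1.
Qed.

Let emM x y : em (x * y) = em x * em y.
Proof. by have [_ ->] := scalar_ext_map_is_monoid_morphism A f_gh. Qed.
Let em1 : em 1 = 1.
Proof. by have [->] := scalar_ext_map_is_monoid_morphism A f_gh. Qed.

(* A subspace of [B] that is a subalgebra containing [a] and [th] is [B]: the
   latter gives the diagonal idempotents, and the former moves between them. *)
Lemma full_subalg (U : {vspace B}) : 1 \in U -> em a \in U -> em th \in U ->
  (forall x y, x \in U -> y \in U -> x * y \in U) -> U = fullv.
Proof.
move=> U1 Ua Uth UM.
have Uhorner q : horner_alg (em th) q \in U.
  elim/poly_ind: q => [|q c IHq]; first by rewrite raddf0 mem0v.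
  by rewrite rmorphD rmorphM /= horner_algX horner_algC memvD ?UM ?memvZ.
have /choice [u uE] : forall ij : 'I_n.+1 * 'I_n.+1, exists u, rho u = delta_mx ij.1 ij.2.
  by move=> ij; apply: rho_surj.
have uU i j : u (i, j) \in U.
  have diagU l : u (l, l) \in U.
    rewrite (_ : u (l, l) = horner_alg (em th) (lagr (fun i => d i) l)) //.
    apply: rho_inj; rewrite rho_horner uE rho_th horner_mx_diag.
    apply/matrixP => r s; rewrite !mxE lagr_eval //.
    case: (eqVneq r s) => [<-|rs]; first by rewrite mulr1n eq_sym andbb.
    by rewrite mulr0n; case: (eqVneq r l) => //= rl; rewrite eq_sym -rl (negPf rs).
  suff VT : [set j | u (i, j) \in U] = setT by have := in_setT j; rewrite -VT inE.
  apply: (R_closed (i := i)); first by rewrite inE.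
  move=> r s; rewrite !inE => ir_U Rrs.
  have : u (i, r) * em a * u (s, s) \in U by rewrite !UM.
  suff -> : u (i, r) * em a * u (s, s) = rho (em a) r s *: u (i, s).
    move=> /(memvZ (rho (em a) r s)^-1); rewrite scalerA mulVf ?scale1r //.
    by rewrite rho_a.
  apply: rho_inj; rewrite !rhoM rhoZ !uE /=; apply/matrixP => v w; rewrite !mxE.
  rewrite (bigD1 s) //= !mxE (bigD1 r) //= !mxE !eqxx !big1 ?addr0.
  - by rewrite andbT; case: (v == i); case: (w == s); rewrite ?mulr1 ?mul1r ?mulr0 ?mul0r.
  - by move=> s' s's; rewrite !mxE (negPf s's) mulr0.
  by move=> r' r'r; rewrite !mxE (negPf r'r) andbF mul0r.
apply/vspaceP => z; rewrite memvf.
rewrite (_ : z = \sum_i \sum_j rho z i j *: u (i, j)).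
  by apply: memv_suml => i _; apply: memv_suml => j _; rewrite memvZ.
apply: rho_inj; rewrite {1}[rho z]matrix_sum_delta rho_sum; apply: eq_bigr => i _.
by rewrite rho_sum; apply: eq_bigr => j _; rewrite rhoZ uE.
Qed.

Let emL (I : finType) (c : I -> L) (u : I -> AL) :
  em (\sum_i c i *: u i) = \sum_i g (c i) *: em (u i).
Proof. by rewrite [LHS]raddf_sum; apply: eq_bigr => i _; apply: scalar_ext_mapZ. Qed.

(** The elements satisfying [B0] form an algebra over [M]. By [full_subalg] a maximal [L]-free
    family [ws] among them has [n.+1 ^ 2] members, and the trace form gives coordinates in [M] to
    each of these elements. *)
Lemma ex_mid_descent : exists M : midField L,
  (exists A0 : csa (mid_ext M) n.+1, alg_iso (csa_ext (mid_incl M) A0) (csa_ext h A)) /\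
  forall e (x : 'I_e -> mid_ext M), alg_indep x ->
    (e <= #|[set ij | R ij.1 ij.2]| - n)%N.
Proof.
have [||t [T [t0 cT TP]]] := @ex_gauge F n R (fun i j => rho (em a) i j).
- by move=> i j Rij; rewrite rho_a.
- move=> V V0 VT; apply: contrapT => no_edge; case/eqP: VT.
  have /set0Pn [i iV] := V0; apply: (R_closed iV) => j l jV Rjl.
  apply: contrapT => lV; apply: no_edge; exists j, l; split=> //.
  by rewrite jV; apply/eqP => /esym.
pose rt z : 'M[F]_n.+1 := \matrix_(i, j) (t i * rho z i j / t j).
have [rt_lin rt1 rtM _ _] : mx_iso rt := mx_iso_conj rho_iso t0.
have rt_diag z i : rt z i i = rho z i i by rewrite mxE mulrAC divff ?mul1r.
pose E := [set ij | R ij.1 ij.2] :\: T.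
have cE : #|E| = (#|[set ij | R ij.1 ij.2]| - n)%N.
  have /setIidPr TR : T \subset [set ij | R ij.1 ij.2].
    by apply/subsetP => -[i j] /TP [Rij _]; rewrite inE.
  by rewrite cardsD TR cT.
pose y (i : 'I_#|E|) := rt (em a) (enum_val i).1 (enum_val i).2.
pose iota : {rmorphism k -> F} := g \o ext_emb L.
pose FM := rat_pred iota y (@idfun F).
pose LM := rat_pred iota y g.
have FM_LM c : g c \in FM -> c \in LM by move=> /rat_predP ?; apply/rat_predP.
have LM_emb c : ext_emb L c \in LM by apply/rat_predP/rat_in_const.
pose M : midField L := MidField LM_emb.
pose B0 z := forall i j, rt (em z) i j \in FM.
have B0M z1 z2 : B0 z1 -> B0 z2 -> B0 (z1 * z2).
  by move=> z1B z2B i j; rewrite emM rtM mxE rpred_sum // => l _; rewrite rpredM.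
have B01 : B0 1.
  by move=> i j; rewrite em1 rt1 mxE; case: eqP; rewrite ?rpred1 ?rpred0.
have B0a : B0 a.
  move=> i j; have [Rij|Rij] := boolP (R i j); last first.
    by move: Rij; rewrite -rho_a negbK mxE => /eqP ->; rewrite mulr0 mul0r rpred0.
  have [ijT|ijT] := boolP ((i, j) \in T).
    by have [_] := TP i j ijT; rewrite mxE => ->; apply: rpred1.
  have ijE : (i, j) \in E by rewrite !inE ijT.
  apply/rat_predP; have := rat_in_gen iota y (enum_rank_in ijE (i, j)).
  by rewrite /y enum_rankK_in.
have emX z q : em (z ^+ q) = em z ^+ q.
  by elim: q => [|q IHq]; rewrite ?expr0 // !exprS emM IHq.
have rhoX z q : rho (z ^+ q) = rho z ^+ q.
  by elim: q => [|q IHq]; rewrite ?expr0 // !exprS rhoM IHq.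
have B0X z q : B0 z -> B0 (z ^+ q).
  by move=> zB; elim: q => [|q IHq]; rewrite ?expr0 // exprS; apply: B0M.
(* The diagonal entries of [th] are those of [a ^+ p], and a diagonal conjugation leaves them
   unchanged. *)
have B0th : B0 th.
  move=> i j; rewrite mxE rho_th mxE; case: eqP => [<-|_]; last first.
    by rewrite mulr0n mulr0 mul0r rpred0.
  by rewrite mulr1n mulrAC divff // mul1r mxE -rhoX -emX -rt_diag; apply: B0X.
have [ws [wsB ws_free ws_max]] : exists ws : seq AL,
    [/\ {in ws, forall z, B0 z}, free ws & forall z, B0 z -> z \in <<ws>>%VS].
  pose P q := `[< exists ws : seq AL, [/\ {in ws, forall z, B0 z}, free ws & size ws = q] >].
  have exP : exists q, P q by exists 0%N; apply/asboolP; exists [::]; rewrite nil_free.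
  have leP q : P q -> (q <= \dim {:AL})%N.
    by move=> /asboolP [ws [_ ws_free <-]]; rewrite -(eqP ws_free) dimvS ?subvf.
  case: (ex_maxnP exP leP) => _ /asboolP [ws [wsB ws_free <-]] maxq.
  exists ws; split=> // z zB; apply: contrapT => /negP z_ws.
  suff /maxq : P (size ws).+1 by rewrite ltnn.
  apply/asboolP; exists (z :: ws); split=> //=; last by rewrite free_cons z_ws.
  by move=> z'; rewrite inE => /orP [/eqP -> //|]; apply: wsB.
pose U := <<map em ws>>%VS.
have emU z : B0 z -> em z \in U.
  move=> /ws_max /(coord_span (X := in_tuple ws)) ->; rewrite emL.
  apply: memv_suml => i _; rewrite memvZ // memv_span //.
  by apply/map_f/mem_nth.
have UT : U = fullv.
  apply: full_subalg; rewrite ?emU // -?em1 ?emU //.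
  have U_span := coord_span (X := map_tuple em (in_tuple ws)).
  move=> z1 z2 /U_span -> /U_span ->.
  rewrite mulr_suml; apply: memv_suml => i _; rewrite mulr_sumr; apply: memv_suml => j _.
  rewrite -scalerAl -scalerAr !memvZ //= !(nth_map 0) // -emM emU //.
  by apply: B0M; apply: wsB; apply: mem_nth.
(* [ws] stays free over [F], where it spans [B]. *)
have ws_size : size ws = (n.+1 ^ 2)%N.
  have em_free : free (map_tuple em (in_tuple ws)).
    have ws_free' (c : 'I_(size ws) -> L) : \sum_i c i *: ws`_i = 0 -> forall i, c i = 0.
      by have /freeP := ws_free : free (in_tuple ws); apply.
    apply/freeP => c sum0; apply: (@scalar_ext_map_free _ _ _ h g f A _ _ ws_free').
    by rewrite -[RHS]sum0; apply: eq_bigr => i _; rewrite (nth_map 0).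
  have := eqP em_free; rewrite /= -/U UT dim_scalar_ext csa_degree size_map => <-.
  by [].
pose w (l : 'I_(n.+1 ^ 2)) := ws`_l.
have wB l : B0 (w l) by apply/wsB/mem_nth; rewrite ws_size.
pose wt : (n.+1 ^ 2).-tuple AL := Tuple (introT eqP ws_size).
have wt_free : free wt by [].
have w_free (c : 'I_(n.+1 ^ 2) -> L) : \sum_l c l *: w l = 0 -> forall l, c l = 0.
  by have /freeP := wt_free; apply.
have wt_basis : basis_of {:AL} wt.
  by rewrite basisEfree wt_free subvf dim_scalar_ext csa_degree size_tuple /=.
have [tau tauE] := choice rho_tr.
have tau_sum (c : 'I_(n.+1 ^ 2) -> L) (z : 'I_(n.+1 ^ 2) -> AL) :
    tau (\sum_l c l *: z l) = \sum_l c l * tau (z l).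
  apply: (fmorph_inj g); rewrite -tauE emL rho_sum raddf_sum rmorph_sum.
  by apply: eq_bigr => l _; rewrite rhoZ /= mxtraceZ tauE rmorphM.
have tauB z : B0 z -> tau z \in LM.
  move=> zB; apply: FM_LM; rewrite -tauE /mxtrace rpred_sum // => i _.
  by rewrite -rt_diag.
pose G : 'M[L]_(n.+1 ^ 2) := \matrix_(i, j) tau (w i * w j).
(* A kernel vector gives a [z] with trace zero against [ws], hence against all of [B], which [ws]
   spans over [F]; testing with matrix units gives [z = 0]. *)
have G_unit : G \in unitmx.
  rewrite -row_free_unit -kermx_eq0; apply/rowV0P => v /sub_kermxP vG.
  pose z := \sum_l v 0 l *: w l.
  have tau_z z' : tau (z * z') = 0.
    have tau_zw l : tau (z * w l) = 0.
      rewrite mulr_suml; under eq_bigr do rewrite -scalerAl.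
      have /rowP/(_ l) := vG; rewrite !mxE => vGl; rewrite tau_sum -[RHS]vGl.
      by apply: eq_bigr => j _; rewrite [in RHS]mxE.
    rewrite (coord_basis wt_basis (memvf z')) mulr_sumr.
    under eq_bigr do rewrite -scalerAr.
    by rewrite tau_sum big1 // => l _; rewrite tau_zw mulr0.
  have tr_z x : \tr (rho (em z * x)) = 0.
    have : x \in U by rewrite UT memvf.
    move=> /(coord_span (X := map_tuple em (in_tuple ws))) ->.
    rewrite mulr_sumr rho_sum raddf_sum big1 // => l _.
    rewrite -scalerAr rhoZ /= mxtraceZ (nth_map 0) // -emM tauE tau_z rmorph0.
    by rewrite mulr0.
  have z0 : z = 0.
    apply: (@scalar_ext_map_inj _ _ _ h g f A); rewrite raddf0; apply: rho_inj; rewrite rho0.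
    apply/matrixP => i j; rewrite mxE.
    have [x xE] := rho_surj (delta_mx j i).
    have := tr_z x; rewrite rhoM xE mxtrace_mulC /mxtrace.
    rewrite (bigD1 j) //= big1 ?addr0 => [|j' j'j].
      rewrite mxE (bigD1 i) //= big1 ?addr0 => [|i' i'i]; rewrite mxE ?eqxx ?mul1r //.
      by rewrite (negPf i'i) andbF mul0r.
    by rewrite mxE big1 // => i' _; rewrite mxE (negPf j'j) mul0r.
  by apply/rowP => l; rewrite mxE; apply: (w_free (fun l => v 0 l)).
have LM_lift c : c \in LM -> exists c' : mid_ext M, mid_incl M c' = c.
  by move=> cM; exists (Subfield (S := mid_set M) cM).
have [G0 G0E] : exists G0 : 'M[mid_ext M]_(n.+1 ^ 2), map_mx (mid_incl M) G0 = G.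
  have /choice [Gc GcE] : forall ij : 'I_(n.+1 ^ 2) * 'I_(n.+1 ^ 2),
      exists c : mid_ext M, mid_incl M c = G ij.1 ij.2.
    by move=> [i j]; apply: LM_lift; rewrite mxE; apply/tauB/B0M.
  by exists (\matrix_(i, j) Gc (i, j)); apply/matrixP => i j; rewrite mxE [in LHS]mxE GcE.
have descB z : B0 z -> exists s, z = desc_in (mid_incl M) w s.
  move=> zB; pose c := \row_l coord wt l z.
  have /choice [r0 r0E] : forall l, exists r0 : mid_ext M, mid_incl M r0 = tau (z * w l).
    by move=> l; apply/LM_lift/tauB/B0M.
  (* The traces of [z] against the [w l] determine its coordinates through the Gram matrix [G], and
     all these data lie in [M]. *)
  have cG : c *m G = map_mx (mid_incl M) (\row_l r0 l).
    apply/rowP => l; rewrite !mxE r0E [in RHS](coord_basis wt_basis (memvf z)) mulr_suml.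
    under [in RHS]eq_bigr do rewrite -scalerAl.
    by rewrite tau_sum; apply: eq_bigr => j _; rewrite !mxE.
  exists ((\row_l r0 l) *m invmx G0).
  rewrite {1}(coord_basis wt_basis (memvf z)); apply: eq_bigr => l _; congr (_ *: _).
  have : c = map_mx (mid_incl M) ((\row_l r0 l) *m invmx G0).
    by rewrite map_mxM map_invmx G0E -cG mulmxK.
  by move/rowP/(_ l); rewrite !mxE.
have [one oneE] := descB 1 B01.
have /choice [s sE] : forall ij : 'I_(n.+1 ^ 2) * 'I_(n.+1 ^ 2),
    exists s, w ij.1 * w ij.2 = desc_in (mid_incl M) w s.
  by move=> [i j]; apply/descB/B0M.
exists M; split.
  exact: (csa_descent (B := csa_ext h A) w_free (esym oneE) (fun i j => sE (i, j))).
move=> e x x_indep; rewrite -cE.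
apply: (alg_indep_rat_in (E := mid_ext M) (g := g \o mid_incl M) (y := y) _ x_indep).
by move=> i; have /rat_predP := valP (x i).
Qed.
End MidDescent.

(** * Galois action on the roots; infinite and finite centres *)

Lemma scalar_ext_horner (K F : fieldType) (f : {rmorphism K -> F}) (A : falgType K) x q :
  scalar_ext_in f (horner_alg (x : A) q) = horner_alg (scalar_ext_in f x) (map_poly f q).
Proof.
elim/poly_ind: q => [|q c IHq]; first by rewrite !raddf0.
rewrite !rmorphD !rmorphM /= !map_polyX !map_polyC /= !horner_algX !horner_algC.
by rewrite scalar_ext_inZ IHq.
Qed.

Lemma scalar_ext_horner_free (K F : fieldType) (f : {rmorphism K -> F}) (A : falgType K)
    n (x : A) :
  (forall q : {poly K}, (size q <= n)%N -> horner_alg x q = 0 -> q = 0) ->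
  forall q : {poly F}, (size q <= n)%N -> horner_alg (scalar_ext_in f x) q = 0 -> q = 0.
Proof.
move=> x_free q q_size q_root.
have pw_free (c : 'I_n -> K) : \sum_i c i *: x ^+ i = 0 -> forall i, c i = 0.
  move=> sum0 i; pose c' j := oapp c 0 (insub j).
  have c'E (j : 'I_n) : c' j = c j by rewrite /c' valK.
  rewrite -c'E -[RHS](coef0 K i) -(x_free (\poly_(j < n) c' j)) ?size_poly //.
    by rewrite coef_poly ltn_ord.
  rewrite poly_def linear_sum -[RHS]sum0; apply: eq_bigr => j _.
  by rewrite c'E linearZ /= rmorphXn /= horner_algX mulr_algl.
have iotaX j : scalar_ext_in f x ^+ j = scalar_ext_in f (x ^+ j).
  by elim: j => [|j IHj]; rewrite ?expr0 // !exprS IHj [RHS]scalar_ext_inM.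
have q_free := scalar_ext_in_free (f := f) pw_free.
apply/polyP => i; rewrite coef0; have [ltin|lein] := ltnP i n; last first.
  by rewrite nth_default // (leq_trans q_size).
apply: (q_free (fun j => q`_j) _ (Ordinal ltin)).
rewrite -[RHS]q_root -[q in RHS]coefK poly_def linear_sum /=.
rewrite (big_ord_widen n (fun i => horner_alg (scalar_ext_in f x) (q`_i *: 'X^i)) q_size).
rewrite [RHS]big_mkcond; apply: eq_bigr => j _.
case: ltnP => [_|/(nth_default 0) ->]; last by rewrite scale0r.
by rewrite linearZ /= [in RHS]rmorphXn /= horner_algX mulr_algl iotaX.
Qed.

Section GaloisAct.
Variables (K : fieldType) (F : splittingFieldType K) (n : nat) (l : 'I_n -> F) (q : {poly K}).
Hypothesis l_inj : injective l.
Hypothesis qE : map_poly (in_alg F) q = \prod_i ('X - (l i)%:P).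

Lemma gal_alg (s : gal_of {:F}) (a : K) : s (a%:A) = a%:A.
Proof. by rewrite linearZ /= rmorph1. Qed.

Lemma ex_gal_root i (s : gal_of {:F}) : exists j, s (l i) = l j.
Proof.
have : root (map_poly (in_alg F) q) (s (l i)).
  rewrite (_ : map_poly _ q = map_poly s (map_poly (in_alg F) q)).
    rewrite fmorph_root qE /root horner_prod (bigD1 i) //= hornerXsubC subrr.
    by rewrite mul0r eqxx.
  by rewrite -map_poly_comp; apply: eq_map_poly => a; rewrite /= gal_alg.
rewrite qE /root horner_prod => /eqP/eqP; rewrite prodf_seq_eq0 => /hasP [j _].
by rewrite /= hornerXsubC subr_eq0 => /eqP; exists j.
Qed.

Lemma ex_gal_action : exists to : {action gal_of {:F} &-> 'I_n},
  forall i (s : gal_of {:F}), s (l i) = l (to i s).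
Proof.
have /choice [t tP] : forall u : 'I_n * gal_of {:F}, exists j, u.2 (l u.1) = l j.
  by move=> [i s]; apply: ex_gal_root.
pose to i s := t (i, s).
have toP i (s : gal_of {:F}) : s (l i) = l (to i s) := tP (i, s).
have to1 i : to i 1%g = i by apply: l_inj; rewrite -toP gal_id.
have toM i (s s' : gal_of {:F}) : to i (s * s')%g = to (to i s) s'.
  by apply: l_inj; rewrite -!toP galM ?memvf.
by exists (TotalAction to1 toM).
Qed.
End GaloisAct.

Lemma ex_descent_infinite (k : fieldType) (K : fieldExt k) p r n (A : csa K n.+1) :
  prime p -> n.+1 = (p ^ r.+2)%N -> infinite_field K ->
  exists L : fieldExtType K, coprime p (\dim {:L}) /\ exists M : midField (fin_ext L),
    (exists A0 : csa (mid_ext M) n.+1,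
       alg_iso (csa_ext (mid_incl M) A0) (csa_ext (fin_incl L) A)) /\
    forall e (x : 'I_e -> mid_ext M), alg_indep x -> (e <= n.+1 * p ^ r.+1 - n)%N.
Proof.
move=> p_pr nE infK; have p_gt0 := prime_gt0 p_pr.
have [x [mu [mu_monic mu_size mu_sep mu_x x_free]]] := csa_separable_elt A infK.
have [F [l [l_inj muE galF]]] := ex_splitting_roots mu_monic mu_sep mu_size.
have [to toP] := ex_gal_action l_inj muE.
have [P sylP] := Sylow_exists p 'Gal({:F} / 1%AS)%G.
have [b [b_lt b_card b_shift]] := ex_blocks to p_pr (pHall_pgroup sylP) nE.
pose L : fieldExtType K := subvs_of (fixedField P).
exists L; split.
  have -> : \dim {:L} = #|'Gal({:F} / 1) : P|%g.
    rewrite -(dim_fixed_galois galF (pHall_sub sylP)) dimv1 divn1.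
    by rewrite dimvf.
  rewrite prime_coprime // -p'natE //.
  by have /and3P [] := sylP.
pose f : {rmorphism K -> F} := in_alg F.
pose T := {s : gal_of {:F} | s \in P}.
pose S (t : T) : {rmorphism F -> F} := gal_repr (val t).
pose h : {rmorphism K -> fin_ext L} := fin_incl L.
pose g : {rmorphism fin_ext L -> F} := (vsval : L -> F).
have f_gh : f =1 g \o h by move=> c; rewrite /= algid1.
have S_g (t : T) c : S t (g c) = g c.
  by have [_ c_fix] := mem_fixedFieldP (subvsP c); apply: c_fix (valP t).
have S_ex c : (forall t, S t c = c) -> exists c', c = g c'.
  move=> c_fix; have cP : c \in fixedField P.
    by apply/fixedFieldP => [|s sP]; rewrite ?memvf // (c_fix (Sub s sP)).
  by exists (Subvs cP).
have S_l (t : T) i : S t (l i) = l (to i (val t)) := toP i (val t).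
have x_root : horner_alg (scalar_ext_in f x) (\prod_j ('X - (l j)%:P)) = 0.
  by rewrite -muE -scalar_ext_horner mu_x raddf0.
have x_freeF := scalar_ext_horner_free (f := f) x_free.
pose R := block_succ p b.
have R_act (t : T) i j : R (to i (val t)) (to j (val t)) = R i j.
  have [c bc] := b_shift _ (valP t).
  exact: (block_succ_shift b_lt (g := fun i => to i (val t)) bc).
have R_cycle i i' : i != i' -> exists X : 'M[F]_n.+1,
    [/\ forall j l, ~~ R j l -> X j l = 0, (X ^+ p) i i = 1 & (X ^+ p) i' i' = 0].
  (* The exponent of [p] in the degree being at least [2], the blocks have [p ^ r.+1 > 1]
     elements. *)
  by apply: (ex_cycle_mx F p_gt0 b_lt b_card); rewrite -(expn0 p) ltn_exp2l ?prime_gt1.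
have [rho [rho_iso rho_tr [a [th [rho_a a_inj rho_th]]]]] :=
  ex_galois_generators f_gh S_g S_ex l_inj (fun t => act_inj to (val t)) S_l x_root x_freeF
    infK R_act R_cycle.
have pr_gt0 : (0 < p ^ r.+1)%N by rewrite expn_gt0 p_gt0.
have [M [A0_ex M_indep]] := ex_mid_descent f_gh
  (block_succ_closed p_gt0 b_lt b_card pr_gt0) rho_iso rho_tr rho_a a_inj rho_th.
exists M; split=> // e y /M_indep; rewrite -/R.
by rewrite (card_block_succ p_gt0 b_card).
Qed.

(** Here [M] is the whole field: among finitely many elements the powers of [z] repeat, so every [z]
    is a root of some ['X ^+ j - 'X ^+ i] and none is transcendental over [k]. *)
Lemma ex_descent_finite (k : fieldType) (K : fieldExt k) n (A : csa K n) :
  ~ infinite_field K ->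
  exists L : fieldExtType K, \dim {:L} = 1%N /\ exists M : midField (fin_ext L),
    (exists A0 : csa (mid_ext M) n,
       alg_iso (csa_ext (mid_incl M) A0) (csa_ext (fin_incl L) A)) /\
    forall e (x : 'I_e -> mid_ext M), alg_indep x -> e = 0%N.
Proof.
move=> /existsNP [s /forallNP s_all].
pose L : fieldExtType K := K^o; exists L; split; first by rewrite dimvf.
pose y (i : 'I_0) : L := 0.
(* Rational functions in no variables with constants in [L] present all of [L] as a subfield of
   itself. *)
have LM_all c : c \in rat_pred (@idfun L) y (@idfun L).
  by apply/rat_predP/(rat_in_const (@idfun L)).
pose LM : divringClosed (fin_ext L) := rat_pred (@idfun L) y (@idfun L).
pose M : midField (fin_ext L) :=
  @MidField k (fin_ext L) LM (fun a => LM_all (ext_emb (fin_ext L) a)).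
have lift c : exists c' : mid_ext M, mid_incl M c' = c.
  by exists (Subfield (S := mid_set M) (LM_all c)).
exists M; split.
  pose B := csa_ext (fin_incl L) A.
  have dimB : size (vbasis {:B}) == (n ^ 2)%N by rewrite size_tuple csa_degree.
  pose wt : (n ^ 2).-tuple B := Tuple dimB.
  have wt_basis : basis_of {:B} wt by apply: vbasisP.
  have descB z : exists s, z = desc_in (mid_incl M) (fun l : 'I_(n ^ 2) => wt`_l) s.
    have /choice [c cE] : forall l, exists c : mid_ext M, mid_incl M c = coord wt l z.
      by move=> l; apply: lift.
    exists (\row_l c l); rewrite {1}(coord_basis wt_basis (memvf z)).
    by apply: eq_bigr => l _; rewrite mxE cE.
  have [one oneE] := descB 1.
  have /choice [t tE] : forall ij : 'I_(n ^ 2) * 'I_(n ^ 2), exists t,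
      wt`_(ij.1) * wt`_(ij.2) = desc_in (mid_incl M) (fun l : 'I_(n ^ 2) => wt`_l) t.
    by move=> ij; apply: descB.
  apply: (csa_descent (B := B) _ (esym oneE) (fun i j => tE (i, j))).
  by have /freeP := basis_free wt_basis; apply.
case=> // e x x_indep; pose z := mid_incl M (x ord0).
have /(uniqPn 0) [i [j []]] : ~~ uniq [seq z ^+ i | i <- iota 0 (size s).+1].
  apply/negP => z_uniq; have : (size [seq z ^+ i | i <- iota 0 (size s).+1] <= size s)%N.
    by apply: uniq_leq_size z_uniq _ => c _; apply: contrapT => /negP /s_all.
  by rewrite size_map size_iota ltnn.
rewrite size_map size_iota => ij js.
rewrite !(nth_map 0%N) ?size_iota ?(ltn_trans ij) // !nth_iota ?(ltn_trans ij) // !add0n => zij.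
pose P : {mpoly k[e.+1]} := 'X_ord0 ^+ j - 'X_ord0 ^+ i.
have /mpolyP/(_ (U_(ord0) *+ j)%MM) : P = 0.
  have xE : mmap (ext_emb (mid_ext M)) x 'X_ord0 = x ord0.
    exact: etrans (mmapX _ _ _) (mmap1U _ _).
  apply: x_indep; rewrite /P rmorphB !rmorphXn /= xE.
  by apply: (fmorph_inj (mid_incl M)); rewrite rmorphB !rmorphXn /= -zij subrr.
rewrite mcoeffB !mcoeffXn eqxx mcoeff0 => /eqP; rewrite subr_eq0.
case: (eqVneq (U_(ord0) *+ i)%MM _) => [/mnmP eqU _|_]; last by rewrite oner_eq0.
by have := eqU ord0; rewrite !mulmnE mnm1E eqxx !mul1n => eq_ij; rewrite eq_ij ltnn in ij.
Qed.

(* Imported only now, as [classical_sets] shadows names of [finset]. *)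
From mathcomp Require Import classical_sets reals ereal.
Import Num.Theory Order.TTheory.

Theorem corollary1p2 (R : realType) (k : fieldType) (p r n : nat) :
  prime p -> (2 <= r)%N -> n = (p ^ r)%N ->
  (ed_PGL R k n p <=
     ((p ^ (2 * r - 1))%:R - (p ^ r)%:R + 1 : R)%:E)%E.
Proof.
move=> p_pr; case: r => [|[|r]] // _ nE; have p_gt0 := prime_gt0 p_pr.
have n_gt0 : (0 < n)%N by rewrite nE expn_gt0 p_gt0.
(* After the case analysis the exponent is [r.+2], so [p ^ r.+1] is the block size [n / p]. *)
have -> : (p ^ (2 * r.+2 - 1) = n * p ^ r.+1)%N.
  by rewrite nE -expnD mul2n -addnn addnS subn1.
rewrite -nE; case: n n_gt0 nE => // n _ nE; pose N := (n.+1 * p ^ r.+1 - n)%N.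
(* The degree is now [n.+1], and the subtraction in [N] does not truncate. *)
have -> : (n.+1 * p ^ r.+1)%:R - n.+1%:R + 1 = N%:R :> R.
  rewrite natrB; last by apply: (leq_trans (leqnSn n)); rewrite leq_pmulr // expn_gt0 p_gt0.
  by rewrite -[n.+1 in X in _ - X]addn1 natrD opprD addrA subrK.
apply: ge_ereal_sup => _ [K [C ->]].
have [A ->] := class_of_surj C.
suff [L [L_coprime [M [[A0 A0P] M_indep]]]] :
    exists L : fieldExtType K, coprime p (\dim {:L}) /\ exists M : midField (fin_ext L),
    (exists A0 : csa (mid_ext M) n.+1,
       alg_iso (csa_ext (mid_incl M) A0) (csa_ext (fin_incl L) A)) /\
    forall e (x : 'I_e -> mid_ext M), alg_indep x -> (e <= N)%N.
  pose AL := Defs.fmap (H1_PGL k n.+1) (fin_incl L) (class_of A).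
  have le_ed : (@ed_at R k (H1_PGL k n.+1) p K (class_of A) <= ed R AL)%E.
    by apply: ereal_inf_lbound; exists L.
  have le_trdeg : (ed R AL <= trdeg R (mid_ext M))%E.
    apply: ereal_inf_lbound; exists M, (class_of A0); split=> //=.
    by rewrite /AL /= !class_extE; apply/class_ofP.
  apply: (le_trans le_ed); apply: (le_trans le_trdeg).
  apply: ge_ereal_sup => _ [e [x x_indep] <-].
  by rewrite lee_fin ler_nat; apply: M_indep x_indep.
have [K_inf|/(ex_descent_finite A) [L [L1 [M [A0_ex M_indep]]]]] := pselect (infinite_field K).
  exact: ex_descent_infinite.
exists L; rewrite L1 coprimen1; split=> //; exists M; split=> // e x /M_indep ->.
exact: leq0n.
Qed.
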